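(* Let $d\in\mathbb{N}$, let $r>-1/2$ be fixed, let $f\in L^2$ have the expansion $$f(x,t)=\sum_{k,j=0}^{\infty}b_{k,j}\,H_k(t)\,C_j^{r}(x),\qquad (x,t)\in[-1,1]\times\mathbb{R},$$ and let $\eta\in\mathbb{R}_+$ be given. Then $f\in W^{\eta}$ if and only if $$\sum_{k,j=0}^{\infty}|b_{k,j}|^2\,k^{\eta}\, j^{\,d-1+2\eta}<\infty,$$ i.e. $$\|f\|_{W^\eta}^2\simeq\sum_{k,j=0}^{\infty}|b_{k,j}|^2\,k^{\eta}\, j^{\,d-1+2\eta}$$ is an equivalent norm in $W^\eta$. For $\psi\in W^n$, $n\in\mathbb{N}$, with spatio-temporal Hermite power spectrum $\{\alpha_{k,j}\}_{k,j}$, i.e. $$\psi(x,t)=\sum_{j=0}^\infty\dim(\mathcal{H}_j^d)\sum_{k=0}^\infty\alpha_{k,j}\,H_k(t)\,c_j(d,x),\qquad (x,t)\in[-1,1]\times\mathbb{R},$$ the equivalence is reduced to: $\{\alpha_{k,j}\,k^{n/2}j^{(d-1)/2+n},\ k,j\in\mathbb{N}\}$ is in $\ell^2(\mathbb{N}^2)$ if and only if $\frac{\partial^n}{\partial t^n}\frac{\partial^n}{\partial x^n}\psi(x,t)\,(1-x^2)^{(d-2)/4+n/2}$ is in $L^2((-1,1)\times\mathbb{R})$. Rephrased, $$\sum_{k,j=n}^{\infty}|\alpha_{k,j}|^2\,k^{n}\,j^{\,d-1+2n}<+\infty$$ if and only if $$\int_{\mathbb{R}}\int_{-1}^{1}\left|\frac{\partial^n}{\partial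 t^n}\frac{\partial^n}{\partial x^n}\psi(x,t)\right|^2(1-x^2)^{d/2-1+n}\,dx\,d\nu(t)<+\infty .$$
   Context: $\nu$ is the standard Gaussian measure on $\mathbb{R}$, and throughout $\mathbb{R}$ carries the measure $\nu$. $L^2$ denotes $L^2((-1,1)\times\mathbb{R})\cong L^2(-1,1)\otimes L^2(\mathbb{R})$, identified with the space $W^0=W^{0,0}$ below. $H_k(u)=\frac{(-1)^k}{(k!\sqrt{2\pi})^{1/2}}e^{u^2/2}\frac{d^k}{du^k}e^{-u^2/2}$, $k\ge0$, are the normalized Hermite polynomials. $C_j^r$ is the Gegenbauer polynomial of degree $j$ and order $r$; for fixed $r>-1/2$ the products $H_kC_j^r$ are used as a basis of $L^2$, and the coefficients of $f$ are written $b_{k,j}:=\int_{\mathbb{R}}\int_{-1}^1 f(x,t)H_k(t)C_j^r(x)\,dx\,d\nu(t)$, $k,j\in\mathbb{N}_0$. $c_j(d,x)=C_j^{(d-1)/2}(x)/C_j^{(d-1)/2}(1)$ is the standardized Gegenbauer polynomial. $\dim(\mathcal{H}_0^d)=1$ and $\dim(\mathcal{H}_j^d)=\frac{(2j+d-1)(j+d-2)!}{j!\,(d-1)!}$ for $j\ge1$ (dimension of the space $\mathcal{H}_j^d$ of spherical harmonics of degree $j$ on the unit sphere $\mathbb{S}^d\subset\mathbb{R}^{d+1}$). The function $\psi$ plays the role of the covariance kernel of an isotropic stationary Gaussian random field $Z$ on $\mathbb{S}^d\times\mathbb{R}$, meaning $\mathrm{cov}(Z(\mathbf{x},t),Z(\mathbf{y},s))=\psi(\langle\mathbf{x},\mathbf{y}\rangle_{\mathbb{R}^{d+1}},t-s)$;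 the coefficients $\alpha_{k,j}\in\mathbb{C}$ in its expansion above are called its spatio-temporal Hermite power spectrum. Spaces: for $n\in\mathbb{N}$ (and $n=0$), $W^n=W^{n,n}$ is the closure of $H^n(-1,1)\times H^n(\mathbb{R})$ (standard Sobolev spaces) with respect to the weighted norm $$\|f\|_{W^n}^2:=\sum_{j=0}^n\sum_{k=0}^n|f|_{W^{j,k}}^2,\qquad |f|_{W^{j,k}}^2:=\int_{\mathbb{R}}\int_{-1}^1\left|\frac{\partial^k}{\partial t^k}\frac{\partial^j}{\partial x^j}f(x,t)\right|^2(1-x^2)^{d/2-1+j}\,dx\,d\nu(t).$$ For $n<\eta<n+1$, $W^\eta:=(W^n,W^{n+1})_{\eta-n,2}$ is the interpolation space with norm $$\|f\|_{W^\eta}^2=\int_0^\infty\zeta^{-2(\eta-n)}|J(\zeta,f)|^2\frac{d\zeta}{\zeta},\qquad J(\zeta,f)=\inf_{f=v+w,\ v\in W^n,\ w\in W^{n+1}}\big(\|v\|_{W^n}+\zeta\|w\|_{W^{n+1}}\big),\ \zeta>0.$$ $A\simeq B$ means that $A$ and $B$ bound each other up to positive multiplicative constants.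
   Formalization: In part one, r must make the H_k C_j^r orthogonal in W^0 (so r=(d-1)/2), b_{k,j} is the W^0 inner product of f with H_k C_j^r/C_j^r(1), f expands with b_{k,j} over the squared norm, and the factors k^η, j^{d-1+2η} are 1 at index 0; as printed the claim is false. *)

(* Defs.v *)
From HB Require Import structures.
From mathcomp Require Import all_boot all_order all_algebra.
From mathcomp Require Import complex.
From mathcomp Require Import all_classical all_reals all_analysis.

Set Implicit Arguments.
Unset Strict Implicit.
Unset Printing Implicit Defensive.

Import Order.TTheory GRing.Theory Num.Theory.
Import numFieldNormedType.Exports.

Local Open Scope classical_set_scope.
Local Open Scope complex_scope.
Local Open Scope ring_scope.

(* The points of (-1,1) x R are the pairs (x, t) with -1 < x < 1.  Functions on
   it are total functions on R * R whose values elsewhere are never used. *)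
Definition strip (R : realType) : set (R * R) := [set p | -1 < p.1 < 1].
Arguments strip R : clear implicits.

Notation leb2 R := ((@lebesgue_measure R) \x (@lebesgue_measure R))%E.

(* dx dnu(t), with nu the standard Gaussian probability measure *)
Notation dxdnu R := ((@lebesgue_measure R) \x (normal_prob (0 : R) 1))%E.

Definition sqabs (R : realType) (z : R[i]) : R :=
  complex.Re z ^+ 2 + complex.Im z ^+ 2.

Definition hermite (R : realType) (k : nat) (u : R) : R :=
  (-1) ^+ k / Num.sqrt (k`!%:R * Num.sqrt (2 * pi)) * expR (u ^+ 2 / 2)
  * derive1n k (fun v : R => expR (- (v ^+ 2) / 2)) u.

(* The pair (C_j^r, C_{j+1}^r), by the recurrence
   (j+2) C_{j+2}^r = 2 (j+1+r) x C_{j+1}^r - (j+2r) C_j^r. *)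
Fixpoint gegenbauer_pair (R : realType) (r : R) (j : nat) : {poly R} * {poly R} :=
  if j is i.+1 then
    let: (P, Q) := gegenbauer_pair r i in
    (Q, (i.+2%:R)^-1 *: ((2 * (i.+1%:R + r)) *: ('X * Q) - (i%:R + 2 * r) *: P))
  else (1, (2 * r) *: 'X).

Fixpoint chebyshev_pair (R : realType) (j : nat) : {poly R} * {poly R} :=
  if j is i.+1 then
    let: (P, Q) := chebyshev_pair R i in (Q, 2%:R *: ('X * Q) - P)
  else (1, 'X).

(* At r = 0 the recurrence degenerates and the classical convention is the limit
   C_j^0 = lim_{r -> 0} C_j^r / r = (2 / j) T_j for j >= 1, and C_0^0 = 1. *)
Definition gegenbauer (R : realType) (r : R) (j : nat) : {poly R} :=
  if r == 0 then
    (if j is 0%N then 1 else (2 / j%:R) *: (chebyshev_pair R j).1)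
  else (gegenbauer_pair r j).1.

(* The standardization with value 1 at x = 1 (C_j^r(1) is nonzero for r > -1/2);
   c_j(d, x) is the case r = (d - 1)/2. *)
Definition gegenbauer_std (R : realType) (r : R) (j : nat) (x : R) : R :=
  (gegenbauer r j).[x] / (gegenbauer r j).[1].

(* dimension of the spherical harmonics of degree j on the sphere S^d, d >= 1 *)
Definition dim_harm (R : realType) (d j : nat) : R :=
  if j is 0%N then 1
  else ((2 * j + d - 1) * (j + d - 2)`!)%:R / (j`! * (d - 1)`!)%:R.

(* phi 0 0 is a smooth compactly supported function on the strip, and phi j k
   is its derivative of order j in x and k in t. *)
Definition test_jet2 (R : realType) (phi : nat -> nat -> R * R -> R) : Prop :=
  [/\ forall j k, continuous (phi j k),
      forall j k x t,
        is_derive x (1 : R) (fun y : R => phi j k (y, t)) (phi j.+1 k (x, t)),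
      forall j k x t,
        is_derive t (1 : R) (fun s : R => phi j k (x, s)) (phi j k.+1 (x, t)) &
      exists K : set (R * R),
        [/\ compact K, K `<=` strip R & forall p, ~ K p -> phi 0%N 0%N p = 0]].

Definition loc_integrable2 (R : realType) (u : R * R -> R) : Prop :=
  measurable_fun (strip R : set (measurableTypeR R * measurableTypeR R)) u /\
  forall K : set (R * R), compact K -> K `<=` strip R ->
    (\int[leb2 R]_(p in (K : set (measurableTypeR R * measurableTypeR R)))
       `|u p|%:E < +oo)%E.

Definition is_wderiv2_real (R : realType) (j k : nat) (u v : R * R -> R) : Prop :=
  [/\ loc_integrable2 u, loc_integrable2 v &
   forall phi, test_jet2 phi ->
     \int[leb2 R]_(p in strip R) (u p * phi j k p)
     = (-1) ^+ (j + k) * \int[leb2 R]_(p in strip R) (v p * phi 0%N 0%N p)].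

(* g is the weak derivative of f of order j in x and k in t *)
Definition is_wderiv2 (R : realType) (j k : nat) (f g : R * R -> R[i]) : Prop :=
  is_wderiv2_real j k (fun p => complex.Re (f p)) (fun p => complex.Re (g p)) /\
  is_wderiv2_real j k (fun p => complex.Im (f p)) (fun p => complex.Im (g p)).

Definition wderivable2 (R : realType) (j k : nat) (f : R * R -> R[i]) : Prop :=
  exists g, is_wderiv2 j k f g.

Definition wderiv2 (R : realType) (j k : nat) (f : R * R -> R[i]) : R * R -> R[i] :=
  xget (fun=> 0) [set g | is_wderiv2 j k f g].

Definition test_fun1 (R : realType) (I : set R) (phi : R -> R) : Prop :=
  (forall m x, derivable (derive1n m phi) x 1) /\
  exists K : set R,
    [/\ compact K, K `<=` I & forall x, ~ K x -> phi x = 0].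

Definition is_wderiv1_real (R : realType) (I : set R) (m : nat) (u v : R -> R) : Prop :=
  [/\ locally_integrable I u, locally_integrable I v &
   forall phi, test_fun1 I phi ->
     \int[@lebesgue_measure R]_(x in I) (u x * derive1n m phi x)
     = (-1) ^+ m * \int[@lebesgue_measure R]_(x in I) (v x * phi x)].

Definition is_wderiv1 (R : realType) (I : set R) (m : nat) (f g : R -> R[i]) : Prop :=
  is_wderiv1_real I m (fun x => complex.Re (f x)) (fun x => complex.Re (g x)) /\
  is_wderiv1_real I m (fun x => complex.Im (f x)) (fun x => complex.Im (g x)).

(* H^n(I) *)
Definition sobolev (R : realType) (n : nat) (I : set R) (f : R -> R[i]) : Prop :=
  forall m, (m <= n)%N -> exists g, is_wderiv1 I m f g /\
    (\int[@lebesgue_measure R]_(x in I) (sqabs (g x))%:E < +oo)%E.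

(* The tensor product of H^n(-1,1) and H^n(R), as functions on the strip *)
Definition sobolev_tensor (R : realType) (n : nat) (f : R * R -> R[i]) : Prop :=
  exists (m : nat) (g h : 'I_m -> R -> R[i]),
    [/\ forall i, sobolev n `]-1, 1[ (g i),
        forall i, sobolev n setT (h i) &
        forall p, strip R p -> f p = \sum_(i < m) g i p.1 * h i p.2].

Definition jweight (R : realType) (d j : nat) (x : R) : R :=
  (1 - x ^+ 2) `^ (d%:R / 2 - 1 + j%:R).

Definition wint (R : realType) (d j : nat) (f : R * R -> R[i]) : \bar R :=
  (\int[dxdnu R]_(p in strip R) (sqabs (f p) * jweight d j p.1)%:E)%E.

Definition wseminorm2 (R : realType) (d j k : nat) (f : R * R -> R[i]) : \bar R :=
  if `[< wderivable2 j k f >] then wint d j (wderiv2 j k f) else +oo%E.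

Definition Wn_norm2 (R : realType) (d n : nat) (f : R * R -> R[i]) : \bar R :=
  (\sum_(j < n.+1) \sum_(k < n.+1) wseminorm2 d j k f)%E.

(* The ambient normed space in which the closure is taken consists of the f with
   finite norm; it is complete. *)
Definition Wn (R : realType) (d n : nat) (f : R * R -> R[i]) : Prop :=
  (Wn_norm2 d n f < +oo)%E /\
  forall e : R, 0 < e -> exists g, sobolev_tensor n g /\
    (Wn_norm2 d n (fun p => (f p - g p)%R) < e%:E)%E.

Definition Kfun (R : realType) (d n : nat) (zeta : R) (f : R * R -> R[i]) : \bar R :=
  ereal_inf [set y : \bar R | exists v w : R * R -> R[i],
    [/\ Wn d n v, Wn d n.+1 w, forall p, strip R p -> f p = v p + w p &
        y = (sqrte (Wn_norm2 d n v) + zeta%:E * sqrte (Wn_norm2 d n.+1 w))%E]].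

Definition interp_norm2 (R : realType) (d n : nat) (theta : R)
    (f : R * R -> R[i]) : \bar R :=
  (\int[@lebesgue_measure R]_(zeta in `]0%R, +oo[)
     ((zeta `^ (- 2 * theta) / zeta)%:E * (Kfun d n zeta f) ^+ 2))%E.

(* For eta >= 0, Num.truncn eta is the integer part of eta. *)
Definition W_norm2 (R : realType) (d : nat) (eta : R) (f : R * R -> R[i]) : \bar R :=
  let n := Num.truncn eta in
  if eta == n%:R then Wn_norm2 d n f else interp_norm2 d n (eta - n%:R) f.

(* For integer eta this is Wn; otherwise it is the interpolation space of
   W^n + W^{n+1} = W^n and W^{n+1}. *)
Definition Wspace (R : realType) (d : nat) (eta : R) (f : R * R -> R[i]) : Prop :=
  Wn d (Num.truncn eta) f /\ (W_norm2 d eta f < +oo)%E.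

Definition HG (R : realType) (r : R) (k j : nat) (p : R * R) : R :=
  hermite k p.2 * gegenbauer_std r j p.1.

(* The products are an orthogonal system of L^2 = W^0, whose weight is
   (1 - x^2)^(d/2 - 1).  Among r > -1/2 this holds exactly for r = (d - 1)/2. *)
Definition HG_orthogonal (R : realType) (d : nat) (r : R) : Prop :=
  forall k j k' j' : nat, (k, j) <> (k', j') ->
    \int[dxdnu R]_(p in strip R)
      (HG r k j p * HG r k' j' p * jweight d 0 p.1) = 0.

Definition HG_norm2 (R : realType) (d : nat) (r : R) (k j : nat) : R :=
  \int[dxdnu R]_(p in strip R) (HG r k j p ^+ 2 * jweight d 0 p.1).

(* b_{k,j}: the inner product of f with the basis element in L^2 = W^0.  As the
   basis is orthogonal but not normalized, the expansion of f has coefficients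
   b_{k,j} / HG_norm2 d r k j. *)
Definition HG_coef (R : realType) (d : nat) (r : R) (f : R * R -> R[i])
    (k j : nat) : R[i] :=
  (\int[dxdnu R]_(p in strip R)
     (complex.Re (f p) * HG r k j p * jweight d 0 p.1))
  +i* (\int[dxdnu R]_(p in strip R)
     (complex.Im (f p) * HG r k j p * jweight d 0 p.1)).

(* f = sum_{k,j} a_{k,j} HG_{k,j}, in the sense of L^2 = W^0 *)
Definition HG_expansion (R : realType) (d : nat) (r : R)
    (a : nat -> nat -> R[i]) (f : R * R -> R[i]) : Prop :=
  (fun N : nat => wint d 0 (fun p => f p -
     \sum_(k < N) \sum_(j < N) a k j * (HG r k j p)%:C)) @ \oo --> 0%E.

(* k^s, except that the index 0 has weight 1: with weight 0 at k = 0 or j = 0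
   the sums would not see the terms constant in t or in x, and would not be
   norms. *)
Definition index_pow (R : realType) (k : nat) (s : R) : R := (maxn k 1)%:R `^ s.

Definition HG_sum (R : realType) (d : nat) (eta : R) (b : nat -> nat -> R[i]) : \bar R :=
  (\sum_(0 <= k <oo) \sum_(0 <= j <oo)
     (sqabs (b k j) * index_pow k eta * index_pow j (d%:R - 1 + 2 * eta))%:E)%E.

(* membership in l^2(N^2), N = {1, 2, ...} *)
Definition in_l2 (R : realType) (a : nat -> nat -> R[i]) : Prop :=
  (\sum_(1 <= k <oo) \sum_(1 <= j <oo) (sqabs (a k j))%:E < +oo)%E.

(* membership in the unweighted L^2((-1,1) x R), R carrying nu *)
Definition in_L2 (R : realType) (f : R * R -> R[i]) : Prop :=
  [/\ measurable_fun (strip R : set (measurableTypeR R * measurableTypeR R))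
        (fun p => complex.Re (f p)),
      measurable_fun (strip R : set (measurableTypeR R * measurableTypeR R))
        (fun p => complex.Im (f p)) &
      (\int[dxdnu R]_(p in strip R) (sqabs (f p))%:E < +oo)%E].

(* Main.v *)
(* Weak derivatives of the products H_k C_j are again orthogonal systems: by the
   Gegenbauer and Hermite equations, integrating by parts against the cut-off
   products turns one x-derivative (in the weight of index m+1) into the factor
   (j-m)(j+m+d-1) and one t-derivative into the factor k-l.  Iterating, the
   coefficients of the derivative of order (m,l) are those of f times
   [mode m l], and [mode m l] for m, l in {0,n} controls k^n j^(2n).  Bessel's
   inequality then bounds the weighted coefficient sum by the norm of W^n, and
   conversely the partial sums of the expansion are Cauchy in every seminorm, so
   that by completeness (Riesz-Fischer) their limits are the weak derivatives.
   The closure condition costs nothing: a polynomial times exp(-e t^2) belongs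
   to the tensor product of Sobolev spaces and tends to the polynomial.

   With A = k j^2 the K-functional satisfies
   K(z,f)^2 ~ sum k^n j^(2n) min(1, z^2 A) |f_kj|^2, the upper bound by putting
   the finitely many modes with z^2 A < 1 into the smooth part.  Integrating
   against z^(-2 theta - 1) gives the weight A^theta.

   Pairing H_0 C_0 with H_0 C_2 shows that orthogonality forces r = (d-1)/2, and
   then |H_k C_j|^2 is a constant multiple of 1 / dim H_j ~ j^(1-d).  In the last
   part psi is assumed to be in W^n, so both sides of each equivalence hold. *)
Require Import Defs.
From HB Require Import structures.
From mathcomp Require Import all_boot all_order all_algebra.
From mathcomp Require Import complex ring lra zify.
From mathcomp Require Import all_classical all_reals all_analysis.
From mathcomp Require Import measurable_realfun.

Set Implicit Arguments.
Unset Strict Implicit.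
Unset Printing Implicit Defensive.

Import Order.TTheory GRing.Theory Num.Theory.
Import numFieldNormedType.Exports.

Local Open Scope classical_set_scope.
Local Open Scope complex_scope.
Local Open Scope ring_scope.

(** * Weighted L2 spaces *)

(** [wderiv2] selects a weak derivative by choice, so no seminorm can be computed until the
    fundamental lemma of the calculus of variations makes the choice irrelevant almost everywhere;
    [wseminorm2E] is where this enters. Test functions live in Lebesgue measure, while the norms are
    weighted and each x-order has its own weight. The bridge is the density [rho d m]: a product of
    weight, polynomial and cut-off is itself a test function, and its x-derivative carries the
    weight of the next lower index, which is the self-adjoint form of the differentiated Gegenbauer
    equation. The cut-offs are built from exp(-1/y) at y = (n+1)(1-x^2) - 1: differentiating them
    costs a factor n+1, which is harmless only together with the 1 - x^2 left over from the weight.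
    Real and imaginary parts are treated separately and meet in [energy], the squared length of the
    projection on one mode, which does not depend on the normalization of the basis. The
    K-functional enters its integral only through pointwise bounds, since its measurability in zeta
    is never established. *)

Section weighted_L2.
Context d (T : measurableType d) (R : realType).
Variables (mu : {measure set T -> \bar R}) (D : set T) (w : T -> R).
Hypothesis mD : measurable D.
Hypothesis mw : measurable_fun D w.
Hypothesis w_ge0 : forall x, D x -> 0 <= w x.
Implicit Types u v : T -> R.

(** The integral of a nonnegative function is a supremum over the simple functions below it, hence
    monotone for arbitrary functions. The integrand of [interp_norm2] is controlled in this way, by
    pointwise bounds on [Kfun]. *)
Lemma le_integral_nomeas (E : set T) (f g : T -> \bar R) :
  (forall x, E x -> (0 <= f x)%E) -> (forall x, E x -> (f x <= g x)%E) ->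
  (\int[mu]_(x in E) f x <= \int[mu]_(x in E) g x)%E.
Proof.
move=> f0 fg; have g0 x : E x -> (0 <= g x)%E.
  by move=> Ex; exact: le_trans (f0 _ Ex) (fg _ Ex).
rewrite !ge0_integralE//; apply: ereal_sup_le => _ [h hf <-].
exists h => // x; apply: (le_trans (hf x)).
by rewrite /patch; case: ifPn => // /set_mem; exact: fg.
Qed.

Lemma subset_integral_nomeas (E F : set T) (f : T -> \bar R) :
  E `<=` F -> (forall x, F x -> (0 <= f x)%E) ->
  (\int[mu]_(x in E) f x <= \int[mu]_(x in F) f x)%E.
Proof.
move=> EF f0; rewrite integral_mkcond [leRHS]integral_mkcond.
apply: le_integral_nomeas => x _; rewrite /patch.
  by case: ifPn => // /set_mem /EF; exact: f0.
case: ifPn => [/set_mem /EF Fx|_]; first by rewrite mem_set.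
by case: ifPn => // /set_mem; exact: f0.
Qed.

Definition L2w u : Prop :=
  measurable_fun D u /\ (\int[mu]_(x in D) (u x ^+ 2 * w x)%:E < +oo)%E.

Definition ip u v : R := \int[mu]_(x in D) (u x * v x * w x).

(** Pointwise |uv| is at most u^2 + v^2, which is integrable against [w]. *)
Lemma L2w_integrable u v : L2w u -> L2w v ->
  mu.-integrable D (EFin \o (fun x => u x * v x * w x)).
Proof.
move=> [mu1 fu] [mv fv].
have muv : measurable_fun D (fun x => u x * v x * w x).
  by apply: measurable_funM => //; exact: measurable_funM.
apply/integrableP; split; first exact/measurable_EFinP.
have m2 (z : T -> R) : measurable_fun D z -> measurable_fun D (fun x => (z x ^+ 2 * w x)%:E).
  by move=> mz; apply/measurable_EFinP; apply: measurable_funM => //; exact: measurable_funX.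
apply: (@le_lt_trans _ _ (\int[mu]_(x in D) ((u x ^+ 2 * w x)%:E + (v x ^+ 2 * w x)%:E))%E).
  apply: le_integral_nomeas => x Dx /=; first by rewrite lee_fin.
  rewrite -EFinD lee_fin -mulrDl normrM (ger0_norm (w_ge0 Dx)) ler_wpM2r ?w_ge0//.
  rewrite ler_norml; apply/andP; split; nra.
rewrite ge0_integralD//; first exact: lte_add_pinfty.
- by move=> x Dx; rewrite lee_fin mulr_ge0 ?sqr_ge0 ?w_ge0.
- exact: m2.
- by move=> x Dx; rewrite lee_fin mulr_ge0 ?sqr_ge0 ?w_ge0.
- exact: m2.
Qed.

Lemma ip_fin u v : L2w u -> L2w v ->
  (ip u v)%:E = (\int[mu]_(x in D) (u x * v x * w x)%:E)%E.
Proof.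
move=> Lu Lv; rewrite /ip /Rintegral fineK//.
exact: (integrable_fin_num mD (L2w_integrable Lu Lv)).
Qed.

Lemma ip_sq u : L2w u ->
  (ip u u)%:E = (\int[mu]_(x in D) (u x ^+ 2 * w x)%:E)%E.
Proof. by move=> Lu; rewrite ip_fin//; apply: eq_integral => x _; rewrite -expr2. Qed.

Lemma eq_L2w u v : (forall x, D x -> u x = v x) -> L2w u -> L2w v.
Proof.
move=> uv [mu1 fu]; split.
  apply: eq_measurable_fun mu1 => x /set_mem; exact: uv.
rewrite (_ : integral _ _ _ = (\int[mu]_(x in D) (u x ^+ 2 * w x)%:E)%E)//.
by apply: eq_integral => x /set_mem Dx; rewrite uv.
Qed.

Lemma L2wD u v : L2w u -> L2w v -> L2w (fun x => u x + v x).
Proof.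
move=> Lu Lv; split; first by apply: measurable_funD; [case: Lu|case: Lv].
have -> : (\int[mu]_(x in D) ((u x + v x) ^+ 2 * w x)%:E =
   \int[mu]_(x in D) ((u x * u x * w x)%:E + ((u x * v x * w x)%:E + (u x * v x * w x)%:E
     + (v x * v x * w x)%:E)))%E.
  by apply: eq_integral => x _; rewrite -!EFinD; congr EFin; ring.
apply: (integrable_lty mD).
apply: (integrableD mD (L2w_integrable Lu Lu)).
apply: (integrableD mD _ (L2w_integrable Lv Lv)).
by apply: (integrableD mD); exact: L2w_integrable.
Qed.

Lemma L2wZ c u : L2w u -> L2w (fun x => c * u x).
Proof.
move=> Lu; split.
  by apply: measurable_funM => //; case: Lu.
have -> : (\int[mu]_(x in D) ((c * u x) ^+ 2 * w x)%:E =
   \int[mu]_(x in D) ((c ^+ 2)%:E * (u x * u x * w x)%:E))%E.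
  by apply: eq_integral => x _; rewrite -EFinM; congr EFin; ring.
apply: (integrable_lty mD); apply: (integrableZl mD _ (L2w_integrable Lu Lu)).
Qed.

Lemma L2w0 : L2w (fun=> 0).
Proof.
split => //; rewrite (_ : integral _ _ _ = 0%E) ?ltry//.
by apply: integral0_eq => x _; rewrite expr0n mul0r.
Qed.

Lemma L2wB u v : L2w u -> L2w v -> L2w (fun x => u x - v x).
Proof.
move=> Lu Lv; apply: (@eq_L2w (fun x => u x + (-1) * v x)); first by move=> x _; ring.
by apply: L2wD => //; exact: L2wZ.
Qed.

Lemma L2w_sum I (s : seq I) (P : pred I) (e : I -> T -> R) : (forall i, L2w (e i)) ->
  L2w (fun x => \sum_(i <- s | P i) e i x).
Proof.
move=> Le; elim: s => [|i s IH].
  by apply: (eq_L2w _ L2w0) => x _; rewrite big_nil.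
case Pi : (P i); last by apply: eq_L2w IH => x _; rewrite big_cons Pi.
by apply: eq_L2w (L2wD (Le i) IH) => x _; rewrite big_cons Pi.
Qed.

Lemma ipC u v : ip u v = ip v u.
Proof. by rewrite /ip; apply: eq_Rintegral => x _; rewrite (mulrC (u x)). Qed.

Lemma eq_ip u v u' v' : (forall x, D x -> u x = u' x) -> (forall x, D x -> v x = v' x) ->
  ip u v = ip u' v'.
Proof.
by move=> uu vv; apply: eq_Rintegral => x /set_mem Dx; rewrite uu// vv.
Qed.

Lemma ipDl u v z : L2w u -> L2w v -> L2w z ->
  ip (fun x => u x + v x) z = ip u z + ip v z.
Proof.
move=> Lu Lv Lz; rewrite /ip -RintegralD//; try exact: L2w_integrable.
by apply: eq_Rintegral => x _; ring.
Qed.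

Lemma ipZl c u v : L2w u -> L2w v -> ip (fun x => c * u x) v = c * ip u v.
Proof.
move=> Lu Lv; rewrite /ip -RintegralZl//; last exact: L2w_integrable.
by apply: eq_Rintegral => x _; ring.
Qed.

Lemma ipDr u v z : L2w u -> L2w v -> L2w z ->
  ip z (fun x => u x + v x) = ip z u + ip z v.
Proof. by move=> Lu Lv Lz; rewrite ipC ipDl// ![ip z _]ipC. Qed.

Lemma ipZr c u v : L2w u -> L2w v -> ip v (fun x => c * u x) = c * ip v u.
Proof. by move=> Lu Lv; rewrite ipC ipZl// ipC. Qed.

Lemma ipBl u v z : L2w u -> L2w v -> L2w z ->
  ip (fun x => u x - v x) z = ip u z - ip v z.
Proof.
move=> Lu Lv Lz.
rewrite (@eq_ip _ _ (fun x => u x + (-1) * v x) z) //; last by move=> x _; ring.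
rewrite ipDl ?ipZl//; last exact: L2wZ. by rewrite mulN1r.
Qed.

Lemma ipBr u v z : L2w u -> L2w v -> L2w z ->
  ip z (fun x => u x - v x) = ip z u - ip z v.
Proof. by move=> Lu Lv Lz; rewrite ipC ipBl// ![ip z _]ipC. Qed.

Lemma ip0l v : ip (fun=> 0) v = 0.
Proof.
rewrite /ip (@eq_Rintegral _ _ _ mu D (fun=> 0)); first last.
  by move=> x _; rewrite !mul0r.
by rewrite Rintegral_cst// mul0r.
Qed.

Lemma ip_suml I (s : seq I) (P : pred I) (e : I -> T -> R) v : (forall i, L2w (e i)) -> L2w v ->
  ip (fun x => \sum_(i <- s | P i) e i x) v = \sum_(i <- s | P i) ip (e i) v.
Proof.
move=> Le Lv; elim: s => [|i s IH].
  rewrite big_nil -[RHS](ip0l v); apply: eq_ip => x _ //.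
  by rewrite big_nil.
rewrite big_cons; case Pi : (P i); last first.
  by rewrite -IH; apply: eq_ip => x _ //; rewrite big_cons Pi.
rewrite -IH -ipDl//; last exact: L2w_sum.
by apply: eq_ip => x _ //; rewrite big_cons Pi.
Qed.

Lemma ip_ge0 u : 0 <= ip u u.
Proof.
by apply: Rintegral_ge0 => x Dx; rewrite mulr_ge0 ?w_ge0// -expr2 sqr_ge0.
Qed.

Lemma ipDD u v : L2w u -> L2w v ->
  ip (fun x => u x + v x) (fun x => u x + v x) = ip u u + 2 * ip u v + ip v v.
Proof.
move=> Lu Lv; have Luv := L2wD Lu Lv.
rewrite ipDl// !ipDr// (ipC v u); ring.
Qed.

Lemma ipDD_le u v : L2w u -> L2w v ->
  ip (fun x => u x + v x) (fun x => u x + v x) <= 2 * (ip u u + ip v v).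
Proof.
move=> Lu Lv; rewrite ipDD//.
have := ip_ge0 (fun x => u x - v x).
rewrite ipBl ?ipBr//; try exact: L2wB. rewrite (ipC v u); lra.
Qed.

Lemma ipBB_le u v : L2w u -> L2w v ->
  ip (fun x => u x - v x) (fun x => u x - v x) <= 2 * (ip u u + ip v v).
Proof.
move=> Lu Lv; have := ipDD_le Lu (L2wZ (-1) Lv).
have LZ := L2wZ (-1) Lv.
rewrite (@eq_ip _ _ (fun x => u x - v x) (fun x => u x - v x)).
- by rewrite ipZl// ipZr//; lra.
- by move=> x _; ring.
- by move=> x _; ring.
Qed.

Lemma ip_CS u v : L2w u -> L2w v -> ip u v ^+ 2 <= ip u u * ip v v.
Proof.
move=> Lu Lv.
have H a b : 0 <= a ^+ 2 * ip u u + 2 * a * b * ip u v + b ^+ 2 * ip v v.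
  have := ip_ge0 (fun x => a * u x + b * v x).
  have La := L2wZ a Lu; have Lb := L2wZ b Lv.
  rewrite ipDD// !(ipZl,ipZr)//; lra.
have U := ip_ge0 u; have V := ip_ge0 v.
have [U0|U0] := eqVneq (ip u u) 0.
  rewrite U0 mul0r.
  have [->|P0] := eqVneq (ip u v) 0; first by rewrite expr0n.
  (* With <u,u> = 0 the quadratic form is affine in its first argument; this choice gives it the
     value -1, a contradiction. *)
  have := H (- (ip v v + 1) / (2 * ip u v)) 1.
  rewrite U0 mulr0 add0r mulr1 expr1n mul1r.
  rewrite (_ : 2 * _ * _ = - (ip v v + 1)); last by field.
  lra.
have Up : 0 < ip u u by rewrite lt_neqAle eq_sym U0.
(* The component of v orthogonal to u, multiplied by <u,u> to avoid a division. *)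
have := H (- ip u v) (ip u u).
rewrite (_ : _ + _ = ip u u * (ip u u * ip v v - ip u v ^+ 2)); last by ring.
by rewrite pmulr_rge0// subr_ge0.
Qed.

(* Terms with [ip (e i) (e i) = 0] contribute [0], by the convention [x / 0 = 0]. *)
Lemma bessel (I : eqType) (s : seq I) (e : I -> T -> R) u : uniq s ->
  (forall i, L2w (e i)) -> (forall i j, i != j -> ip (e i) (e j) = 0) -> L2w u ->
  \sum_(i <- s) ip u (e i) ^+ 2 / ip (e i) (e i) <= ip u u.
Proof.
move=> us Le oe; elim: s us u => [|i s IH] /=; first by move=> _ u _; rewrite big_nil ip_ge0.
move=> /andP[nis us] u Lu; rewrite big_cons.
set c := ip u (e i) / ip (e i) (e i).
have Lc : L2w (fun x => c * e i x) by exact: L2wZ.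
pose v := fun x => u x - c * e i x.
have Lv : L2w v by exact: L2wB.
have vE j : j != i -> ip v (e j) = ip u (e j).
  by move=> ji; rewrite /v ipBl// ipZl// oe 1?eq_sym// mulr0 subr0.
rewrite (_ : \sum_(j <- s) _ = \sum_(j <- s) ip v (e j) ^+ 2 / ip (e j) (e j)); last first.
  rewrite !big_seq; apply: eq_bigr => j js; rewrite vE//.
  by apply: contraNneq nis => <-.
apply: (le_trans (lerD (lexx _) (IH us _ Lv))).
rewrite /v ipBl// !ipBr// !(ipZl,ipZr)// (ipC (e i) u) /c.
have [->|n0] := eqVneq (ip (e i) (e i)) 0; first by rewrite invr0; lra.
by rewrite le_eqVlt; apply/orP; left; apply/eqP; field.
Qed.

Lemma ip_sum_orth (I : eqType) (s : seq I) (e : I -> T -> R) (a : I -> R) : uniq s ->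
  (forall i, L2w (e i)) -> (forall i j, i != j -> ip (e i) (e j) = 0) ->
  ip (fun x => \sum_(i <- s) a i * e i x) (fun x => \sum_(i <- s) a i * e i x)
  = \sum_(i <- s) a i ^+ 2 * ip (e i) (e i).
Proof.
move=> us Le oe.
have La i : L2w (fun x => a i * e i x) by exact: L2wZ.
rewrite ip_suml//; last exact: L2w_sum.
rewrite !big_seq; apply: eq_bigr => i si; rewrite ipC ip_suml//.
rewrite (bigD1_seq i)//= big1 ?addr0.
  by rewrite ipZl// ipZr//; ring.
by move=> j ji; rewrite ipZl// ipZr// oe// !mulr0.
Qed.

End weighted_L2.

(** * Completeness of weighted L2: the Riesz-Fischer theorem *)

Section riesz_fischer.
Context d (T : measurableType d) (R : realType).
Variables (mu : {measure set T -> \bar R}) (D : set T) (w : T -> R).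
Hypothesis mD : measurable D.
Hypothesis mw : measurable_fun D w.
Hypothesis w_gt0 : forall x, D x -> 0 < w x.
Hypothesis w_fin : (\int[mu]_(x in D) (w x)%:E < +oo)%E.

Let w_ge0 x : D x -> 0 <= w x. Proof. by move=> Dx; exact: ltW (w_gt0 Dx). Qed.

Local Notation L2 := (L2w mu D w).
Local Notation dot := (ip mu D w).

Lemma nneseries_le (f : nat -> \bar R) m (C : \bar R) : (forall i, (0 <= f i)%E) ->
  (forall n, (\sum_(m <= i < n) f i <= C)%E) -> (\sum_(m <= i <oo) f i <= C)%E.
Proof.
move=> f0 fC; apply: lime_le; last by apply: nearW => n; exact: fC.
by apply: is_cvg_nneseries => i _ _.
Qed.

Lemma sum_half_le (n : nat) : \sum_(0 <= i < n) (2^-1 : R) ^+ i <= 2.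
Proof.
suff -> : \sum_(0 <= i < n) (2^-1 : R) ^+ i = 2 - 2 * 2^-1 ^+ n.
  by rewrite lerBlDr lerDl mulr_ge0// exprn_ge0.
elim: n => [|n IH]; first by rewrite big_geq// expr0; lra.
by rewrite big_nat_recr//= IH exprS; field.
Qed.

(** The total mass W being finite, increments of squared norm 4^-i have L1 norm at most 2^-i (W+1),
    so the telescoping series converges absolutely almost everywhere. The exceptional set is
    returned as the complement of a measurable [A], and the limit is set to 0 there so as to stay
    measurable on all of [D]. *)
Lemma riesz_fischer_subseq (v : nat -> T -> R) : (forall i, L2 (v i)) ->
  (forall i, dot (fun x => v i.+1 x - v i x) (fun x => v i.+1 x - v i x) <= (4^-1) ^+ i) ->
  exists A (g : T -> R), [/\ measurable A, mu (D `\` A) = 0%E, measurable_fun D g,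
    forall x, (D `\` A) x -> g x = 0 &
    forall x, D x -> A x -> v n x @[n --> \oo] --> g x].
Proof.
move=> Lv Hv.
pose W := fine (\int[mu]_(x in D) (w x)%:E).
have W0 : 0 <= W by apply: fine_ge0; apply: integral_ge0 => x Dx; rewrite lee_fin w_ge0.
have WE : (\int[mu]_(x in D) (w x)%:E = W%:E)%E.
  rewrite fineK// ge0_fin_numE//; apply: integral_ge0 => x Dx; rewrite lee_fin w_ge0//.
pose f i x := (`|v i.+1 x - v i x| * w x)%:E.
have mv i : measurable_fun D (v i) by case: (Lv i).
have mf i : measurable_fun D (f i).
  apply/measurable_EFinP; apply: measurable_funM => //.
  by apply: measurableT_comp => //; exact: measurable_funB.
have f0 i x : D x -> (0 <= f i x)%E by move=> Dx; rewrite lee_fin mulr_ge0 ?w_ge0.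
have IZ c (h : T -> R) : 0 <= c -> measurable_fun D h -> (forall x, D x -> 0 <= h x) ->
    (\int[mu]_(x in D) (c%:E * (h x)%:E) = c%:E * \int[mu]_(x in D) (h x)%:E)%E.
  move=> c0 mh h0; apply: ge0_integralZl => //; first exact/measurable_EFinP.
(* The inequality |z| <= 2^-i + 2^i z^2 balances the two scales: its second term integrates to at
   most 2^i 4^-i = 2^-i. *)
have If i : (\int[mu]_(x in D) f i x <= (2^-1 ^+ i * (W + 1))%:E)%E.
  apply: (@le_trans _ _ (\int[mu]_(x in D) ((2^-1 ^+ i)%:E * (w x)%:E
      + (2 ^+ i)%:E * ((v i.+1 x - v i x) ^+ 2 * w x)%:E))%E).
    apply: le_integral_nomeas => x Dx; first exact: f0.
    rewrite -!EFinM -EFinD lee_fin mulrA -mulrDl.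
    rewrite ler_wpM2r ?w_ge0// ler_norml.
    rewrite exprVn; set a := 2 ^+ i; set z := v i.+1 x - v i x.
    have a0 : 0 < a by rewrite exprn_gt0.
    have h1 : 0 <= a * (z + (2 * a)^-1) ^+ 2 by rewrite mulr_ge0 ?sqr_ge0// ltW.
    have h2 : 0 <= a * (z - (2 * a)^-1) ^+ 2 by rewrite mulr_ge0 ?sqr_ge0// ltW.
    have e1 : a * (z + (2 * a)^-1) ^+ 2 = a * z ^+ 2 + z + a^-1 / 4.
      by field; rewrite gt_eqF.
    have e2 : a * (z - (2 * a)^-1) ^+ 2 = a * z ^+ 2 - z + a^-1 / 4.
      by field; rewrite gt_eqF.
    have : 0 < a^-1 by rewrite invr_gt0.
    by move: h1 h2; rewrite e1 e2 => *; apply/andP; split; lra.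
  have LB : L2 (fun x => v i.+1 x - v i x) by exact: L2wB.
  rewrite ge0_integralD//.
  - rewrite !IZ ?exprn_ge0//; last 2 first.
    + by apply: measurable_funM => //; apply: measurable_funX; exact: measurable_funB.
    + by move=> x Dx; rewrite mulr_ge0 ?sqr_ge0 ?w_ge0.
    rewrite WE -(ip_sq mD mw w_ge0 LB) -!EFinM -EFinD lee_fin mulrDr mulr1 lerD2l.
    apply: (le_trans (ler_wpM2l _ (Hv i))); first by rewrite exprn_ge0.
    by rewrite -exprMn (_ : 2 * 4^-1 = 2^-1) //; field.
  - by move=> x Dx; rewrite lee_fin mulr_ge0 ?w_ge0// exprn_ge0.
  - by apply/measurable_EFinP; apply: measurable_funM.
  - by move=> x Dx; rewrite lee_fin mulr_ge0 ?exprn_ge0// mulr_ge0 ?sqr_ge0 ?w_ge0.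
  - apply/measurable_EFinP; apply: measurable_funM => //; apply: measurable_funM => //.
    by apply: measurable_funX; exact: measurable_funB.
pose S x := (\sum_(0 <= i <oo) f i x)%E.
have IS : (\int[mu]_(x in D) S x < +oo)%E.
  rewrite integral_nneseries//; apply: (@le_lt_trans _ _ (2 * (W + 1))%:E); last exact: ltry.
  apply: nneseries_le => [i|n]; first by apply: integral_ge0 => x; exact: f0.
  apply: (@le_trans _ _ (\sum_(0 <= i < n) (2^-1 ^+ i * (W + 1))%:E)%E).
    by apply: lee_sum => i _.
  rewrite sumEFin lee_fin -mulr_suml ler_wpM2r//; [lra|exact: sum_half_le].
have S0 x : D x -> (0 <= S x)%E by move=> Dx; apply: nneseries_ge0 => i _ _; exact: f0.
have mS : measurable_fun D S by apply: ge0_emeasurable_sum => //; move=> i x Dx _; exact: f0.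
have iS : mu.-integrable D S.
  apply/integrableP; split => //; rewrite (eq_integral S)//.
  by move=> x /set_mem Dx; rewrite gee0_abs// S0.
have [N [mN N0 subN]] := integrable_ae mD iS.
exists (~` N).
have cv x : D x -> (~` N) x -> cvgn (fun n => v n x).
  move=> Dx nNx.
  have Sfin : S x \is a fin_num.
    by apply: contrapT => h; apply: nNx; apply: subN => /= /(_ Dx).
  have cs : cvgn (series (telescope (fun n => v n x))).
    apply: normed_cvg; apply: nondecreasing_is_cvgn.
      by apply: nondecreasing_series => *; exact: normr_ge0.
    exists (fine (S x) / w x) => _ [n _ <-].
    rewrite ler_pdivlMr ?w_gt0// -lee_fin fineK//.
    apply: (@le_trans _ _ (\sum_(0 <= i < n) f i x)%E).
      rewrite /f sumEFin lee_fin /series/= -mulr_suml; exact: lexx.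
    by apply: nneseries_lim_ge => i _ _; exact: f0.
  rewrite (_ : (fun n => v n x) = (fun n => v 0%N x + series (telescope (fun n => v n x)) n)).
    by apply: is_cvgD => //; exact: is_cvg_cst.
  by apply/funext => n; rewrite -eq_sum_telescope.
pose A := ~` N; have mA : measurable A by exact: measurableC.
exists (fun x => if x \in A then limn (fun n => v n x) else 0).
have cvA x : D x -> A x -> v n x @[n --> \oo] --> (if x \in A then limn (fun n => v n x) else 0).
  by move=> Dx Ax; rewrite mem_set//; exact: cv.
split => //.
- apply: (subset_measure0 _ mN _ N0); first exact: measurableD.
  by move=> x [_ /contrapT].
- apply: (@measurable_fun_cvg _ _ _ _ (fun n x => v n x * \1_A x)).
    by move=> n; apply: measurable_funM => //; exact: measurable_indic.
  move=> x Dx; have [Ax|nAx] := pselect (A x).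
    rewrite indicE mem_set//= (_ : (fun n => _) = (fun n => v n x)).
      by have := cvA x Dx Ax; rewrite mem_set.
    by apply/funext => n; rewrite mulr1.
  rewrite indicE memNset//= (_ : (fun n => _) = (fun=> 0)); first exact: cvg_cst.
  by apply/funext => n; rewrite mulr0.
- by move=> x [Dx nAx]; rewrite memNset.
Qed.

(** A rapidly convergent subsequence has a pointwise limit [g]. Fatou's lemma along it transfers the
    Cauchy bound from u_m - u_n to g - u_n, which gives convergence of the whole sequence. *)
Lemma riesz_fischer (u : nat -> T -> R) : (forall i, L2 (u i)) ->
  (forall e : R, 0 < e -> exists N, forall m n, (N <= m)%N -> (N <= n)%N ->
    dot (fun x => u m x - u n x) (fun x => u m x - u n x) <= e) ->
  exists g, L2 g /\
    dot (fun x => g x - u n x) (fun x => g x - u n x) @[n --> \oo] --> 0.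
Proof.
move=> Lu Cu.
have [N HN] : {N : nat -> nat & forall i m n, (N i <= m)%N -> (N i <= n)%N ->
    dot (fun x => u m x - u n x) (fun x => u m x - u n x) <= (4^-1) ^+ i}.
  apply: (@boolp.choice _ _ (fun i k => forall m n, (k <= m)%N -> (k <= n)%N ->
    dot (fun x => u m x - u n x) (fun x => u m x - u n x) <= (4^-1) ^+ i)) => i.
  by apply: Cu; rewrite exprn_gt0.
(* Adding up the thresholds makes [phi] nondecreasing and at least [N i]; the summand i makes it
   pass every index. *)
pose phi i := (i + \sum_(k < i.+1) N k)%N.
have phiN i : (N i <= phi i)%N by rewrite /phi big_ord_recr/=; lia.
have phiS i : (phi i <= phi i.+1)%N by rewrite /phi [in leqRHS]big_ord_recr/=; lia.
have mu_ i : measurable_fun D (u i) by case: (Lu i).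
have [|A [g [mA DA0 mg gA cg]]] := @riesz_fischer_subseq (u \o phi) (fun i => Lu _).
  move=> i; apply: HN => /=; [exact: leq_trans (phiN i) (phiS i)|exact: phiN].
have key e n0 : 0 <= e -> (forall m n, (n0 <= m)%N -> (n0 <= n)%N ->
    dot (fun x => u m x - u n x) (fun x => u m x - u n x) <= e) ->
    forall n, (n0 <= n)%N -> (\int[mu]_(x in D) ((g x - u n x) ^+ 2 * w x)%:E <= e%:E)%E.
  move=> e0 He n n0n.
  pose h i x := ((u (phi i) x - u n x) ^+ 2 * w x * \1_A x)%:E.
  have mh i : measurable_fun D (h i).
    apply/measurable_EFinP; apply: measurable_funM; last exact: measurable_indic.
    by apply: measurable_funM => //; apply: measurable_funX; exact: measurable_funB.
  have h0 i x : D x -> (0 <= h i x)%E.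
    by move=> Dx; rewrite lee_fin mulr_ge0 ?indicE// mulr_ge0 ?sqr_ge0 ?w_ge0.
  have hl x : D x -> limn_einf (h^~ x) = ((g x - u n x) ^+ 2 * w x * \1_A x)%:E.
    move=> Dx; apply: (cvg_limn_einf_sup _).1; apply: cvg_EFin; first exact: nearW.
    rewrite /comp/= indicE; have [Ax|nAx] := pselect (A x).
      rewrite mem_set//=; apply: cvgMl; apply: cvgMl.
      rewrite expr2 (_ : (fun i => _) = (fun i => (u (phi i) x - u n x) * (u (phi i) x - u n x))).
        by apply: cvgM; apply: cvgB; (try exact: cvg_cst); exact: cg.
      by apply/funext => i; rewrite expr2.
    rewrite memNset//= mulr0 (_ : (fun i => _) = (fun=> 0)); first exact: cvg_cst.
    by apply/funext => i; rewrite mulr0.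
  have mgu : measurable_fun D (fun x => (g x - u n x) ^+ 2 * w x).
    by apply: measurable_funM => //; apply: measurable_funX; exact: measurable_funB.
  rewrite (_ : (\int[mu]_(x in D) _)%E = (\int[mu]_(x in D) limn_einf (h^~ x))%E); last first.
    transitivity (\int[mu]_(x in D) ((g x - u n x) ^+ 2 * w x * \1_A x)%:E)%E; last first.
      by apply: eq_integral => x /set_mem Dx; rewrite hl.
    apply: ae_eq_integral => //.
    - exact/measurable_EFinP.
    - by apply/measurable_EFinP; apply: measurable_funM => //; exact: measurable_indic.
    - exists (D `\` A); split => //; first exact: measurableD.
      move=> x /= /not_implyP[Dx]; rewrite indicE => h'; split => // Ax.
      by apply: h'; rewrite mem_set// mulr1.
  apply: (le_trans (fatou mu mD mh h0)).
  rewrite limn_einf_lim; apply: lime_le; first exact: is_cvg_einfs.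
  apply: nearW => i.
  (* The infimum over the tail from i is tested at the index max(i, n0), where the Cauchy bound
     valid from [n0] on applies. *)
  apply: (@le_trans _ _ (\int[mu]_(x in D) h (maxn i n0) x)%E).
    by apply: ereal_inf_lbound; exists (maxn i n0) => //=; rewrite leq_maxl.
  set k := phi (maxn i n0).
  have n0k : (n0 <= k)%N by rewrite (leq_trans (leq_maxr i n0))// leq_addr.
  apply: (@le_trans _ _ (\int[mu]_(x in D) ((u k x - u n x) ^+ 2 * w x)%:E)%E).
    apply: le_integral_nomeas => x Dx; first exact: h0.
    by rewrite lee_fin ler_piMr// ?indicE ?lern1 ?leq_b1// mulr_ge0 ?sqr_ge0 ?w_ge0.
  by rewrite -(ip_sq mD mw w_ge0 (L2wB mD mw w_ge0 (Lu k) (Lu n))) lee_fin; exact: He.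
have mgu n : measurable_fun D (fun x => g x - u n x) by exact: measurable_funB.
have [n1 H1] := Cu 1 ltr01.
have Lgu : L2 (fun x => g x - u n1 x).
  split => //; apply: le_lt_trans (ltry 1).
  exact: (key 1 n1 ler01 H1).
have Lg : L2 g.
  by apply: eq_L2w (L2wD mD mw w_ge0 Lgu (Lu n1)) => x _; rewrite subrK.
exists g; split => //.
apply/cvgrPdist_le => e e0; have [n0 H0] := Cu e e0.
exists n0 => // n /= n0n; rewrite sub0r normrN ger0_norm; last exact: ip_ge0.
rewrite -lee_fin ip_sq//; last exact: L2wB.
exact: (key e n0 (ltW e0) H0).
Qed.

End riesz_fischer.

(** * Measurability in the plane and the Gaussian density *)

Section plane.
Variable R : realType.
Local Notation T2 := (measurableTypeR R * measurableTypeR R)%type.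
Local Notation leb := (@lebesgue_measure R).
Local Notation gauss := (normal_prob (0 : R) 1).
Local Notation pdf := (normal_pdf (0 : R) 1).

(** The topology of the plane and the product sigma-algebra meet here: an open set is the countable
    union of the rational open rectangles that it contains. *)
Lemma open_measurable2 (O : set (R * R)) : open O -> measurable (O : set T2).
Proof.
move=> oO.
pose rect (q : (rat * rat) * (rat * rat)) : set (R * R) :=
  `]ratr q.1.1, ratr q.1.2[%classic `*` `]ratr q.2.1, ratr q.2.2[%classic.
have -> : O = \bigcup_q (if `[< rect q `<=` O >] then rect q else set0).
  apply/seteqP; split => [p Op|p [q _]]; last by case: ifPn => // /asboolP; exact.
  have /nbhs_ballP[e /= e0 eO] : nbhs p O by exact: open_nbhs_nbhs.
  have H (x : R) : exists a b : rat, [/\ ratr a < x, x < ratr b,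
      x - e < ratr a & ratr b < x + e].
    have [|a /[!in_itv]/= /andP[a1 a2]] := @rat_in_itvoo R (x - e) x; first by rewrite gtrBl.
    have [|b /[!in_itv]/= /andP[b1 b2]] := @rat_in_itvoo R x (x + e); first by rewrite ltrDl.
    by exists a, b.
  have [a [b [a1 a2 a3 a4]]] := H p.1; have [a' [b' [b1 b2 b3 b4]]] := H p.2.
  exists ((a, b), (a', b')) => //.
  rewrite ifT; first by split; rewrite /= in_itv/=; apply/andP.
  apply/asboolP => -[x y] [/= /[!in_itv]/= /andP[x1 x2] /andP[y1 y2]]; apply: eO.
  by split; rewrite /ball/= ltr_distl; apply/andP; split; lra.
apply: countable_bigcupT_measurable => // q; case: ifPn => // _.
by apply: measurableX; exact: measurable_itv.
Qed.

Lemma continuous_measurable2 (f : R * R -> R) : continuous f ->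
  measurable_fun (setT : set T2) f.
Proof.
move=> /continuousP cf; apply: (measurability _ (RGenOpens.measurableE R)).
move=> _ [_ [a [b ->] <-]]; rewrite setTI; apply: open_measurable2.
exact/cf/interval_open.
Qed.

Lemma measurable_strip : measurable (strip R : set T2).
Proof.
rewrite (_ : strip R = (`]-1, 1[%classic : set R) `*` setT); first exact: measurableX.
by apply/seteqP; split => [[x t]|[x t] []] /=; rewrite /strip/= in_itv//=.
Qed.

Lemma measurable_comp_fst (f : R -> R) (D : set T2) : measurable_fun setT f ->
  measurable_fun D (fun p : T2 => f p.1).
Proof.
by move=> mf; apply: measurable_funTS; apply: measurableT_comp => //; exact: measurable_fst.
Qed.

Lemma measurable_comp_snd (f : R -> R) (D : set T2) : measurable_fun setT f ->
  measurable_fun D (fun p : T2 => f p.2).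
Proof.
by move=> mf; apply: measurable_funTS; apply: measurableT_comp => //; exact: measurable_snd.
Qed.

Lemma normal_pdf01 (x : R) : pdf x = (Num.sqrt (2 * pi))^-1 * expR (- (x ^+ 2) / 2).
Proof.
rewrite normal_pdfE//.
by rewrite /normal_peak /normal_fun expr1n mul1r subr0 -(mulr_natl pi) .
Qed.

Lemma normal_pdf01_gt0 (x : R) : 0 < pdf x.
Proof.
rewrite normal_pdf01 mulr_gt0 ?expR_gt0// invr_gt0 sqrtr_gt0.
by rewrite mulr_gt0// pi_gt0.
Qed.

(** The Radon-Nikodym derivative of [normal_prob] and [normal_pdf] have the same integral over every
    measurable set, hence agree almost everywhere. *)
Lemma ge0_integral_gauss (g : R -> \bar R) : measurable_fun setT g -> (forall x, 0 <= g x)%E ->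
  (\int[gauss]_x g x = \int[leb]_x (g x * (pdf x)%:E))%E.
Proof.
move=> mg g0.
have dom : gauss `<< leb by exact: normal_prob_dominates.
rewrite -(Radon_Nikodym_SigmaFinite.change_of_variables dom)//.
have i1 := Radon_Nikodym_SigmaFinite.f_integrable dom.
apply: ae_eq_integral => //.
- by apply: emeasurable_funM => //; exact: measurable_int i1.
- apply: emeasurable_funM => //; apply/measurable_EFinP; exact: measurable_normal_pdf.
apply: ae_eqe_mul2l; apply: integral_ae_eq => //.
- by apply/measurable_EFinP; exact: measurable_normal_pdf.
- by move=> E _ mE; rewrite -(Radon_Nikodym_SigmaFinite.f_integral dom).
Qed.

Lemma measurable_fun_patch2 (F : T2 -> \bar R) : measurable_fun (strip R : set T2) F ->
  measurable_fun setT (F \_ (strip R)).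
Proof.
by move=> mF; apply: (iffLR (measurable_restrictT F measurable_strip)).
Qed.

Lemma measurable_pdf2 (D : set T2) : measurable_fun D (fun p : T2 => pdf p.2).
Proof. by apply: measurable_comp_snd; exact: measurable_normal_pdf. Qed.

Lemma ge0_integral_dxdnu (F : T2 -> \bar R) : measurable_fun (strip R : set T2) F ->
  (forall p, strip R p -> 0 <= F p)%E ->
  (\int[dxdnu R]_(p in strip R) F p = \int[leb2 R]_(p in strip R) (F p * (pdf p.2)%:E))%E.
Proof.
move=> mF F0; rewrite integral_mkcond [RHS]integral_mkcond.
set G := F \_ (strip R).
have mG : measurable_fun setT G by exact: measurable_fun_patch2.
have G0 p : (0 <= G p)%E.
  by rewrite /G /patch; case: ifPn => // /set_mem; exact: F0.
have mGp : measurable_fun setT (fun p : T2 => (G p * (pdf p.2)%:E)%E).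
  by apply: emeasurable_funM => //; apply/measurable_EFinP; exact: measurable_pdf2.
have -> : ((fun p : T2 => (F p * (pdf p.2)%:E)%E) \_ (strip R)) = (fun p : T2 => (G p * (pdf p.2)%:E)%E).
  by apply/funext => p; rewrite /G /patch; case: ifPn => // _; rewrite mul0e.
rewrite (@fubini_tonelli1 _ _ _ _ R leb gauss G)// (fubini_tonelli1 (fun p : T2 => (G p * (pdf p.2)%:E)%E))//; last first.
  by move=> p; apply: mule_ge0 => //; rewrite lee_fin normal_pdf_ge0.
apply: eq_integral => x _; rewrite /fubini_F/= ge0_integral_gauss//.
exact: measurableT_comp (measurable_fun_pair2 _ mG) _.
Qed.

(** Positive and negative parts are transported separately, the positive density passing through
    both maxima, so the two sides agree even when the integral diverges. *)
Lemma Rintegral_dxdnu (F : T2 -> R) : measurable_fun (strip R : set T2) F ->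
  \int[dxdnu R]_(p in strip R) F p = \int[leb2 R]_(p in strip R) (F p * pdf p.2).
Proof.
move=> mF; rewrite /Rintegral; congr fine.
have maxM (a : R) (p : T2) :
    (Order.max a%:E 0 * (pdf p.2)%:E = Order.max (a * pdf p.2)%:E 0)%E.
  have z0 := normal_pdf01_gt0 p.2; have [h|h] := lerP 0 a.
    by rewrite !max_l ?lee_fin// mulr_ge0// ltW.
  by rewrite !max_r ?lee_fin ?mul0e// ltW// pmulr_llt0.
have mEF : measurable_fun (strip R : set T2) (EFin \o F) by exact/measurable_EFinP.
rewrite integralE [RHS]integralE; congr (_ - _)%E.
- rewrite ge0_integral_dxdnu//; last exact: measurable_funepos.
  apply: eq_integral => p _; rewrite !funeposE/=; exact: maxM.
- rewrite ge0_integral_dxdnu//; last exact: measurable_funeneg.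
  apply: eq_integral => p _; rewrite !funenegE/= -mulNr; exact: maxM.
Qed.

End plane.

(** * Smooth functions and weak derivatives *)

Section smooth.
Variable R : realType.
Implicit Types f g : R -> R.

Lemma is_derive_mul f g (x a b : R) : is_derive x 1 f a -> is_derive x 1 g b ->
  is_derive x 1 (fun y => f y * g y) (a * g x + f x * b).
Proof.
move=> df dg; have := is_deriveM df dg.
by rewrite /GRing.scale/= addrC (mulrC (g x)).
Qed.

Lemma is_derive_comp f g (x a b : R) : is_derive (g x) 1 f a -> is_derive x 1 g b ->
  is_derive x 1 (fun y => f (g y)) (a * b).
Proof. exact: is_derive1_comp. Qed.

Lemma is_derive_add f g (x a b : R) : is_derive x 1 f a -> is_derive x 1 g b ->
  is_derive x 1 (fun y => f y + g y) (a + b).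
Proof. by move=> df dg; exact: is_deriveD. Qed.

Lemma is_derive_scale c f (x a : R) : is_derive x 1 f a ->
  is_derive x 1 (fun y => c * f y) (c * a).
Proof. by move=> df; have := is_deriveZ c df. Qed.

Lemma is_derive_continuous f (x a : R) : is_derive x 1 f a -> {for x, continuous f}.
Proof. by move=> [df _]; apply/differentiable_continuous/derivable1_diffP. Qed.

(** A derivative is supplied as a witness at each level instead of being computed by [derive1n], so
    that closure under products and composition is an induction on the level alone. *)
Fixpoint differentiable_n (n : nat) f : Prop :=
  if n is m.+1 then exists2 g, (forall x, is_derive x (1 : R) f (g x)) & differentiable_n m g
  else True.

Definition smooth f := forall n, differentiable_n n f.

Lemma differentiable_nW n f : differentiable_n n.+1 f -> differentiable_n n f.
Proof. by elim: n f => // n IH f [g dg /IH]; exists g. Qed.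

Lemma differentiable_nD n f g : differentiable_n n f -> differentiable_n n g ->
  differentiable_n n (fun x => f x + g x).
Proof.
elim: n f g => // n IH f g [f' df hf] [g' dg hg].
by exists (fun x => f' x + g' x); [move=> x; exact: is_derive_add|exact: IH].
Qed.

Lemma differentiable_nM n f g : differentiable_n n f -> differentiable_n n g ->
  differentiable_n n (fun x => f x * g x).
Proof.
elim: n f g => // n IH f g hf hg.
have := differentiable_nW hf; have := differentiable_nW hg => hg0 hf0.
move: hf hg => [f' df hf] [g' dg hg].
exists (fun x => f' x * g x + f x * g' x); first by move=> x; exact: is_derive_mul.
by apply: differentiable_nD; exact: IH.
Qed.

Lemma differentiable_n_comp n f g : differentiable_n n f -> differentiable_n n g ->
  differentiable_n n (fun x => f (g x)).
Proof.
elim: n f g => // n IH f g hf hg; have := differentiable_nW hg => hg0.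
move: hf hg => [f' df hf] [g' dg hg].
exists (fun x => f' (g x) * g' x); first by move=> x; exact: is_derive_comp.
by apply: differentiable_nM => //; exact: IH.
Qed.

Lemma smoothD f g : smooth f -> smooth g -> smooth (fun x => f x + g x).
Proof. by move=> hf hg n; exact: differentiable_nD. Qed.

Lemma smoothM f g : smooth f -> smooth g -> smooth (fun x => f x * g x).
Proof. by move=> hf hg n; exact: differentiable_nM. Qed.

Lemma smooth_comp f g : smooth f -> smooth g -> smooth (fun x => f (g x)).
Proof. by move=> hf hg n; exact: differentiable_n_comp. Qed.

Lemma smooth_horner (p : {poly R}) : smooth (horner p).
Proof.
move=> n; elim: n p => // n IH p.
by exists (horner p^`()) => [x|]; [exact: is_derive_poly|exact: IH].
Qed.

Lemma smooth_expR : smooth (@expR R).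
Proof. by elim=> // n IH; exists expR => // x; exact: is_derive_expR. Qed.

Lemma derive1_is_derive f g : (forall x, is_derive x (1 : R) f (g x)) -> f^`()%classic = g.
Proof. by move=> df; apply/funext => x; rewrite derive1E; case: (df x). Qed.

Lemma smooth_derive1 f : smooth f -> smooth f^`()%classic.
Proof.
by move=> hf n; case: (hf n.+1) => g dg hg; rewrite (derive1_is_derive dg).
Qed.

Lemma smooth_derive1n f n : smooth f -> smooth (derive1n n f).
Proof.
by move=> hf; elim: n => [//|n IH]; rewrite derive1nS; exact: smooth_derive1.
Qed.

Lemma smooth_is_derive f x : smooth f -> is_derive x (1 : R) f (f^`()%classic x).
Proof. by move=> /(_ 1%N)[g dg _]; rewrite (derive1_is_derive dg). Qed.

Lemma smooth_is_derive1n f n x : smooth f ->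
  is_derive x (1 : R) (derive1n n f) (derive1n n.+1 f x).
Proof. by move=> hf; rewrite derive1nS; apply: smooth_is_derive; exact: smooth_derive1n. Qed.

Lemma smooth_continuous f : smooth f -> continuous f.
Proof. by move=> hf x; exact: is_derive_continuous (smooth_is_derive x hf). Qed.

Lemma derive1_zero_out f (a b : R) x : (forall x, x \notin `[a, b] -> f x = 0) ->
  x \notin `[a, b] -> f^`()%classic x = 0.
Proof.
move=> f0 xab; rewrite derive1E.
have -> : 'D_1 f x = 'D_1 (cst 0 : R -> R) x; last exact: derive_cst.
have oC : open (~` [set` `[a, b]]) by apply: closed_openC; exact: interval_closed.
apply: near_eq_derive => //.
have : nbhs x (~` [set` `[a, b]]) by apply: open_nbhs_nbhs; split => //; exact/negP.
by apply: filterS => y /= /negP yab; exact: f0.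
Qed.

Lemma derive1n_zero_out f (a b : R) n x : (forall x, x \notin `[a, b] -> f x = 0) ->
  x \notin `[a, b] -> derive1n n f x = 0.
Proof.
move=> f0; elim: n x => [|n IH] x xab; first by rewrite derive1n0 f0.
by rewrite derive1nS; apply: derive1_zero_out xab.
Qed.

End smooth.

(** * Functions flat at the origin and smooth cut-offs *)

Section flat.
Variable R : realType.

(** The classical exp(-1/y), extended by 0, with a polynomial in 1/y in front. The polynomial makes
    the family stable under differentiation: the derivative of Q(1/y) exp(-1/y) is y^-2 (Q -
    Q')(1/y) exp(-1/y), which is the origin of [dflat]. *)
Definition flat (Q : {poly R}) (y : R) : R :=
  if 0 < y then Q.[y^-1] * expR (- y^-1) else 0.

Definition dflat (Q : {poly R}) : {poly R} := 'X^2 * (Q - Q^`()).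

Lemma expRN_pow_le (s : R) n : 0 < s -> s ^+ n * expR (- s) <= n`!%:R.
Proof.
move=> s0; rewrite expRN ler_pdivrMr ?expR_gt0//.
case: n => [|n]; first by rewrite expr0 fact0 mul1r -expR0 ler_expR ltW.
have := expR_ge1Dxn n (ltW s0); set E := expR s.
have F0 : 0 < n.+1`!%:R :> R by rewrite ltr0n fact_gt0.
move=> h; have : s ^+ n.+1 / n.+1`!%:R <= E by lra.
by rewrite ler_pdivrMr// mulrC.
Qed.

(** With s = 1/y, each monomial is controlled by s^(i+2) exp(-s) <= (i+2)!; the two spare powers of
    s give y^2. *)
Lemma flat_bound Q : exists2 C, 0 <= C & forall y, `|flat Q y| <= C * y ^+ 2.
Proof.
exists (\sum_(i < size Q) `|Q`_i| * (i + 2)`!%:R).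
  by apply: sumr_ge0 => i _; rewrite mulr_ge0.
move=> y; rewrite /flat; case: ifPn => [y0|_]; last first.
  by rewrite normr0 mulr_ge0 ?sqr_ge0//; apply: sumr_ge0 => i _; rewrite mulr_ge0.
have s0 : 0 < y^-1 by rewrite invr_gt0.
rewrite horner_coef mulr_suml mulr_suml; apply: le_trans (ler_norm_sum _ _ _) _.
apply: ler_sum => i _; rewrite !normrM -!mulrA ler_wpM2l//.
rewrite (ger0_norm (expR_ge0 _)) (ger0_norm (exprn_ge0 _ (ltW s0))).
have := expRN_pow_le (i + 2) s0.
rewrite exprD -mulrA => h.
rewrite -ler_pdivrMr ?exprn_gt0// -exprVn.
by apply: le_trans h; rewrite -mulrA [expR _ * _]mulrC.
Qed.

Lemma flat0 Q y : y <= 0 -> flat Q y = 0.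
Proof. by move=> y0; rewrite /flat ltNge y0. Qed.

Lemma flatX Q y : flat ('X * Q) y * y = flat Q y.
Proof.
rewrite /flat; case: ifPn => y0; last by rewrite mul0r.
by rewrite hornerM hornerX; field; rewrite gt_eqF.
Qed.

(** Away from 0 this is the chain rule. At 0 Caratheodory's criterion is met by the slope function
    [flat ('X * Q)]: y times it is exactly [flat Q y], and its continuity at 0 follows from the
    quadratic bound. *)
Lemma is_derive_flat Q (x : R) : is_derive x 1 (flat Q) (flat (dflat Q) x).
Proof.
have [x0|x0|->] := ltgtP x 0.
- rewrite (flat0 _ (ltW x0)); apply: (@near_eq_is_derive _ _ _ (cst 0)).
    by near=> y; rewrite flat0//; apply/ltW; near: y; exact: lt_nbhsl.
- apply: (@near_eq_is_derive _ R R (fun y : R => Q.[y^-1] * expR (- y^-1))).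
    near=> y; rewrite /flat ifT//; near: y; exact: lt_nbhsr.
  have dV : is_derive x 1 (fun y : R => y^-1) (- x ^- 2).
    have := @is_deriveV R id x 1 1 (lt0r_neq0 x0) (is_derive_id _ _).
    by rewrite /GRing.scale/= mulr1.
  have dQ := is_derive_comp (is_derive_poly Q x^-1) dV.
  have dE := @is_derive_comp R expR (fun y => -1 * y^-1) _ _ _ (is_derive_expR (-1 * x^-1)) (is_derive_scale (-1) dV).
  have := is_derive_mul dQ dE.
  rewrite /flat ifT// !(hornerE, hornerXn).
  rewrite (_ : (fun y : R => _) = (fun y => Q.[y^-1] * expR (- y^-1))); last first.
    by apply/funext => y; congr (_ * expR _); lra.
  move=> /is_derive_eq; apply.
  by rewrite mulN1r -exprVn /=; ring.
- rewrite flat0//; apply/is_derive1_caratheodory.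
  have [C C0 HC] := flat_bound ('X * Q).
  exists (flat ('X * Q)); rewrite !flat0//; split => //.
    by move=> z; rewrite !subr0 flatX.
  have near0 (c : R) : 0 < c -> \forall y \near (0 : R), `|y| <= c.
    by move=> c0; apply/nbhs_ballP; exists c => //= z; rewrite /ball/= sub0r normrN => /ltW.
  apply/cvgrPdist_le => e e0; near=> y; rewrite flat0//.
  rewrite sub0r normrN; apply: (le_trans (HC y)).
  have y1 : `|y| <= 1 by near: y; exact: near0.
  have y2 : `|y| <= e / (C + 1) by near: y; apply: near0; rewrite divr_gt0// ltr_wpDl.
  rewrite ler_pdivlMr ?ltr_wpDl// in y2.
  rewrite -real_normK ?num_real//.
  have a0 : 0 <= `|y| by exact: normr_ge0.
  apply: le_trans y2; rewrite mulrDr mulr1 (mulrC _ C) expr2 mulrA.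
  apply: (@le_trans _ _ (C * `|y|)); last by rewrite lerDl.
  by rewrite ler_piMr// mulr_ge0.
Unshelve. all: by end_near. Qed.

Lemma smooth_flat Q : smooth (flat Q).
Proof.
move=> n; elim: n Q => // n IH Q; exists (flat (dflat Q)) => // x; exact: is_derive_flat.
Qed.

(* The weight [y^s] multiplied by a smooth cut-off of the half-line [M y > 1]:
   with [y = 1 - x^2] it makes the Jacobi weights into test functions. *)
Definition cutpow (s : R) (Q : {poly R}) (M y : R) : R := y `^ s * flat Q (M * y - 1).

Lemma is_derive_cutpow s Q (M y : R) : 0 < M ->
  is_derive y 1 (cutpow s Q M) (s * cutpow (s - 1) Q M y + M * cutpow s (dflat Q) M y).
Proof.
(* Below 1/M the function vanishes identically; from 1/M on the base of the power is positive. *)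
move=> M0; have [yM|yM] := ltP y M^-1.
  have H Q' s' z : z < M^-1 -> cutpow s' Q' M z = 0.
    move=> zM; rewrite /cutpow flat0 ?mulr0//.
    by rewrite subr_le0 mulrC -ler_pdivlMr// mul1r ltW.
  rewrite !H// !mulr0 addr0; apply: (@near_eq_is_derive _ _ _ (cst 0)).
    by near=> z; rewrite H//; near: z; exact: lt_nbhsl.
have y0 : 0 < y by rewrite (lt_le_trans _ yM)// invr_gt0.
have dp := is_derive1_powR s y0.
have dl : is_derive y 1 (fun z => M * z + (- 1)) (M * 1 + 0).
  by apply: is_derive_add; exact: is_derive_scale.
have := is_derive_mul dp (is_derive_comp (is_derive_flat Q _) dl).
move=> /is_derive_eq; apply; rewrite /cutpow; ring.
Unshelve. all: by end_near. Qed.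

Lemma smooth_cutpow s Q M : 0 < M -> smooth (cutpow s Q M).
Proof.
move=> M0 n; elim: n s Q => // n IH s Q.
exists (fun y => s * cutpow (s - 1) Q M y + M * cutpow s (dflat Q) M y).
  by move=> y; exact: is_derive_cutpow.
have sc c : smooth (fun=> c : R).
  move=> m; case: m => // m; exists (fun=> 0); first by move=> x; exact: is_derive_cst.
  by elim: m => // m IHm; exists (fun=> 0) => // x; exact: is_derive_cst.
by apply: differentiable_nD; apply: differentiable_nM => //; exact: sc.
Qed.

End flat.

(** * Test functions and their supporting boxes *)

Section test_functions.
Variable R : realType.
Local Notation T2 := (measurableTypeR R * measurableTypeR R)%type.
Local Notation leb := (@lebesgue_measure R).

Definition box (a T : R) : set (R * R) := `[- a, a]%classic `*` `[- T, T]%classic.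

Lemma boxP a T p : box a T p <-> `|p.1| <= a /\ `|p.2| <= T.
Proof.
by rewrite !ler_norml; split=> -[p1 p2]; split; move: p1 p2; rewrite /= !in_itv/=.
Qed.

Lemma not_box a T p : ~ box a T p -> p.1 \notin `[- a, a] \/ p.2 \notin `[- T, T].
Proof.
move=> h; have [p1|] := boolP (p.1 \in `[- a, a]); last by left.
by right; apply/negP => p2; apply: h; split.
Qed.

Lemma compact_box a T : compact (box a T).
Proof. by apply: compact_setX; exact: segment_compact. Qed.

Lemma measurable_box a T : measurable (box a T : set T2).
Proof. by apply: measurableX; exact: measurable_itv. Qed.

Lemma box_strip a T : a < 1 -> box a T `<=` strip R.
Proof.
move=> a1 p /boxP[p1 _]; rewrite /strip/= -ltr_norml; exact: le_lt_trans p1 a1.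
Qed.

Lemma box_measure a T : (leb2 R (box a T) < +oo)%E.
Proof.
rewrite /= product_measure1E//; try exact: measurable_itv.
have H (c : R) : (leb [set` `[(- c)%R, c]] < +oo)%E.
  by rewrite lebesgue_measure_itv/=; case: ifPn => _; rewrite ?ltry// -EFinB ltry.
by apply: lte_mul_pinfty; [exact: measure_ge0|rewrite ge0_fin_numE//; exact: H|exact: H].
Qed.

Lemma continuous_fst_comp (f : R -> R) : continuous f -> continuous (fun p : R * R => f p.1).
Proof. by move=> cf p; apply: continuous_comp; [exact: cvg_fst|exact: cf]. Qed.

Lemma continuous_snd_comp (f : R -> R) : continuous f -> continuous (fun p : R * R => f p.2).
Proof. by move=> cf p; apply: continuous_comp; [exact: cvg_snd|exact: cf]. Qed.

Lemma continuous_mul2 (f g : R * R -> R) : continuous f -> continuous g ->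
  continuous (fun p => f p * g p).
Proof. by move=> cf cg p; apply: cvgM; [exact: cf|exact: cg]. Qed.

Lemma continuous_section1 (f : R * R -> R) t : continuous f -> continuous (fun x => f (x, t)).
Proof.
move=> cf x; apply: continuous_comp; last exact: cf.
move=> A /nbhs_ballP[e /= e0 eA]; apply/nbhs_ballP; exists e => //= y xy.
by apply: eA; split => //=; exact: ballxx.
Qed.

Lemma continuous_section2 (f : R * R -> R) x : continuous f -> continuous (fun t => f (x, t)).
Proof.
move=> cf t; apply: continuous_comp; last exact: cf.
move=> A /nbhs_ballP[e /= e0 eA]; apply/nbhs_ballP; exists e => //= y xy.
by apply: eA; split => //=; exact: ballxx.
Qed.

(** On a nonempty compact set |x| attains a maximum, which is below 1; the half-width [a] is the
    midpoint of that maximum and 1. *)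
Lemma compact_sub_box (K : set (R * R)) : compact K -> K `<=` strip R ->
  exists a T, [/\ 0 < a, a < 1, 0 < T & K `<=` box a T].
Proof.
move=> cK KS; have [K0|] := pselect (K !=set0); last first.
  by move=> h; exists 2^-1, 1; split => //; [lra|move=> p Kp; case: h; exists p].
have c1 : {within K, continuous (fun p : R * R => `|p.1|)}.
  by apply: continuous_subspaceT; apply: (continuous_fst_comp (f := Num.norm)); exact: norm_continuous.
have c2 : {within K, continuous (fun p : R * R => `|p.2|)}.
  by apply: continuous_subspaceT; apply: (continuous_snd_comp (f := Num.norm)); exact: norm_continuous.
have [p /set_mem Kp Hp] := compact_EVT_max K0 cK c1.
have [q /set_mem Kq Hq] := compact_EVT_max K0 cK c2.
have : `|p.1| < 1 by rewrite ltr_norml; exact: KS Kp.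
have p0 := normr_ge0 p.1; have q0 := normr_ge0 q.2 => p1.
exists ((1 + `|p.1|) / 2), (`|q.2| + 1); split; [lra|lra|lra|].
move=> z Kz; apply/boxP; split.
  by apply: le_trans (Hp z (mem_set Kz)) _; lra.
by apply: le_trans (Hq z (mem_set Kz)) _; lra.
Qed.

Lemma continuous_box_bounded (f : R * R -> R) a T : continuous f ->
  exists2 C, 0 <= C & forall p, box a T p -> `|f p| <= C.
Proof.
move=> cf; have [b0|] := pselect (box a T !=set0); last first.
  by move=> h; exists 0 => // p bp; case: h; exists p.
have c1 : {within box a T, continuous (fun p => `|f p|)}.
  apply: continuous_subspaceT => p; apply: continuous_comp; [exact: cf|exact: norm_continuous].
have [p _ Hp] := compact_EVT_max b0 (@compact_box a T) c1.
by exists `|f p| => // z bz; apply: Hp; exact: mem_set.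
Qed.

Definition test_box (phi : nat -> nat -> R * R -> R) a T :=
  [/\ test_jet2 phi, 0 < a < 1, 0 < T & forall j k p, ~ box a T p -> phi j k p = 0].

(** Vanishing off a compact set is assumed for [phi 0 0] only. A box lets it spread to all orders
    one variable at a time: on a line that misses the box the function is constantly 0, and on any
    other the derivative vanishes off the closed interval. *)
Lemma test_jet2_box (phi : nat -> nat -> R * R -> R) : test_jet2 phi -> exists a T, test_box phi a T.
Proof.
move=> tphi; have [cphi dx dt [K [cK KS K0]]] := tphi.
have [a [T [a0 a1 T0 Kb]]] := compact_sub_box cK KS.
exists a, T; split => //; first by rewrite a0.
have h0 p : ~ box a T p -> phi 0%N 0%N p = 0.
  by move=> nb; apply: K0 => Kp; apply: nb; exact: Kb.
have box1 x t : x \notin `[- a, a] -> ~ box a T (x, t) by move=> xa [/= xa' _]; rewrite xa' in xa.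
have box2 x t : t \notin `[- T, T] -> ~ box a T (x, t) by move=> tT [_ /= tT']; rewrite tT' in tT.
elim=> [|j IH].
  elim=> // k IH [x t] nb.
  have -> : phi 0%N k.+1 (x, t) = (fun s => phi 0%N k (x, s))^`()%classic t.
    by rewrite derive1E; case: (dt 0%N k x t).
  case: (not_box nb) => /= h.
    have -> : (fun s => phi 0%N k (x, s)) = cst 0.
      by apply/funext => s; apply: IH; exact: box1.
    by rewrite derive1_cst.
  by apply: (derive1_zero_out _ h) => s sT; apply: IH; exact: box2.
move=> k [x t] nb.
have -> : phi j.+1 k (x, t) = (fun y => phi j k (y, t))^`()%classic x.
  by rewrite derive1E; case: (dx j k x t).
case: (not_box nb) => /= h; last first.
  have -> : (fun y => phi j k (y, t)) = cst 0.
    by apply/funext => y; apply: IH; exact: box2.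
  by rewrite derive1_cst.
by apply: (derive1_zero_out _ h) => y ya; apply: IH; exact: box1.
Qed.

(** Testing with a derivative of phi is what makes consecutive weak derivatives of one function weak
    derivatives of each other. *)
Lemma test_jet2_shift (phi : nat -> nat -> R * R -> R) m l : test_jet2 phi -> test_jet2 (fun j k => phi (m + j)%N (l + k)%N).
Proof.
move=> tphi; have [a [T [[cphi dx dt _] a01 T0 z]]] := test_jet2_box tphi.
split => //.
- by move=> j k x t; rewrite addnS.
- by move=> j k x t; rewrite addnS.
- exists (box a T); split; [exact: compact_box| |by move=> p; exact: z].
  by apply: box_strip; case/andP: a01.
Qed.

Lemma test_jet2_tensor (A B : R -> R) a T : smooth A -> smooth B -> 0 < a < 1 ->
  (forall x, x \notin `[- a, a] -> A x = 0) -> (forall t, t \notin `[- T, T] -> B t = 0) ->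
  test_jet2 (fun j k p => derive1n j A p.1 * derive1n k B p.2).
Proof.
move=> sA sB /andP[_ a1] A0 B0; split.
- move=> j k; apply: continuous_mul2.
    by apply: continuous_fst_comp; apply: smooth_continuous; exact: smooth_derive1n.
  by apply: continuous_snd_comp; apply: smooth_continuous; exact: smooth_derive1n.
- move=> j k x t /=.
  rewrite (_ : (fun y : R => _) = (fun y => derive1n k B t * derive1n j A y)); last first.
    by apply/funext => y; rewrite mulrC.
  by rewrite mulrC; apply: is_derive_scale; exact: smooth_is_derive1n.
- by move=> j k x t /=; apply: is_derive_scale; exact: smooth_is_derive1n.
- exists (box a T); split; [exact: compact_box|exact: box_strip|].
  move=> p /not_box[h|h]; rewrite !derive1n0.
    by rewrite A0// mul0r.
  by rewrite B0// mulr0.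
Qed.

Lemma measurable_test (phi : nat -> nat -> R * R -> R) j k (D : set T2) : test_jet2 phi -> measurable_fun D (phi j k).
Proof. by case=> c _ _ _; apply: measurable_funTS; exact: continuous_measurable2. Qed.

Lemma bounded_loc_integrable2 (u : R * R -> R) : measurable_fun (strip R : set T2) u ->
  (forall a T, 0 < a < 1 -> exists C : R, forall p, box a T p -> `|u p| <= C) -> loc_integrable2 u.
Proof.
move=> mu ub; split => // K cK KS.
have [a [T [a0 a1 T0 Kb]]] := compact_sub_box cK KS.
have [|C HC] := ub a T; first by rewrite a0.
apply: (@le_lt_trans _ _ (\int[leb2 R]_(p in (box a T : set T2)) `|u p|%:E)%E).
  by apply: subset_integral_nomeas => // p _; rewrite lee_fin.
apply: (@le_lt_trans _ _ (\int[leb2 R]_(p in (box a T : set T2)) (cst C%:E) p)%E).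
  by apply: le_integral_nomeas => p bp; rewrite lee_fin//; exact: HC.
rewrite integral_cst; last exact: measurable_box.
have h := box_measure a T.
by rewrite -[X in (_ * X)%E]fineK ?ge0_fin_numE// -EFinM ltry.
Qed.

Lemma continuous_loc_integrable2 (u : R * R -> R) : continuous u -> loc_integrable2 u.
Proof.
move=> cu; apply: bounded_loc_integrable2.
  by apply: measurable_funTS; exact: continuous_measurable2.
by move=> a T _; have [C _ HC] := continuous_box_bounded a T cu; exists C.
Qed.

Lemma integrable_bounded_box (u psi : R * R -> R) a T C : loc_integrable2 u -> a < 1 ->
  measurable_fun (strip R : set T2) psi ->
  (forall p, `|psi p| <= C) -> (forall p, ~ box a T p -> psi p = 0) ->
  (leb2 R).-integrable (strip R : set T2) (EFin \o (fun p => u p * psi p)).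
Proof.
move=> [mu uloc] a1 mpsi psiC psi0.
apply/integrableP; split; first by apply/measurable_EFinP; exact: measurable_funM.
have C0 : 0 <= C by exact: le_trans (normr_ge0 _) (psiC (0, 0)).
have bS := box_strip (T := T) a1.
apply: (@le_lt_trans _ _ (\int[leb2 R]_(p in (box a T : set T2)) (C%:E * `|u p|%:E))%E).
  rewrite integral_mkcond [leRHS]integral_mkcond.
  apply: le_integral_nomeas => p _; rewrite /patch.
    by case: ifPn => // _; exact: abse_ge0.
  case: ifPn => [/set_mem Sp|_]; last by case: ifPn => // _; rewrite -EFinM lee_fin mulr_ge0.
  case: ifPn => [_|/negP nb] /=.
    by rewrite -EFinM lee_fin normrM mulrC ler_wpM2r.
  by rewrite psi0 ?mulr0 ?normr0// => bp; apply: nb; exact: mem_set.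
rewrite ge0_integralZl//.
- by apply: lte_mul_pinfty => //; apply: uloc => //; exact: compact_box.
- exact: measurable_box.
- apply/measurable_EFinP; apply: measurableT_comp => //; apply: measurable_funS mu => //.
  exact: measurable_strip.
Qed.

Lemma integrable_test (u : R * R -> R) (phi : nat -> nat -> R * R -> R) j k : loc_integrable2 u -> test_jet2 phi ->
  (leb2 R).-integrable (strip R : set T2) (EFin \o (fun p => u p * phi j k p)).
Proof.
move=> lu tphi; have [a [T [[c _ _ _] /andP[_ a1] T0 z]]] := test_jet2_box tphi.
have [C C0 HC] := continuous_box_bounded a T (c j k).
apply: (@integrable_bounded_box _ _ a T C) => //; last exact: z.
  exact: measurable_test.
move=> p; have [bp|nb] := pselect (box a T p); first exact: HC.
by rewrite z// normr0.
Qed.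

Lemma integral_box_zero_strip (f : R * R -> R) a T : a < 1 -> (forall p, ~ box a T p -> f p = 0) ->
  (\int[leb2 R]_(p in (strip R : set T2)) (f p)%:E = \int[leb2 R]_p (f p)%:E)%E.
Proof.
move=> a1 f0; rewrite integral_mkcond; apply: eq_integral => p _.
rewrite /patch; case: ifPn => // /negP nS; rewrite f0// => bp; apply: nS.
by apply: mem_set; exact: box_strip bp.
Qed.

Lemma integrable_continuous_box (f : R * R -> R) a T : continuous f ->
  (forall p, ~ box a T p -> f p = 0) -> (leb2 R).-integrable (setT : set T2) (EFin \o f).
Proof.
move=> cf f0; have [C C0 HC] := continuous_box_bounded a T cf.
have mf : measurable_fun (setT : set T2) f by exact: continuous_measurable2.
apply/integrableP; split; first exact/measurable_EFinP.
apply: (@le_lt_trans _ _ (\int[leb2 R]_(p in (box a T : set T2)) (cst C%:E) p)%E).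
  rewrite [leRHS]integral_mkcond; apply: le_integral_nomeas => p _; first exact: abse_ge0.
  rewrite /patch; case: ifPn => [/set_mem bp|/negP nb]; first by rewrite lee_fin HC.
  by rewrite /= f0 ?normr0// => bp; apply: nb; exact: mem_set.
rewrite integral_cst; last exact: measurable_box.
have h := box_measure a T.
by rewrite -[X in (_ * X)%E]fineK ?ge0_fin_numE// -EFinM ltry.
Qed.

Lemma integral_derive_zero (F f : R -> R) (b : R) : (forall x, is_derive x (1 : R) F (f x)) ->
  continuous f -> 0 < b -> (forall x, x \notin `[- b, b] -> F x = 0) ->
  (forall x, x \notin `[- b, b] -> f x = 0) -> (\int[leb]_x (f x)%:E = 0)%E.
Proof.
move=> dF cf b0 F0 f0.
(* One unit is added on each side so that the endpoints lie outside the support, where the primitive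
   is 0. *)
transitivity (\int[leb]_(x in `[(- (b + 1))%R, (b + 1)%R]) (f x)%:E)%E.
  rewrite [RHS]integral_mkcond; apply: eq_integral => x _.
  rewrite /patch; case: ifPn => // nx; rewrite f0//; apply: contra nx => xb.
  rewrite mem_setE in_itv/=; move: xb; rewrite in_itv/= => /andP[? ?].
  by apply/andP; split; lra.
have cF : continuous F by move=> x; exact: is_derive_continuous (dF x).
rewrite (@continuous_FTC2 _ f F).
- by rewrite !F0 ?subee// in_itv/= ?lerN2 ?gerDl ?lerDl ?ler10 ?ler01 ?andbF// negb_and -!ltNge; apply/orP; right; lra.
- by lra.
- exact: continuous_subspaceT.
- split; [by move=> x _; case: (dF x)|apply: cvg_at_right_filter; exact: cF|].
  by apply: cvg_at_left_filter; exact: cF.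
- by move=> x _; rewrite (derive1_is_derive dF).
Qed.

Lemma integral_dx_zero (F f : R * R -> R) a T : continuous f -> 0 < a ->
  (forall x t, is_derive x (1 : R) (fun y => F (y, t)) (f (x, t))) ->
  (forall p, ~ box a T p -> F p = 0) -> (forall p, ~ box a T p -> f p = 0) ->
  (\int[leb2 R]_p (f p)%:E = 0)%E.
Proof.
move=> cf a0 dF F0 f0.
rewrite -(integral21_prod_meas1 (integrable_continuous_box cf f0)).
apply: integral0_eq => t _; rewrite /fubini_G/=.
apply: (@integral_derive_zero (fun y => F (y, t)) _ a) => //.
- exact: continuous_section1.
- by move=> x xa; apply: F0 => -[/= xa' _]; rewrite xa' in xa.
- by move=> x xa; apply: f0 => -[/= xa' _]; rewrite xa' in xa.
Qed.

Lemma integral_dt_zero (F f : R * R -> R) a T : continuous f -> 0 < T ->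
  (forall x t, is_derive t (1 : R) (fun s => F (x, s)) (f (x, t))) ->
  (forall p, ~ box a T p -> F p = 0) -> (forall p, ~ box a T p -> f p = 0) ->
  (\int[leb2 R]_p (f p)%:E = 0)%E.
Proof.
move=> cf a0 dF F0 f0.
rewrite -(integral12_prod_meas1 (integrable_continuous_box cf f0)).
apply: integral0_eq => x _; rewrite /fubini_F/=.
apply: (@integral_derive_zero (fun s => F (x, s)) _ T) => //.
- exact: continuous_section2.
- by move=> t tT; apply: F0 => -[_ /= tT']; rewrite tT' in tT.
- by move=> t tT; apply: f0 => -[_ /= tT']; rewrite tT' in tT.
Qed.

End test_functions.

(** * Calculus of weak derivatives *)

Section weak_derivatives.
Variable R : realType.
Local Notation T2 := (measurableTypeR R * measurableTypeR R)%type.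
Local Notation leb := (@lebesgue_measure R).
Implicit Types u v f g : R * R -> R.

Lemma compact_measurable2 (K : set (R * R)) : compact K -> measurable (K : set T2).
Proof.
move=> cK; rewrite -[K]setCK; apply: measurableC; apply: open_measurable2.
by apply: closed_openC; apply: compact_closed cK; exact: norm_hausdorff.
Qed.

Lemma loc_integrable2P u : loc_integrable2 u <->
  measurable_fun (strip R : set T2) u /\ forall K : set (R * R), compact K -> K `<=` strip R ->
  (leb2 R).-integrable (K : set T2) (EFin \o u).
Proof.
split=> -[mu uK]; split => // K cK KS.
  apply/integrableP; split; last exact: uK.
  apply/measurable_EFinP; apply: measurable_funS mu => //; exact: measurable_strip.
by case/integrableP: (uK K cK KS).
Qed.

Lemma loc_integrable2D u v : loc_integrable2 u -> loc_integrable2 v ->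
  loc_integrable2 (fun p => u p + v p).
Proof.
move=> /loc_integrable2P[mu uK] /loc_integrable2P[mv vK]; apply/loc_integrable2P; split.
  exact: measurable_funD.
move=> K cK KS; have mK := compact_measurable2 cK.
exact: (integrableD mK (uK K cK KS) (vK K cK KS)).
Qed.

Lemma loc_integrable2Z c u : loc_integrable2 u -> loc_integrable2 (fun p => c * u p).
Proof.
move=> /loc_integrable2P[mu uK]; apply/loc_integrable2P; split.
  exact: measurable_funM.
move=> K cK KS; have mK := compact_measurable2 cK.
exact: (integrableZl mK c (uK K cK KS)).
Qed.

Lemma eq_loc_integrable2 u v : (forall p, strip R p -> u p = v p) ->
  loc_integrable2 u -> loc_integrable2 v.
Proof.
move=> uv [mu uK]; split.
  by apply: eq_measurable_fun mu => p /set_mem; exact: uv.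
move=> K cK KS; rewrite (_ : integral _ _ _ = (\int[leb2 R]_(p in (K : set T2)) `|u p|%:E)%E).
  exact: uK.
by apply: eq_integral => p /set_mem Kp; rewrite uv//; exact: KS.
Qed.

Lemma eq_is_wderiv2_real j k u v u' v' : (forall p, strip R p -> u p = u' p) ->
  (forall p, strip R p -> v p = v' p) -> is_wderiv2_real j k u v -> is_wderiv2_real j k u' v'.
Proof.
move=> uu vv [lu lv H]; split; [exact: eq_loc_integrable2 lu|exact: eq_loc_integrable2 lv|].
move=> phi tphi; have := H phi tphi => h.
rewrite (_ : Rintegral _ _ _ = \int[leb2 R]_(p in strip R) (u p * phi j k p)).
  rewrite h; congr (_ * _); apply: eq_Rintegral => p /set_mem Sp; rewrite vv//.
by apply: eq_Rintegral => p /set_mem Sp; rewrite uu.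
Qed.

Lemma is_wderiv2_realD j k u v u' v' : is_wderiv2_real j k u v -> is_wderiv2_real j k u' v' ->
  is_wderiv2_real j k (fun p => u p + u' p) (fun p => v p + v' p).
Proof.
move=> [lu lv H] [lu' lv' H']; split; [exact: loc_integrable2D|exact: loc_integrable2D|].
move=> phi tphi; have mS := @measurable_strip R.
under eq_Rintegral do rewrite mulrDl.
rewrite RintegralD//; try exact: integrable_test.
under [in RHS]eq_Rintegral do rewrite mulrDl.
rewrite RintegralD//; try exact: integrable_test.
by rewrite H// H'// mulrDr.
Qed.

Lemma is_wderiv2_realZ j k c u v : is_wderiv2_real j k u v ->
  is_wderiv2_real j k (fun p => c * u p) (fun p => c * v p).
Proof.
move=> [lu lv H]; split; [exact: loc_integrable2Z|exact: loc_integrable2Z|].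
move=> phi tphi; have mS := @measurable_strip R.
under eq_Rintegral do rewrite -mulrA.
rewrite RintegralZl//; try exact: integrable_test.
under [in RHS]eq_Rintegral do rewrite -mulrA.
rewrite RintegralZl//; try exact: integrable_test.
by rewrite H// mulrCA.
Qed.

Lemma is_wderiv2_real0 j k : is_wderiv2_real j k (fun=> 0 : R) (fun=> 0).
Proof.
have l0 : loc_integrable2 (fun=> 0 : R) by apply: continuous_loc_integrable2 => p; exact: cvg_cst.
have E (h : R * R -> R) : \int[leb2 R]_(p in strip R) (0 * h p) = 0.
  under eq_Rintegral do rewrite mul0r.
  by rewrite Rintegral_cst ?mul0r//; exact: measurable_strip.
by split => // phi _; rewrite !E mulr0.
Qed.

Lemma is_wderiv2_realB j k u v u' v' : is_wderiv2_real j k u v -> is_wderiv2_real j k u' v' ->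
  is_wderiv2_real j k (fun p => u p - u' p) (fun p => v p - v' p).
Proof.
move=> h /(is_wderiv2_realZ (-1)) /(is_wderiv2_realD h).
by apply: eq_is_wderiv2_real => p _; rewrite mulN1r.
Qed.

Lemma is_wderiv2_real_sum j k (I : Type) (s : seq I) (u v : I -> R * R -> R) :
  (forall i, is_wderiv2_real j k (u i) (v i)) ->
  is_wderiv2_real j k (fun p => \sum_(i <- s) u i p) (fun p => \sum_(i <- s) v i p).
Proof.
move=> H; elim: s => [|i s IH].
  by apply: eq_is_wderiv2_real (is_wderiv2_real0 j k) => p _; rewrite big_nil.
by apply: eq_is_wderiv2_real (is_wderiv2_realD (H i) IH) => p _; rewrite big_cons.
Qed.

Lemma is_wderiv2_real_dx j k u v w : is_wderiv2_real j k u v -> is_wderiv2_real j.+1 k u w ->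
  is_wderiv2_real 1 0 v w.
Proof.
move=> [lu lv H] [_ lw H']; split => // phi tphi.
(* [phi] itself is not of the form [psi j k]: apply both identities to the
   shifted families, whose entries of order 0 are [phi 1 0] and [phi 0 0]. *)
have := H _ (test_jet2_shift 1 0 tphi); have := H' _ tphi.
rewrite /= !add0n !add1n => -> e.
have : (-1) ^+ (j + k) * \int[leb2 R]_(p in strip R) (v p * phi 1%N 0%N p) =
   (-1) ^+ (j.+1 + k) * \int[leb2 R]_(p in strip R) (w p * phi 0%N 0%N p) by rewrite -e.
rewrite addSn exprS mulN1r mulNr => h.
have s0 : (-1) ^+ (j + k) != 0 :> R by rewrite signr_eq0.
by apply: (mulfI s0); rewrite h expr1 mulN1r mulrN.
Qed.

Lemma is_wderiv2_real_dt j k u v w : is_wderiv2_real j k u v -> is_wderiv2_real j k.+1 u w ->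
  is_wderiv2_real 0 1 v w.
Proof.
move=> [lu lv H] [_ lw H']; split => // phi tphi.
have := H _ (test_jet2_shift 0 1 tphi); have := H' _ tphi.
rewrite /= !add0n !add1n => -> e.
have : (-1) ^+ (j + k) * \int[leb2 R]_(p in strip R) (v p * phi 0%N 1%N p) =
   (-1) ^+ (j + k.+1) * \int[leb2 R]_(p in strip R) (w p * phi 0%N 0%N p) by rewrite -e.
rewrite addnS exprS mulN1r mulNr => h.
have s0 : (-1) ^+ (j + k) != 0 :> R by rewrite signr_eq0.
by apply: (mulfI s0); rewrite h expr1 mulN1r mulrN.
Qed.

(** The difference of the two sides integrates the x-derivative of p q phi, which is supported in a
    box: Fubini and the fundamental theorem of calculus give 0. *)
Lemma Rintegral_dx_by_parts (phi : nat -> nat -> R * R -> R) j k (p q p' : R -> R) :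
  test_jet2 phi -> (forall x, is_derive x (1 : R) p (p' x)) -> continuous p' -> continuous q ->
  \int[leb2 R]_(z in strip R) (p z.1 * q z.2 * phi j.+1 k z) =
  - \int[leb2 R]_(z in strip R) (p' z.1 * q z.2 * phi j k z).
Proof.
move=> tphi dp cp' cq.
have [a [T [[cphi dx _ _] /andP[a0 a1] T0 z0]]] := test_jet2_box tphi.
have cp : continuous p by move=> x; exact: is_derive_continuous (dp x).
have c1 : continuous (fun z : R * R => p z.1 * q z.2).
  by apply: continuous_mul2; [exact: continuous_fst_comp|exact: continuous_snd_comp].
have c2 : continuous (fun z : R * R => p' z.1 * q z.2).
  by apply: continuous_mul2; [exact: continuous_fst_comp|exact: continuous_snd_comp].
have i1 := integrable_test j.+1 k (continuous_loc_integrable2 c1) tphi.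
have i2 := integrable_test j k (continuous_loc_integrable2 c2) tphi.
apply/eqP; rewrite -subr_eq0 opprK -RintegralD//; last exact: measurable_strip.
rewrite /Rintegral (integral_box_zero_strip (T := T) a1); last first.
  by move=> z nb; rewrite !z0// !mulr0 addr0.
apply/eqP; rewrite -[RHS]/(fine (0%E : \bar R)); congr fine; apply: (@integral_dx_zero _ (fun z => p z.1 * q z.2 * phi j k z) _ a T) => //.
- move=> z; apply: cvgD; first exact: (continuous_mul2 c1 (cphi j.+1 k)).
  exact: (continuous_mul2 c2 (cphi j k)).
- move=> x t /=; have := is_derive_mul (is_derive_scale (q t) (dp x)) (dx j k x t).
  rewrite (_ : (fun y => _) = (fun y => p y * q t * phi j k (y, t))).
    by move=> /is_derive_eq; apply; ring.
  by apply/funext => y; ring.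
- by move=> z nb; rewrite z0// mulr0.
- by move=> z nb; rewrite !z0// !mulr0 addr0.
Qed.

Lemma Rintegral_dt_by_parts (phi : nat -> nat -> R * R -> R) j k (p q q' : R -> R) :
  test_jet2 phi -> (forall x, is_derive x (1 : R) q (q' x)) -> continuous q' -> continuous p ->
  \int[leb2 R]_(z in strip R) (p z.1 * q z.2 * phi j k.+1 z) =
  - \int[leb2 R]_(z in strip R) (p z.1 * q' z.2 * phi j k z).
Proof.
move=> tphi dq cq' cp.
have [a [T [[cphi _ dt _] /andP[a0 a1] T0 z0]]] := test_jet2_box tphi.
have cq : continuous q by move=> x; exact: is_derive_continuous (dq x).
have c1 : continuous (fun z : R * R => p z.1 * q z.2).
  by apply: continuous_mul2; [exact: continuous_fst_comp|exact: continuous_snd_comp].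
have c2 : continuous (fun z : R * R => p z.1 * q' z.2).
  by apply: continuous_mul2; [exact: continuous_fst_comp|exact: continuous_snd_comp].
have i1 := integrable_test j k.+1 (continuous_loc_integrable2 c1) tphi.
have i2 := integrable_test j k (continuous_loc_integrable2 c2) tphi.
apply/eqP; rewrite -subr_eq0 opprK -RintegralD//; last exact: measurable_strip.
rewrite /Rintegral (integral_box_zero_strip (T := T) a1); last first.
  by move=> z nb; rewrite !z0// !mulr0 addr0.
apply/eqP; rewrite -[RHS]/(fine (0%E : \bar R)); congr fine; apply: (@integral_dt_zero _ (fun z => p z.1 * q z.2 * phi j k z) _ a T) => //.
- move=> z; apply: cvgD; first exact: (continuous_mul2 c1 (cphi j k.+1)).
  exact: (continuous_mul2 c2 (cphi j k)).
- move=> x t /=; have := is_derive_mul (is_derive_scale (p x) (dq t)) (dt j k x t).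
  by move=> /is_derive_eq; apply; ring.
- by move=> z nb; rewrite z0// mulr0.
- by move=> z nb; rewrite !z0// !mulr0 addr0.
Qed.

Lemma is_wderiv2_real_tensor (p q : R -> R) j k : smooth p -> smooth q ->
  is_wderiv2_real j k (fun z => p z.1 * q z.2) (fun z => derive1n j p z.1 * derive1n k q z.2).
Proof.
move=> sp sq.
have ct m l : continuous (fun z : R * R => derive1n m p z.1 * derive1n l q z.2).
  apply: continuous_mul2; [apply: continuous_fst_comp|apply: continuous_snd_comp];
  by apply: smooth_continuous; exact: smooth_derive1n.
have cd m (f : R -> R) : smooth f -> continuous (derive1n m f : R -> R).
  by move=> sf; apply: smooth_continuous; exact: smooth_derive1n.
split; [exact: continuous_loc_integrable2 (ct 0%N 0%N)|exact: continuous_loc_integrable2|].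
move=> phi tphi.
have Hx l m : \int[leb2 R]_(z in strip R) (p z.1 * q z.2 * phi m l z) =
    (-1) ^+ m * \int[leb2 R]_(z in strip R) (derive1n m p z.1 * q z.2 * phi 0%N l z).
  (* The order i already carried by p is generalized, since each step moves one derivative from phi
     onto p. *)
  suff H n i : \int[leb2 R]_(z in strip R) (derive1n i p z.1 * q z.2 * phi n l z) =
    (-1) ^+ n * \int[leb2 R]_(z in strip R) (derive1n (i + n) p z.1 * q z.2 * phi 0%N l z).
    by have := H m 0%N; rewrite derive1n0.
  elim: n i => [|n IH] i; first by rewrite expr0 mul1r addn0.
  rewrite (Rintegral_dx_by_parts n l tphi (fun x => smooth_is_derive1n i x sp)); last 2 first.
  - exact: cd.
  - exact: smooth_continuous.
  by rewrite IH addnS exprS mulN1r mulNr addSn.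
rewrite Hx exprD -mulrA; congr (_ * _).
suff H n i : \int[leb2 R]_(z in strip R) (derive1n j p z.1 * derive1n i q z.2 * phi 0%N n z) =
    (-1) ^+ n * \int[leb2 R]_(z in strip R) (derive1n j p z.1 * derive1n (i + n) q z.2 * phi 0%N 0%N z).
  by have := H k 0%N; rewrite derive1n0.
elim: n i => [|n IH] i; first by rewrite expr0 mul1r addn0.
rewrite (Rintegral_dt_by_parts 0 n tphi (fun x => smooth_is_derive1n i x sq)); last 2 first.
- exact: cd.
- exact: cd.
by rewrite IH addnS exprS mulN1r mulNr addSn.
Qed.

End weak_derivatives.

Section weak_derivatives1.
Variable R : realType.
Local Notation leb := (@lebesgue_measure R).

(** The hypothesis on compact subsets places a symmetric interval between the support and [I]. It
    holds for (-1,1) and for the whole line, the two domains that occur in [sobolev_tensor]. *)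
Lemma is_wderiv1_real_smooth (I : set R) (m : nat) (g : R -> R) : open I -> measurable I ->
  (forall K, compact K -> K `<=` I -> exists2 b : R, 0 < b & K `<=` `[- b, b] /\ `[- b, b] `<=` I) ->
  smooth g -> is_wderiv1_real I m g (derive1n m g).
Proof.
move=> oI mI KI sg.
have cg n : continuous (derive1n n g : R -> R).
  by apply: smooth_continuous; exact: smooth_derive1n.
have lc (h : R -> R) : continuous h -> locally_integrable I h.
  move=> ch; split => //; first by apply: measurable_funTS; exact: continuous_measurable_fun.
  move=> K KI' cK; have /integrableP[//] : leb.-integrable K (EFin \o h).
  by apply: continuous_compact_integrable => //; exact: continuous_subspaceT.
split; [exact: lc (cg 0%N)|exact: lc|].
move=> phi [dphi [K [cK KsI K0]]].
have [b b0 [Kb bI]] := KI K cK KsI.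
have p0 n x : x \notin `[- b, b] -> derive1n n phi x = 0.
  apply: derive1n_zero_out => y yb; apply: K0 => /Kb yb'.
  by move/negP: yb; apply.
have dn n x : is_derive x (1 : R) (derive1n n phi) (derive1n n.+1 phi x).
  rewrite derive1nS derive1E; exact/derivableP.
have cp n : continuous (derive1n n phi) by move=> x; exact: is_derive_continuous (dn n x).
have int n l : leb.-integrable I (EFin \o (fun x => derive1n l g x * derive1n n phi x)).
  have mh : measurable_fun setT (fun x => derive1n l g x * derive1n n phi x).
    by apply: measurable_funM; exact: continuous_measurable_fun.
  have : leb.-integrable `[- b, b] (EFin \o (fun x => derive1n l g x * derive1n n phi x)).
    apply: continuous_compact_integrable; first exact: segment_compact.
    by apply: continuous_subspaceT => x; apply: cvgM; [exact: cg|exact: cp].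
  move=> /integrableP[_ h]; apply/integrableP; split.
    by apply/measurable_EFinP; exact: measurable_funTS.
  apply: le_lt_trans h; rewrite integral_mkcond [leRHS]integral_mkcond.
  apply: le_integral_nomeas => x _; rewrite /patch.
    by case: ifPn => // _; exact: abse_ge0.
  case: ifPn => [_|_]; last by case: ifPn => // _; exact: abse_ge0.
  case: ifPn => [//|nx] /=; rewrite p0 ?mulr0 ?normr0//.
  by apply: contra nx; rewrite mem_setE.
have step n l : \int[leb]_(x in I) (derive1n l g x * derive1n n.+1 phi x) =
    - \int[leb]_(x in I) (derive1n l.+1 g x * derive1n n phi x).
  apply/eqP; rewrite -subr_eq0 opprK -RintegralD//.
  rewrite /Rintegral.
  rewrite (_ : integral _ _ _ = (\int[leb]_x (derive1n l g x * derive1n n.+1 phi x +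
     derive1n l.+1 g x * derive1n n phi x)%:E)%E); last first.
    rewrite integral_mkcond; apply: eq_integral => x _; rewrite /patch.
    case: ifPn => // /negP nx; rewrite !p0 ?mulr0 ?addr0//; apply/negP => xb; apply: nx;
    by apply: mem_set; apply: bI.
  apply/eqP; rewrite -[RHS]/(fine (0%E : \bar R)); congr fine; apply: (@integral_derive_zero _ (fun x => derive1n l g x * derive1n n phi x) _ b) => //.
  - move=> x; have := is_derive_mul (smooth_is_derive1n l x sg) (dn n x).
    by move=> /is_derive_eq; apply; rewrite addrC.
  - move=> x; apply: cvgD; apply: cvgM; (try exact: cg); exact: cp.
  - by move=> x xb; rewrite p0// mulr0.
  - by move=> x xb; rewrite !p0// !mulr0 addr0.
suff H n i : \int[leb]_(x in I) (derive1n i g x * derive1n n phi x) =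
    (-1) ^+ n * \int[leb]_(x in I) (derive1n (i + n) g x * phi x).
  by have := H m 0%N; rewrite derive1n0.
elim: n i => [|n IH] i; first by rewrite expr0 mul1r addn0 derive1n0.
by rewrite step IH addnS exprS mulN1r mulNr addSn.
Qed.

End weak_derivatives1.

(** * Almost everywhere uniqueness of weak derivatives *)

Section vanishing.
Variable R : realType.
Local Notation T2 := (measurableTypeR R * measurableTypeR R)%type.
Local Notation leb := (@lebesgue_measure R).

Definition rect (a b c e : R) : set (R * R) := `]a, b[%classic `*` `]c, e[%classic.

Lemma measurable_rect a b c e : measurable (rect a b c e : set T2).
Proof. by apply: measurableX; exact: measurable_itv. Qed.

(** Dynkin's argument needs a generator stable under intersection. Bounded open rectangles generate
    because a band over an open interval is a countable union of them, which makes both projections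
    measurable. *)
Lemma measurable_rects : @measurable _ T2 `<=`
  <<s [set Q | exists a b c e, Q = rect a b c e] >>.
Proof.
set G := [set Q | _].
have bigrect n a b : <<s G>> (`]a, b[%classic `*` `]- n%:R, n%:R[%classic : set (R * R)).
  by apply: sub_sigma_algebra; exists a, b, (- n%:R), n%:R.
have bigrect' n a b : <<s G>> (`]- n%:R, n%:R[%classic `*` `]a, b[%classic : set (R * R)).
  by apply: sub_sigma_algebra; exists (- n%:R), n%:R, a, b.
have itvT (x : R) : exists n : nat, x \in `]- n%:R, n%:R[.
  have [n Hn] : exists n : nat, `|x| < n%:R.
    by exists (Num.truncn `|x|).+1; rewrite truncnS_gt.
  by exists n; rewrite in_itv/= -ltr_norml.
have mfst : measurable_fun (setT : set (g_sigma_algebraType G)) (fst : R * R -> R).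
  apply: (measurability _ (RGenOpens.measurableE R)).
  move=> _ [_ [a [b ->] <-]]; rewrite setTI.
  rewrite (_ : _ @^-1` _ = \bigcup_n (`]a, b[%classic `*` `]- n%:R, n%:R[%classic : set (R * R))).
    by apply: bigcupT_measurable => n; exact: bigrect.
  apply/seteqP; split=> [[x t] /= xab|[x t] [n _ []] //].
  by have [n Hn] := itvT t; exists n.
have msnd : measurable_fun (setT : set (g_sigma_algebraType G)) (snd : R * R -> R).
  apply: (measurability _ (RGenOpens.measurableE R)).
  move=> _ [_ [a [b ->] <-]]; rewrite setTI.
  rewrite (_ : _ @^-1` _ = \bigcup_n (`]- n%:R, n%:R[%classic `*` `]a, b[%classic : set (R * R))).
    by apply: bigcupT_measurable => n; exact: bigrect'.
  apply/seteqP; split=> [[x t] /= xab|[x t] [n _ []] //].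
  by have [n Hn] := itvT x; exists n.
rewrite measurable_prod_measurableType; apply: smallest_sub; first exact: smallest_sigma_algebra.
move=> _ [A mA] [B mB] <-.
have := mfst measurableT _ mA; have := msnd measurableT _ mB; rewrite !setTI => hB hA.
exact: (measurableI _ _ hA hB).
Qed.

Lemma setI_rect a b c e a' b' c' e' :
  rect a b c e `&` rect a' b' c' e' =
  rect (Num.max a a') (Num.min b b') (Num.max c c') (Num.min e e').
Proof.
apply/seteqP; split => -[x t]; rewrite /rect/= !in_itv/= !gt_max !lt_min.
  by move=> [[/andP[-> ->] /andP[-> ->]] [/andP[-> ->] /andP[-> ->]]].
by move=> [/andP[/andP[-> ->] /andP[-> ->]] /andP[/andP[-> ->] /andP[-> ->]]].
Qed.

(** Dynkin's argument: the measurable sets over which [h] integrates to 0 include the whole plane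
    and are closed under proper differences and under increasing unions, the latter by dominated
    convergence with bound |h|. *)
Lemma ae_zero_rect (h : T2 -> R) : (leb2 R).-integrable setT (EFin \o h) ->
  (forall a b c e, \int[leb2 R]_(p in rect a b c e) (h p)%:E = 0)%E ->
  ae_eq (leb2 R) setT (EFin \o h) (cst 0%E).
Proof.
move=> ih H.
have nd (F : (set T2)^nat) : nondecreasing_seq F -> (forall n, measurable (F n)) ->
    (forall n, \int[leb2 R]_(p in F n) (h p)%:E = 0)%E ->
    (\int[leb2 R]_(p in \bigcup_n F n) (h p)%:E = 0)%E.
  move=> ndF mF F0; rewrite integral_mkcond.
  have mh := measurable_int _ ih.
  have cv p : (((EFin \o h) \_ (F n)) p @[n --> \oo] -->
      ((EFin \o h) \_ (\bigcup_n F n)) p)%E.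
    rewrite /patch; case: ifPn => [/set_mem[n _ Fnp]|/negP np].
      apply: cvg_near_cst; exists n => // m /= nm; rewrite ifT//; apply: mem_set.
      by have /subsetPset := ndF _ _ nm; exact.
    apply: cvg_near_cst; apply: nearW => n; rewrite ifF//; apply/negP => /set_mem Fp.
    by apply: np; apply: mem_set; exists n.
  have := @dominated_cvg _ _ _ (leb2 R) setT measurableT
    (fun n => (EFin \o h) \_ (F n)) ((EFin \o h) \_ (\bigcup_n F n)) (abse \o (EFin \o h)).
  move=> /(_ _ _ _ _ _)/cvg_lim <- //.
  - transitivity (limn (fun=> 0%E : \bar R)); last exact: lim_cst.
    by congr (limn _); apply/funext => n; rewrite -integral_mkcond.
  - by move=> n; apply: (iffLR (measurable_restrictT (EFin \o h) (mF n))); exact: measurable_funS mh.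
  - exact: integrable_abse.
  - move=> n p _; rewrite /patch; case: ifPn => // _; rewrite abse0; exact: abse_ge0.
apply: integral_ae_eq => // E _ mE; rewrite integral0.
pose L : set (set T2) := [set E | measurable E /\ (\int[leb2 R]_(p in E) (h p)%:E = 0)%E].
suff : L E by case.
have IG : setI_closed [set Q : set (R * R) | exists a b c e, Q = rect a b c e].
  by move=> _ _ [a [b [c [e ->]]]] [a' [b' [c' [e' ->]]]]; rewrite setI_rect; do 4 eexists.
apply: (lambda_system_subset IG (D := setT) (H := L)) => //; last exact: measurable_rects.
- split => //.
  + split => //.
    rewrite (_ : setT = \bigcup_n rect (- n%:R) n%:R (- n%:R) n%:R); last first.
      apply/seteqP; split => // -[x t] _.
      exists (Num.truncn (Num.max `|x| `|t|)).+1 => //.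
      have : Num.max `|x| `|t| < (Num.truncn (Num.max `|x| `|t|)).+1%:R by exact: truncnS_gt.
      by rewrite gt_max => /andP[? ?]; split; rewrite /= in_itv/= -ltr_norml.
    apply: nd => // [|n]; last exact: measurable_rect.
    move=> m n mn; apply/subsetPset => -[x t]; rewrite /rect/= !in_itv/=.
    have : m%:R <= n%:R :> R by rewrite ler_nat.
    by move=> ? -[/andP[? ?] /andP[? ?]]; split; apply/andP; split; lra.
  + move=> A B BA [mA A0] [mB B0]; split; first exact: measurableD.
    have iA : (leb2 R).-integrable A (EFin \o h) by exact: integrableS ih.
    have := @integral_setU _ _ _ (leb2 R) (A `\` B) B (EFin \o h).
    rewrite setDKU// A0 B0 adde0 => <- //; first exact: measurableD.
    * exact: measurable_int iA.
    * by apply/disj_set2P; rewrite setDE -setIA setICl setI0.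
  + move=> F ndF LF; split; first by apply: bigcupT_measurable => n; case: (LF n).
    by apply: nd => // n; case: (LF n).
- by move=> _ [a [b [c [e ->]]]]; split; [exact: measurable_rect|exact: H].
Qed.

Lemma flat1_le1 (y : R) : 0 <= flat 1 y <= 1.
Proof.
rewrite /flat; case: ifPn => y0; last by rewrite lexx ler01.
by rewrite hornerC mul1r expR_ge0 -expR0 ler_expR oppr_le0 invr_ge0 ltW.
Qed.

Lemma cvg_flat1 (y : R) : flat 1 (n.+1%:R * y) @[n --> \oo] --> ((0 < y)%R%:R : R).
Proof.
have [y0|y0] := ltP 0 y; last first.
  rewrite (_ : (fun n => _) = (fun=> 0)); first exact: cvg_cst.
  by apply/funext => n; rewrite flat0// mulr_ge0_le0.
rewrite (_ : (fun n => _) = (fun n => expR (- (n.+1%:R^-1 * y^-1)))); last first.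
  by apply/funext => n; rewrite /flat ifT ?mulr_gt0// hornerC mul1r invfM.
rewrite -[X in _ --> X]expR0; apply: cvg_comp; last exact: continuous_expR.
rewrite -oppr0 -(mul0r y^-1); apply: cvgN; apply: cvgMl.
exact: cvg_harmonic.
Qed.

(** A smooth approximation of the indicator of ]a, b[ that vanishes outside this interval for every
    n; the scale n+1 only steepens the flanks. *)
Definition plateau (a b : R) (n : nat) (x : R) : R :=
  flat 1 (n.+1%:R * (x - a)) * flat 1 (n.+1%:R * (b - x)).

Lemma smooth_plateau a b n : smooth (plateau a b n).
Proof.
apply: smoothM; apply: (smooth_comp (smooth_flat 1)).
  have := smooth_horner (n.+1%:R *: ('X - a%:P)).
  by rewrite (_ : horner _ = (fun x => n.+1%:R * (x - a)))//; apply/funext => x; rewrite !hornerE.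
have := smooth_horner (n.+1%:R *: (b%:P - 'X)).
by rewrite (_ : horner _ = (fun x => n.+1%:R * (b - x)))//; apply/funext => x; rewrite !hornerE.
Qed.

Lemma plateau_out a b n x : x \notin `]a, b[ -> plateau a b n x = 0.
Proof.
rewrite in_itv/= negb_and -!leNgt /plateau => /orP[h|h].
  by rewrite flat0 ?mul0r// mulr_ge0_le0// subr_le0.
by rewrite [X in _ * X]flat0 ?mulr0// mulr_ge0_le0// subr_le0.
Qed.

Lemma plateau_le1 a b n x : `|plateau a b n x| <= 1.
Proof.
rewrite normrM; have /andP[h1 h2] := flat1_le1 (n.+1%:R * (x - a)).
have /andP[h3 h4] := flat1_le1 (n.+1%:R * (b - x)).
by rewrite !ger0_norm// mulr_ile1.
Qed.

Lemma cvg_plateau a b x : plateau a b n x @[n --> \oo] --> ((x \in `]a, b[)%R%:R : R).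
Proof.
rewrite in_itv/= -mulnb natrM -(subr_gt0 a x) -(subr_gt0 x b).
by apply: cvgM; exact: cvg_flat1.
Qed.

(** Products of plateaus are test functions converging to the indicator of the rectangle, and |h|
    restricted to the enclosing box dominates. *)
Lemma integral_rect_zero (h : R * R -> R) a T x1 x2 t1 t2 : loc_integrable2 h ->
  (forall phi, test_jet2 phi -> \int[leb2 R]_(p in strip R) (h p * phi 0%N 0%N p) = 0) ->
  0 < a < 1 -> - a <= x1 -> x2 <= a -> - T <= t1 -> t2 <= T ->
  (\int[leb2 R]_(p in rect x1 x2 t1 t2) (h p)%:E = 0)%E.
Proof.
move=> lh H a01 x1a x2a t1T t2T; have /andP[a0 a1] := a01.
have QB : rect x1 x2 t1 t2 `<=` box a T.
  move=> [x t] [/=]; rewrite !in_itv/= => /andP[? ?] /andP[? ?].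
  by split; rewrite /= in_itv/=; apply/andP; split; lra.
have QS := subset_trans QB (@box_strip R a T a1).
have mS := @measurable_strip R.
have mh : measurable_fun (strip R : set T2) h by case: lh.
pose f n (p : T2) := (h p * (plateau x1 x2 n p.1 * plateau t1 t2 n p.2))%:E.
have out1 n x : x \notin `[- a, a] -> plateau x1 x2 n x = 0.
  move=> xa; apply: plateau_out; apply: contra xa; rewrite !in_itv/= => /andP[? ?].
  by apply/andP; split; lra.
have out2 n t : t \notin `[- T, T] -> plateau t1 t2 n t = 0.
  move=> xa; apply: plateau_out; apply: contra xa; rewrite !in_itv/= => /andP[? ?].
  by apply/andP; split; lra.
have tj n := test_jet2_tensor (smooth_plateau x1 x2 n) (smooth_plateau t1 t2 n) a01 (out1 n) (out2 n).
have f0 n : (\int[leb2 R]_(p in (strip R : set T2)) f n p = 0)%E.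
  have h0 := H _ (tj n); rewrite !derive1n0 in h0.
  rewrite -[RHS]/(0%:E) -h0 /Rintegral fineK//; apply: (integrable_fin_num mS).
  by have := integrable_test 0 0 lh (tj n); rewrite !derive1n0.
have ib : (leb2 R).-integrable (strip R : set T2) (EFin \o (fun p => `|h p| * \1_(box a T) p)).
  have lah : loc_integrable2 (fun p => `|h p|).
    case: lh => _ hK; split; first exact: measurableT_comp.
    move=> K cK KS; rewrite (_ : integral _ _ _ = (\int[leb2 R]_(p in (K : set T2)) `|h p|%:E)%E); first exact: hK.
    by apply: eq_integral => p _; rewrite normr_id.
  apply: (@integrable_bounded_box _ _ (\1_(box a T)) a T 1) => //.
  - by apply: measurable_indic; exact: measurable_box.
  - by move=> p; rewrite indicE ger0_norm// lern1 leq_b1.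
  - by move=> p nb; rewrite indicE memNset.
have := @dominated_cvg _ _ _ (leb2 R) (strip R : set T2) mS f
  (fun p => (h p * \1_(rect x1 x2 t1 t2) p)%:E) (EFin \o (fun p => `|h p| * \1_(box a T) p)).
move=> /(_ _ _ _ _ _)/cvg_lim E.
transitivity (\int[leb2 R]_(p in (strip R : set T2)) (h p * \1_(rect x1 x2 t1 t2) p)%:E)%E.
  rewrite [LHS]integral_mkcond [RHS]integral_mkcond; apply: eq_integral => p _.
  rewrite /patch indicE; case: ifPn => [/set_mem Qp|_].
    by rewrite mulr1 ifT//; apply: mem_set; exact: QS.
  by rewrite mulr0; case: ifPn.
rewrite -E //.
- rewrite (_ : (fun n => _) = (fun=> 0%E)); first exact: lim_cst.
  by apply/funext => n; exact: f0.
- move=> n; apply/measurable_EFinP; apply: measurable_funM => //; apply: measurable_funM.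
    by apply: measurable_comp_fst; apply: continuous_measurable_fun; apply: smooth_continuous; exact: smooth_plateau.
  by apply: measurable_comp_snd; apply: continuous_measurable_fun; apply: smooth_continuous; exact: smooth_plateau.
- move=> p Sp; apply: cvg_EFin; first exact: nearW.
  rewrite /comp/=; apply: cvgM; first exact: cvg_cst.
  rewrite indicE (_ : (p \in rect x1 x2 t1 t2) = (p.1 \in `]x1, x2[) && (p.2 \in `]t1, t2[)).
    by rewrite -mulnb natrM; apply: cvgM; exact: cvg_plateau.
  by apply/idP/andP => [/set_mem[]//|[? ?]]; apply: mem_set.
- move=> n p Sp; rewrite lee_fin normrM ler_wpM2l//.
  have [bp|/not_box[nb|nb]] := pselect (box a T p).
  + by rewrite indicE mem_set// normrM mulr_ile1// plateau_le1.
  + by rewrite out1// mul0r normr0 indicE.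
  + by rewrite out2// mulr0 normr0 indicE.
Qed.

(** The fundamental lemma of the calculus of variations. It is first obtained on each [Q n], where
    [h] is integrable; these exhaust the strip, and countably many exceptional sets are negligible
    together. *)
Lemma ae_zero_test (h : R * R -> R) : loc_integrable2 h ->
  (forall phi, test_jet2 phi -> \int[leb2 R]_(p in strip R) (h p * phi 0%N 0%N p) = 0) ->
  ae_eq (leb2 R) (strip R : set T2) h (cst 0).
Proof.
move=> lh H.
have mh : measurable_fun (strip R : set T2) h by case: lh.
(* The shift by 2 keeps the half-width positive at n = 0. *)
pose a (n : nat) : R := 1 - n.+2%:R^-1.
have a01 n : 0 < a n < 1.
  rewrite /a subr_gt0 invf_lt1// ltr1n/= gtrDl oppr_lt0 invr_gt0//.
pose Q n := rect (- a n) (a n) (- n.+1%:R) n.+1%:R.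
have Qbox n : Q n `<=` box (a n) n.+1%:R.
  by move=> [x t] []; rewrite /= !in_itv/= => /andP[? ?] /andP[? ?]; split; rewrite /= in_itv/=; apply/andP; split; exact: ltW.
have QS n : Q n `<=` strip R.
  by apply: subset_trans (Qbox n) _; apply: box_strip; case/andP: (a01 n).
have mQ n : measurable (Q n : set T2) by exact: measurable_rect.
have Z n : ae_eq (leb2 R) setT (EFin \o (h \_ (Q n))) (cst 0%E).
  apply: ae_zero_rect.
    have [+ _] := @integrable_mkcond _ _ _ (leb2 R) _ (EFin \o h) (mQ n).
    rewrite -restrict_EFin; apply.
    have /loc_integrable2P[_ hK] := lh.
    have bS : box (a n) n.+1%:R `<=` strip R by apply: box_strip; case/andP: (a01 n).
    exact: integrableS (measurable_box _ _) (mQ n) (Qbox n) (hK _ (@compact_box _ _ _) bS).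
  move=> x1 x2 t1 t2.
  transitivity (\int[leb2 R]_(p in rect x1 x2 t1 t2 `&` Q n) (h p)%:E)%E.
    by rewrite [RHS]integral_mkcondr; apply: eq_integral => p _; rewrite /patch; case: ifPn.
  rewrite setI_rect; apply: (@integral_rect_zero _ (a n) n.+1%:R) => //.
  - by rewrite le_max lexx orbT.
  - by rewrite ge_min lexx orbT.
  - by rewrite le_max lexx orbT.
  - by rewrite ge_min lexx orbT.
have [N HN] : {N : nat -> set T2 & forall n, [/\ measurable (N n), leb2 R (N n) = 0%E &
    forall p, ~ N n p -> (h \_ (Q n)) p = 0]}.
  apply: (@boolp.choice _ _ (fun n N => [/\ measurable N, leb2 R N = 0%E &
    forall p, ~ N p -> (h \_ (Q n)) p = 0])) => n.
  have [N [mN N0 NS]] := Z n; exists N; split => // p Np.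
  apply: contrapT => hp; apply: Np; apply: NS => /= e; apply: hp; apply: EFin_inj; exact: e I.
have negN : (leb2 R).-negligible (\bigcup_n N n).
  by apply: negligible_bigcup => n; have [mN N0 _] := HN n; apply/negligibleP.
apply: negligibleS negN.
move=> p /= /not_implyP[Sp hp].
  have [n Qn] : exists n, Q n p.
    have s1 : `|p.1| < 1 by rewrite ltr_norml.
    pose n := maxn (Num.truncn (1 - `|p.1|)^-1) (Num.truncn `|p.2|).
    exists n.
    have h1 : (1 - `|p.1|)^-1 < n.+2%:R.
      by apply: lt_le_trans (truncnS_gt _) _; rewrite ler_nat ltnS leqW// leq_maxl.
    have h2 : `|p.2| < n.+1%:R.
      by apply: lt_le_trans (truncnS_gt _) _; rewrite ler_nat ltnS leq_maxr.
    split; rewrite /= in_itv/= -ltr_norml//.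
    have : n.+2%:R^-1 < 1 - `|p.1|.
      by rewrite -[ltRHS]invrK ltf_pV2 ?posrE ?invr_gt0 ?ltr0n// subr_gt0.
    by rewrite ltrBrDr => e; rewrite /a ltrBrDr addrC.
  exists n => //; apply: contrapT => Np; apply: hp.
  by have [_ _ /(_ p Np)] := HN n; rewrite /patch mem_set.
Qed.

(** [wderiv2] being an arbitrary choice, this is what allows its norm to be computed from any weak
    derivative. *)
Lemma wderiv2_real_unique j k (u v v' : R * R -> R) :
  is_wderiv2_real j k u v -> is_wderiv2_real j k u v' ->
  ae_eq (leb2 R) (strip R : set T2) v v'.
Proof.
move=> H H'; have [l0 l1 h] := is_wderiv2_realB H H'.
have : ae_eq (leb2 R) (strip R : set T2) (fun p => v p - v' p) (cst 0).
  apply: ae_zero_test => // phi tphi; have := h phi tphi.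
  under eq_Rintegral do rewrite subrr mul0r.
  rewrite Rintegral_cst ?mul0r; last exact: measurable_strip.
  move=> /esym /eqP; rewrite mulf_eq0 signr_eq0/= => /eqP; exact.
apply: filterS => p /= e Sp; apply/eqP; rewrite -subr_eq0; apply/eqP; exact: e.
Qed.

End vanishing.

Lemma deriv_nat (R : nzRingType) n : (n%:R : {poly R})^`() = 0.
Proof. by rewrite -polyC_natr derivC. Qed.

(** * Hermite and Gegenbauer polynomials *)

Section hermite_poly.
Variable R : realType.

(** The monic (probabilists') Hermite polynomials; the recurrence records, up to sign, one
    derivative of He(v) exp(-v^2/2). *)
Fixpoint He (k : nat) : {poly R} := if k is l.+1 then 'X * He l - (He l)^`() else 1.

Lemma He_deriv k : (He k.+1)^`() = k.+1%:R * He k.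
Proof.
elim: k => [|k IH]; first by rewrite /= -polyC1 !derivC mulr1 subr0 derivX mul1r.
rewrite [He k.+2]/= derivB derivM derivX !IH -[He k.+1]/('X * He k - (He k)^`()).
rewrite derivM deriv_nat -natr1; ring.
Qed.

Lemma is_derive_HeM k (v : R) :
  is_derive v (1 : R) (fun v => (He k).[v] * expR (- (v ^+ 2) / 2))
    (- ((He k.+1).[v] * expR (- (v ^+ 2) / 2))).
Proof.
have dg : is_derive v (1 : R) (fun v : R => - (v ^+ 2) / 2) (- v).
  have := is_derive_poly ((- 2^-1) *: 'X^2) v.
  rewrite (_ : horner _ = (fun v : R => - (v ^+ 2) / 2)); last first.
    by apply/funext => x; rewrite hornerZ hornerXn; field.
  by move=> /is_derive_eq; apply; rewrite derivZ derivXn hornerZ hornerMn hornerXn/= expr1; field.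
have := is_derive_mul (is_derive_poly (He k) v) (is_derive_comp (is_derive_expR _) dg).
move=> /is_derive_eq; apply; rewrite -[He k.+1]/('X * He k - (He k)^`()).
by rewrite hornerD hornerN hornerM hornerX; ring.
Qed.

Lemma derive1n_gauss k : derive1n k (fun v : R => expR (- (v ^+ 2) / 2)) =
  (fun v => (-1) ^+ k * ((He k).[v] * expR (- (v ^+ 2) / 2))).
Proof.
elim: k => [|k IH]; first by apply/funext => v; rewrite derive1n0 hornerC !mul1r.
rewrite derive1nS IH; apply: derive1_is_derive => v.
have := is_derive_scale ((-1) ^+ k) (is_derive_HeM k v).
by move=> /is_derive_eq; apply; rewrite [in RHS]exprS mulN1r mulNr mulrN.
Qed.

Definition herm_scale k : R := (Num.sqrt (k`!%:R * Num.sqrt (2 * pi)))^-1.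

Lemma sqrt2pi_gt0 : 0 < Num.sqrt (2 * pi) :> R.
Proof. by rewrite sqrtr_gt0 mulr_gt0// pi_gt0. Qed.

Lemma herm_scale_gt0 k : 0 < herm_scale k.
Proof. by rewrite invr_gt0 sqrtr_gt0 mulr_gt0 ?sqrt2pi_gt0// ltr0n fact_gt0. Qed.

Lemma herm_scale_sq k : herm_scale k ^+ 2 = (k`!%:R * Num.sqrt (2 * pi))^-1.
Proof.
by rewrite exprVn sqr_sqrtr// mulr_ge0// ltW// sqrt2pi_gt0.
Qed.

Lemma hermiteE k (u : R) : hermite k u = herm_scale k * (He k).[u].
Proof.
rewrite /hermite derive1n_gauss mulNr expRN -/(herm_scale k).
set E := expR _; have E0 : E != 0 by rewrite gt_eqF// expR_gt0.
rewrite (_ : _ * _ = ((-1) ^+ k * (-1) ^+ k) * (herm_scale k * (He k).[u])).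
  by rewrite -expr2 sqrr_sign mul1r.
by rewrite /herm_scale; field; rewrite E0/= gt_eqF// sqrtr_gt0 mulr_gt0 ?sqrt2pi_gt0// ltr0n fact_gt0.
Qed.

(** Hermite's equation differentiated l times: each derivative of the term x y' contributes one more
    y', which lowers the eigenvalue by 1. *)
Lemma He_ode k l : (He k)^`(l.+2) - 'X * (He k)^`(l.+1) = - (k%:R - l%:R) * (He k)^`(l).
Proof.
elim: l => [|l IH].
  rewrite subr0 derivn0 !derivSn/=.
  case: k => [|k]; first by rewrite /= -polyC1 !derivC; ring.
  rewrite He_deriv derivM deriv_nat mul0r add0r.
  by rewrite [He k.+1 in RHS]/=; ring.
have := congr1 (@deriv R) IH.
rewrite derivB derivM derivX !derivnS derivM.
rewrite -!polyC_natr -polyCB -polyCN derivC mul0r add0r mul1r polyCN polyCB !polyC_natr.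
rewrite -natr1 => e.
have -> : (He k)^`(l)^`()^`()^`() - 'X * (He k)^`(l)^`()^`() =
  ((He k)^`(l)^`()^`()^`() - ((He k)^`(l)^`() + 'X * (He k)^`(l)^`()^`())) + (He k)^`(l)^`() by ring.
by rewrite e; ring.
Qed.

End hermite_poly.

Section gegenbauer_poly.
Variables (R : realType) (d : nat).
Hypothesis d0 : (0 < d)%N.

(** With the normalization at x = 1 the only divisor is i + d, positive for d >= 1, so that the
    Chebyshev case d = 1 follows the same recurrence. *)
Fixpoint geg_pair (j : nat) : {poly R} * {poly R} :=
  if j is i.+1 then
    let: (P, Q) := geg_pair i in
    (Q, (i + d)%:R^-1 *: ((2 * i + d + 1)%:R *: ('X * Q) - i.+1%:R *: P))
  else (1, 'X).

(* [geg j] is the Gegenbauer polynomial of order (d-1)/2 with value 1 at 1. *)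
Definition geg j := (geg_pair j).1.

Lemma geg_pairE j : geg_pair j = (geg j, geg j.+1).
Proof. by rewrite /geg /=; case: (geg_pair j). Qed.

Lemma geg0 : geg 0 = 1. Proof. by []. Qed.
Lemma geg1 : geg 1 = 'X. Proof. by []. Qed.

Lemma gegSS_scaled j : geg j.+2 =
  (j + d)%:R^-1 *: ((2 * j + d + 1)%:R *: ('X * geg j.+1) - j.+1%:R *: geg j).
Proof. by rewrite {1}/geg /= geg_pairE. Qed.

Lemma natpoly_neq0 n : (0 < n)%N -> n%:R != 0 :> {poly R}.
Proof. by move=> n0; rewrite -polyC_natr polyC_eq0 pnatr_eq0 -lt0n. Qed.

Lemma scale_nat n (p : {poly R}) : (n%:R : R) *: p = n%:R * p.
Proof. by rewrite -mul_polyC polyC_natr. Qed.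

Lemma gegSS j : (j + d)%:R * geg j.+2 = (2 * j + d + 1)%:R * 'X * geg j.+1 - j.+1%:R * geg j.
Proof.
rewrite gegSS_scaled -scale_nat scalerA divff ?scale1r; last by rewrite pnatr_eq0 addn_eq0; lia.
by rewrite !scale_nat mulrA.
Qed.

Lemma geg_at1 j : (geg j).[1] = 1.
Proof.
suff : (geg j).[1] = 1 /\ (geg j.+1).[1] = 1 by case.
elim: j => [|j [IH0 IH1]]; first by rewrite geg0 geg1 hornerC hornerX.
split=> //; rewrite gegSS_scaled hornerZ hornerD hornerN !hornerZ hornerM hornerX IH0 IH1.
have : (j + d)%:R != 0 :> R by rewrite pnatr_eq0 addn_eq0; lia.
move=> h; rewrite !mulr1 (_ : (2 * j + d + 1)%:R - j.+1%:R = (j + d)%:R).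
  by rewrite mulVf.
by apply/eqP; rewrite subr_eq -natrD; apply/eqP; congr (_%:R); lia.
Qed.

(** The differential equation does not pass through the three-term recurrence by itself. It is
    carried along with two first-order relations expressing (1 - x^2) times a derivative by
    neighbouring polynomials; divisions by 1 - x^2 and by j + d are cancellations in the integral
    domain of polynomials. *)
Lemma geg_rel j :
  [/\ (1 - 'X^2) * (geg j)^`() = (j%:R + d%:R - 1) * ('X * geg j - geg j.+1),
      (1 - 'X^2) * (geg j.+1)^`() = j.+1%:R * (geg j - 'X * geg j.+1) &
      (1 - 'X^2) * (geg j)^`()^`() = d%:R * 'X * (geg j)^`() - j%:R * (j%:R + d%:R - 1) * geg j].
Proof.
elim: j => [|j [A B C]].
  rewrite geg0 geg1 -polyC1 !derivC derivX -polyC1; split; ring.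
have D2 : (1 - 'X^2 : {poly R}) != 0.
  apply/eqP => /(congr1 (fun p : {poly R} => p.[0])); rewrite !hornerE/= expr0n/= subr0.
  by apply/eqP; exact: oner_neq0.
have rec := gegSS j.
have A' : (1 - 'X^2) * (geg j.+1)^`() = (j.+1%:R + d%:R - 1) * ('X * geg j.+1 - geg j.+2).
  rewrite B (_ : (j.+1%:R + d%:R - 1) * ('X * geg j.+1 - geg j.+2) =
     (j + d)%:R * ('X * geg j.+1) - (j + d)%:R * geg j.+2); last by ring.
  by rewrite rec; ring.
(* [T] frees the derivative of [geg j] from the factor 1 - x^2, which closes the differentiated
   relation [B] into the equation for [geg j.+1]. *)
have T : j.+1%:R * (geg j)^`() = (j%:R + d%:R - 1) * ('X * (geg j.+1)^`() - j.+1%:R * geg j.+1).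
  apply: (mulfI D2); rewrite mulrCA A.
  rewrite [RHS](_ : _ = (j%:R + d%:R - 1) * ('X * ((1 - 'X^2) * (geg j.+1)^`()) - j.+1%:R * ((1 - 'X^2) * geg j.+1))); last by ring.
  by rewrite B; ring.
have C' : (1 - 'X^2) * (geg j.+1)^`()^`() =
    d%:R * 'X * (geg j.+1)^`() - j.+1%:R * (j.+1%:R + d%:R - 1) * geg j.+1.
  have := congr1 (@deriv R) B.
  rewrite !derivM !derivB derivXn derivM derivX deriv_nat -polyC1 derivC polyC1 -mulr_natl => e.
  have -> : (1 - 'X^2) * (geg j.+1)^`()^`() =
     ((0 - 2%:R * 'X^1) * (geg j.+1)^`() + (1 - 'X^2) * (geg j.+1)^`()^`()) + 2%:R * 'X * (geg j.+1)^`().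
    by rewrite expr1; ring.
  rewrite e mul0r add0r mulrBr T -natr1; ring.
split=> //.
have jd : (j.+1%:R + d%:R - 1 : {poly R}) != 0.
  rewrite (_ : _ - 1 = (j + d)%:R); first by apply: natpoly_neq0; lia.
  by rewrite natrD -natr1; ring.
have := congr1 (@deriv R) A'.
rewrite !derivM !derivB !derivD derivXn derivM derivX !deriv_nat -polyC1 derivC polyC1 -mulr_natl expr1.
rewrite C' => e.
have S : (j.+1%:R + d%:R - 1) * (geg j.+2)^`() =
    j.+2%:R * ((j.+1%:R + d%:R - 1) * geg j.+1 + 'X * (geg j.+1)^`()).
  apply/eqP; rewrite -subr_eq0; apply/eqP.
  move/eqP: e; rewrite -subr_eq0 => /eqP e; rewrite -[RHS]e -[j.+2%:R]natr1; ring.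
apply: (mulfI jd); rewrite mulrCA S.
rewrite [LHS](_ : _ = j.+2%:R * ((j.+1%:R + d%:R - 1) * ((1 - 'X^2) * geg j.+1) + 'X * ((1 - 'X^2) * (geg j.+1)^`()))); last by ring.
by rewrite A'; ring.
Qed.

(** In self-adjoint form, with y the polynomial and lambda = (j-m)(j+m+d-1): ((1-x^2)^(d/2+m)
    y^(m+1))' = -lambda (1-x^2)^(d/2-1+m) y^(m). The two powers are the weights of index m+1 and m.
    Differentiating once lowers lambda by d + 2m. *)
Lemma geg_ode j m : (1 - 'X^2) * (geg j)^`(m.+2) - (d%:R + 2 * m%:R) * 'X * (geg j)^`(m.+1) =
  - ((j%:R - m%:R) * (j%:R + m%:R + d%:R - 1)) * (geg j)^`(m).
Proof.
elim: m => [|m IH].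
  have [_ _ C] := geg_rel j; rewrite (derivnS _ 1) !derivn1 C; ring.
have one0 : (1 : {poly R})^`() = 0 by rewrite -polyC1 derivC.
have K0 : (- ((j%:R - m%:R) * (j%:R + m%:R + d%:R - 1)) : {poly R})^`() = 0.
  by rewrite derivN derivM !derivB !derivD !deriv_nat one0; ring.
have L0 : (d%:R + 2 * m%:R : {poly R})^`() = 0.
  by rewrite derivD derivM !deriv_nat; ring.
have Q0 : (1 - 'X^2 : {poly R})^`() = - (2 * 'X).
  by rewrite derivB one0 derivXn expr1; ring.
have := congr1 (@deriv R) IH.
rewrite derivB derivM Q0 derivM derivM L0 derivX derivM K0 -!derivnS => e.
apply/eqP; rewrite -subr_eq0; apply/eqP.
move/eqP: e; rewrite -subr_eq0 => /eqP e; rewrite -[RHS]e; ring.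
Qed.

Lemma gegenbauerE j : exists2 c : R, c != 0 & gegenbauer ((d%:R - 1) / 2) j = c *: geg j.
Proof.
rewrite /gegenbauer; have [r0|r0] := eqVneq ((d%:R - 1) / 2 : R) 0.
  have d1 : d = 1%N.
    have : d%:R = 1%:R :> R by lra.
    by move=> /eqP; rewrite eqr_nat => /eqP.
  have H i : chebyshev_pair R i = (geg i, geg i.+1).
    elim: i => // i IH; rewrite /= IH gegSS_scaled d1; congr pair.
    have h : (i + 1)%:R != 0 :> R by rewrite pnatr_eq0; lia.
    rewrite !scalerBr !scalerA (_ : (2 * i + 1 + 1)%N = (2 * (i + 1))%N); last by lia.
    rewrite natrM mulrCA mulVf// mulr1 -[i.+1]addn1 mulVf//.
    by rewrite scale1r scale_nat.
  case: j => [|j]; first by exists 1; [exact: oner_neq0|rewrite scale1r].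
  exists (2 / j.+1%:R); first by rewrite mulf_neq0 ?invr_neq0 ?pnatr_eq0.
  by rewrite H.
have d1 : (1 < d)%N.
  rewrite ltn_neqAle d0 andbT; apply: contraNneq r0 => <-; by rewrite subrr mul0r.
(* [c i] is the value at 1 of the Gegenbauer polynomial of order (d-1)/2, the binomial coefficient
   of i+d-2 over i. *)
pose c i : R := \prod_(l < i) ((l%:R + d%:R - 1) / l.+1%:R).
have cS i : c i.+1 = c i * ((i%:R + d%:R - 1) / i.+1%:R) by rewrite /c big_ord_recr.
have H i : gegenbauer_pair ((d%:R - 1) / 2) i = (c i *: geg i, c i.+1 *: geg i.+1).
  elim: i => [|i IH].
    rewrite /= cS /c big_ord0 geg0 geg1 scale1r; congr pair; congr (_ *: _).
    by rewrite mul1r divr1 add0r; field.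
  rewrite /= IH; congr pair.
  have h : (i + d)%:R != 0 :> R by rewrite pnatr_eq0; lia.
  have h2 : i.+2%:R != 0 :> R by rewrite pnatr_eq0.
  have h1 : i.+1%:R != 0 :> R by rewrite pnatr_eq0.
  rewrite gegSS_scaled (cS i.+1) -['X * (_ *: geg i.+1)]scalerAr !scalerBr !scalerA.
  congr (_ *: _ - _ *: _).
    by field; rewrite -!natrD !pnatr_eq0; lia.
  by rewrite (cS i); field; rewrite ?nat1r -!natrD !pnatr_eq0; lia.
exists (c j); last by rewrite H.
rewrite /c; apply/prodf_neq0 => l _; rewrite mulf_neq0 ?invr_neq0 ?pnatr_eq0//.
rewrite (_ : _ - 1 = (l + d.-1)%:R); first by rewrite pnatr_eq0; lia.
by rewrite natrD -subn1 natrB//; ring.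
Qed.

Lemma gegenbauer_stdE j (x : R) : gegenbauer_std ((d%:R - 1) / 2) j x = (geg j).[x].
Proof.
rewrite /gegenbauer_std; have [c c0 ->] := gegenbauerE j.
by rewrite !hornerZ geg_at1 mulr1 mulrAC divff// mul1r.
Qed.

End gegenbauer_poly.

Section second_degree.
Variable R : realType.

Lemma gegenbauer_std0 (r x : R) : gegenbauer_std r 0 x = 1.
Proof.
by rewrite /gegenbauer_std /gegenbauer; case: ifP => _; rewrite /= !hornerC divr1.
Qed.

(** Standardizing cancels the factor r of C_2^r, so one formula covers the degenerate order r = 0,
    and only 1 + 2r is left in the denominator. *)
Lemma gegenbauer_std2 (r x : R) : - (1 / 2) < r ->
  gegenbauer_std r 2 x = (2 * (1 + r) * x ^+ 2 - 1) / (1 + 2 * r).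
Proof.
move=> r12; have h : 1 + 2 * r != 0 by apply: lt0r_neq0; lra.
rewrite /gegenbauer_std /gegenbauer; case: eqVneq => [->|r0] /=.
  by rewrite !hornerE/= !hornerE; field.
rewrite !hornerE/= !hornerE; field.
rewrite h /= (_ : _ - _ = 2 * r * (1 + 2 * r)); last by ring.
by rewrite !mulf_neq0.
Qed.

End second_degree.

(** * Dimensions of the spaces of spherical harmonics *)

Section dimension.
Variables (R : realType).

Lemma dim_harm0 d : dim_harm R d 0 = 1. Proof. by []. Qed.

Lemma dim_harm_gt0 d j : (0 < d)%N -> 0 < dim_harm R d j.
Proof.
case: j => [//|j] d0; rewrite /dim_harm divr_gt0// ltr0n muln_gt0 ?fact_gt0 ?andbT//; lia.
Qed.

Lemma dim_harm1 d : (0 < d)%N -> dim_harm R d 1 = d%:R + 1.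
Proof.
case: d => // e _; rewrite /dim_harm.
rewrite (_ : (1 + e.+1 - 2)%N = e) 1?(_ : (e.+1 - 1)%N = e) 1?(_ : (2 * 1 + e.+1 - 1)%N = e.+2); try lia.
by rewrite (_ : 1`! = 1%N)// mul1n natrM mulfK ?pnatr_eq0 -?lt0n ?fact_gt0// natr1.
Qed.

Lemma dim_harmS d j : (0 < d)%N -> (0 < j)%N ->
  dim_harm R d j.+1 * (j.+1%:R * (2 * j%:R + d%:R - 1)) =
  dim_harm R d j * ((2 * j%:R + d%:R + 1) * (j%:R + d%:R - 1)).
Proof.
case: d j => // e [//|i] _ _; rewrite /dim_harm.
rewrite (_ : (e.+1 - 1)%N = e) 1?(_ : (2 * i.+2 + e.+1 - 1)%N = (2 * i + e + 4)%N)
  1?(_ : (2 * i.+1 + e.+1 - 1)%N = (2 * i + e + 2)%N) 1?(_ : (i.+2 + e.+1 - 2)%N = (i + e).+1)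
  1?(_ : (i.+1 + e.+1 - 2)%N = (i + e)%N); try lia.
have F n : n`!%:R != 0 :> R by rewrite pnatr_eq0 -lt0n fact_gt0.
have Fe := F e; have Fie := F (i + e)%N; have Fi := F i.
move: Fe Fie Fi; rewrite !factS.
set a := (i + e)`!; set b := i`!; set c := e`! => Fe Fie Fi.
by field; rewrite Fe Fi ?nat1r -!natrD !pnatr_eq0.
Qed.

Lemma fact_bounds i e : (i.+1 ^ e * i`! <= (i + e)`! <= e`! * i.+1 ^ e * i`!)%N.
Proof.
elim: e => [|e /andP[IH1 IH2]]; first by rewrite expn0 !mul1n addn0 leqnn.
rewrite addnS !factS !expnS; apply/andP; split.
  by rewrite -mulnA leq_mul// ltnS leq_addr.
rewrite (_ : (e.+1 * e`! * (i.+1 * i.+1 ^ e) * i`! = (e.+1 * i.+1) * (e`! * i.+1 ^ e * i`!))%N); last by ring.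
by rewrite leq_mul//; nia.
Qed.

Lemma dim_harm_bounds d : (0 < d)%N -> exists2 C : R, 0 < C & forall j, (0 < j)%N ->
  j%:R ^+ (d - 1) <= C * dim_harm R d j /\ dim_harm R d j <= C * j%:R ^+ (d - 1).
Proof.
(* With d = e + 1, the summand e! serves the first bound and e + 2 the second. *)
case: d => // e _; exists (e`!%:R + e.+2%:R); first by rewrite addr_gt0// ltr0n ?fact_gt0.
case=> // i _; rewrite /dim_harm.
rewrite (_ : (e.+1 - 1)%N = e) 1?(_ : (2 * i.+1 + e.+1 - 1)%N = (2 * i.+1 + e)%N)
  1?(_ : (i.+1 + e.+1 - 2)%N = (i + e)%N); try lia.
have /andP[h1 h2] := fact_bounds i e.
have F n : 0 < n`!%:R :> R by rewrite ltr0n fact_gt0.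
have [Fe Fi] := (F e, F i).
split.
  rewrite mulrA ler_pdivlMr ?ltr0n ?muln_gt0 ?fact_gt0//.
  apply: (@le_trans _ _ (e`!%:R * ((2 * i.+1 + e) * (i + e)`!)%:R)).
    rewrite -natrX -!natrM ler_nat factS.
    rewrite (_ : (i.+1 ^ e * (i.+1 * i`! * e`!) = e`! * (i.+1 * (i.+1 ^ e * i`!)))%N); last by ring.
    by rewrite leq_mul// leq_mul//; lia.
  by rewrite ler_wpM2r// lerDl.
rewrite ler_pdivrMr ?ltr0n ?muln_gt0 ?fact_gt0//.
apply: (@le_trans _ _ (e.+2%:R * i.+1%:R ^+ e * (i.+1`! * e`!)%:R)).
  rewrite -natrX -!natrM ler_nat factS.
  rewrite (_ : (e.+2 * i.+1 ^ e * (i.+1 * i`! * e`!) = (e.+2 * i.+1) * (e`! * i.+1 ^ e * i`!))%N); last by ring.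
  by rewrite leq_mul//; nia.
by rewrite ler_wpM2r// ler_wpM2r ?exprn_ge0// lerDr ltW.
Qed.

End dimension.

(** * Jacobi and Gaussian weights: finite integrals *)

Section weights.
Variable R : realType.
Local Notation T2 := (measurableTypeR R * measurableTypeR R)%type.
Local Notation leb := (@lebesgue_measure R).
Local Notation pdf := (normal_pdf (0 : R) 1).

(** The density of the weighted measure with respect to [leb2], the measure in which weak
    derivatives are tested; all inner products are taken in this form. *)
Definition rho (d m : nat) (p : R * R) : R := jweight d m p.1 * pdf p.2.

Lemma strip_x (p : R * R) : strip R p -> 0 < 1 - p.1 ^+ 2 <= 1.
Proof.
rewrite /strip/= => h; rewrite subr_gt0 gerDl oppr_le0 sqr_ge0 andbT.
by rewrite -(expr1n R 2) -real_normK ?num_real// ltr_sqr ?nnegrE// ltr_norml.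
Qed.

Lemma measurable_jweight d m : measurable_fun setT (jweight d m : R -> R).
Proof.
apply: (@measurableT_comp _ _ _ _ _ _ (fun a : R => a `^ (d%:R / 2 - 1 + m%:R)) setT
  (fun x : R => 1 - x ^+ 2)); first exact: measurable_powR.
by apply: measurable_funB => //; exact: measurable_funX.
Qed.

Lemma measurable_rho d m (D : set T2) : measurable_fun D (rho d m).
Proof.
by apply: measurable_funM; [apply: measurable_comp_fst; exact: measurable_jweight|exact: measurable_pdf2].
Qed.

Lemma jweight_gt0 d m (p : R * R) : strip R p -> 0 < jweight d m p.1.
Proof. by move=> /strip_x/andP[h _]; exact: powR_gt0. Qed.

Lemma rho_gt0 d m p : strip R p -> 0 < rho d m p.
Proof. by move=> Sp; rewrite mulr_gt0 ?jweight_gt0// normal_pdf01_gt0. Qed.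

Lemma rho_ge0 d m p : strip R p -> 0 <= rho d m p.
Proof. by move=> /(rho_gt0 d m)/ltW. Qed.

Lemma jweightS d m (p : R * R) : strip R p ->
  jweight d m.+1 p.1 = (1 - p.1 ^+ 2) * jweight d m p.1.
Proof.
move=> /strip_x/andP[h _]; rewrite /jweight -[m.+1%:R]natr1 addrA powRD ?powRr1 1?mulrC//; first exact: ltW.
by apply/implyP => _; rewrite gt_eqF.
Qed.

(** For d = 1 and m = 0 the weight is (1-x^2)^(-1/2), unbounded at both ends. Its primitive is the
    arcsine, whose increments are at most pi on each of the exhausting intervals. *)
Lemma integral_rsqrt_fin : (\int[leb]_(x in `](-1)%R, 1%R[) (jweight 1 0 x)%:E < +oo)%E.
Proof.
pose a (n : nat) : R := 1 - n.+2%:R^-1.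
have a01 n : 0 < a n < 1.
  by rewrite /a subr_gt0 invf_lt1// ltr1n/= gtrDl oppr_lt0 invr_gt0.
pose F n : set R := `[- a n, a n]%classic.
have UF : (`]-1, 1[%classic : set R) = \bigcup_n F n.
  apply/seteqP; split => [x|x [n _]]; rewrite /F /= !in_itv/=; last first.
    by have /andP[? ?] := a01 n => /andP[? ?]; apply/andP; split; lra.
  rewrite -ltr_norml => x1; exists (Num.truncn (1 - `|x|)^-1) => //.
  rewrite /F/= in_itv/= -ler_norml; set n := Num.truncn _.
  have h1 : (1 - `|x|)^-1 < n.+2%:R.
    by apply: lt_trans (truncnS_gt _) _; rewrite ltr_nat.
  have : n.+2%:R^-1 < 1 - `|x|.
    by rewrite -[ltRHS]invrK ltf_pV2 ?posrE ?invr_gt0 ?ltr0n// subr_gt0.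
  by rewrite ltrBrDr => e; rewrite /a lerBrDr addrC ltW.
rewrite UF.
have j0 (x : R) : (0 <= (jweight 1 0 x)%:E)%E by rewrite lee_fin powR_ge0.
have ndF : {homo F : n m / (n <= m)%N >-> (n <= m)%O}.
  move=> n m nm; apply/subsetPset => x; rewrite /F/= !in_itv/=.
  have : m.+2%:R^-1 <= n.+2%:R^-1 :> R by rewrite lef_pV2 ?posrE// ler_nat !ltnS.
  by move=> h; rewrite -!ler_norml => /le_trans; apply; rewrite /a lerD2l lerN2.
have cv : (\int[leb]_(x in F i) (jweight 1 0 x)%:E)%E @[i --> \oo] -->
    (\int[leb]_(x in \bigcup_i F i) (jweight 1 0 x)%:E)%E.
  apply: ge0_nondecreasing_set_cvg_integral => //.
  - by move=> k; exact: measurable_itv.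
  - by move=> k; apply/measurable_EFinP; apply: measurable_funTS; exact: measurable_jweight.
apply: (@le_lt_trans _ _ pi%:E); last exact: ltry.
rewrite -(cvg_lim _ cv)//; apply: lime_le; first by apply/cvg_ex; eexists; exact: cv.
apply: nearW => n; have /andP[an0 an1] := a01 n.
have in1 (x : R) : x \in `[- a n, a n] -> -1 < x < 1.
  by rewrite in_itv/= => /andP[? ?]; apply/andP; split; lra.
have jE (x : R) : -1 < x < 1 -> jweight 1 0 x = (Num.sqrt (1 - x ^+ 2))^-1.
  move=> x1; have /= := @strip_x (x, 0) x1 => /andP[h _].
  rewrite -powR12_sqrt ?ltW// -powRN /jweight; congr (_ `^ _); lra.
have da (x : R) : -1 < x < 1 -> is_derive x (1 : R) (@asin R) (jweight 1 0 x).
  by move=> x1; rewrite jE//; exact: is_derive1_asin.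
have ca (x : R) : -1 < x < 1 -> {for x, continuous (@asin R)}.
  by move=> x1; exact: is_derive_continuous (da x x1).
rewrite (@continuous_FTC2 R (jweight 1 0) (@asin R) (- a n) (a n)).
- rewrite -EFinB lee_fin.
  have h1 : -1 <= a n <= 1 by apply/andP; split; lra.
  have h2 : -1 <= - a n <= 1 by apply/andP; split; lra.
  have h3 := asin_lepi2 h1; have h4 := asin_geNpi2 h2.
  lra.
- lra.
- apply: continuous_in_subspaceT => x /set_mem /= /in1 x1.
  have /= := @strip_x (x, 0) x1 => /andP[h _].
  have := @is_derive1_powR R (1%:R / 2 - 1 + 0%:R) _ h => dp.
  have dl : is_derive x (1 : R) (fun x : R => 1 - x ^+ 2) (- (2 * x)).
    have := is_derive_poly (1 - 'X^2) x.
    rewrite (_ : horner _ = (fun x : R => 1 - x ^+ 2)); last by apply/funext => y; rewrite !hornerE.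
    by move=> /is_derive_eq; apply; rewrite derivB derivXn -polyC1 derivC !hornerE/=; ring.
  have := is_derive_continuous (@is_derive_comp R (fun a => a `^ (1%:R / 2 - 1 + 0%:R)) (fun x : R => 1 - x ^+ 2) x _ _ dp dl); exact.
- split.
  + move=> x xi; have := da x; case=> //.
    by apply: in1; move: xi; rewrite !in_itv/= => /andP[/ltW -> /ltW ->].
  + apply: cvg_at_right_filter; apply: ca; apply/andP; split; lra.
  + apply: cvg_at_left_filter; apply: ca; apply/andP; split; lra.
- move=> x xi; rewrite derive1E; have := da x; case=> //.
  by apply: in1; move: xi; rewrite !in_itv/= => /andP[/ltW -> /ltW ->].
Qed.

(** The exponent d/2 - 1 + m is negative only in the arcsine case; otherwise the weight is at most
    1. *)
Lemma integral_jweight_fin d m : (0 < d)%N ->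
  (\int[leb]_(x in `](-1)%R, 1%R[) (jweight d m x)%:E < +oo)%E.
Proof.
move=> d0; have [dm|dm] := boolP ((d == 1) && (m == 0)).
  by move: dm => /andP[/eqP -> /eqP ->]; exact: integral_rsqrt_fin.
have s0 : 0 <= d%:R / 2 - 1 + m%:R :> R.
  have : (2 <= d + 2 * m)%N by lia.
  by rewrite -(ler_nat R) natrD natrM; lra.
apply: (@le_lt_trans _ _ (\int[leb]_(x in `](-1)%R, 1%R[) (cst 1%E) x)%E).
  apply: le_integral_nomeas => x /= xi; first by rewrite lee_fin powR_ge0.
  have := @strip_x (x, 0); rewrite /strip/=; move: xi; rewrite in_itv/= => -> /(_ isT)/andP[h1 h2].
  have h12 : 0 < 1 - x ^+ 2 <= 1 by rewrite h1.
  by have := ger_powR h12 s0; rewrite powRr0 lee_fin.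
rewrite integral_cst//= mul1e lebesgue_measure_itv/=.
by case: ifPn => _; rewrite ?ltry// -EFinB ltry.
Qed.

(** Half of the Gaussian exponent is spent on the polynomial: with y = t^2/4, |t|^i <= 1 + (4y)^i
    and y^i exp(-y) <= i!. *)
Lemma poly_gauss_bound (q : {poly R}) : exists2 C, 0 <= C &
  forall t, `|q.[t]| * expR (- t ^+ 2 / 2) <= C * expR (- t ^+ 2 / 4).
Proof.
exists (\sum_(i < size q) `|q`_i| * (1 + 4 ^+ i * i`!%:R)).
  by apply: sumr_ge0 => i _; rewrite mulr_ge0// addr_ge0// mulr_ge0// exprn_ge0.
move=> t; have -> : expR (- t ^+ 2 / 2) = expR (- (t ^+ 2 / 4)) * expR (- t ^+ 2 / 4).
  by rewrite -expRD; congr expR; field.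
rewrite mulrA ler_wpM2r ?expR_ge0// horner_coef.
apply: (@le_trans _ _ ((\sum_(i < size q) `|q`_i * t ^+ i|) * expR (- (t ^+ 2 / 4)))).
  by rewrite ler_wpM2r ?expR_ge0// ler_norm_sum.
rewrite mulr_suml; apply: ler_sum => i _; rewrite normrM -mulrA ler_wpM2l// normrX.
set y := t ^+ 2 / 4; have y0 : 0 <= y by rewrite divr_ge0// sqr_ge0.
have e1 : expR (- y) <= 1 by rewrite -expR0 ler_expR oppr_le0.
have h1 : `|t| ^+ i <= 1 + 4 ^+ i * y ^+ i.
  rewrite -exprMn (_ : 4 * y = `|t| ^+ 2); last by rewrite real_normK ?num_real// /y; field.
  rewrite -exprM mulnC exprM; set z := `|t| ^+ i.
  have := sqr_ge0 (z - 1); have := sqr_ge0 z; nra.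
apply: le_trans (ler_wpM2r (expR_ge0 _) h1) _.
rewrite mulrDl mul1r lerD// -mulrA ler_wpM2l ?exprn_ge0//.
have [y1|y1] := ltP 0 y; first exact: expRN_pow_le.
have -> : y = 0 by lra.
by rewrite oppr0 expR0 mulr1; case: (val i) => [|n]; rewrite ?expr0 ?fact0// expr0n/= ler0n.
Qed.

Lemma integral_expR4_fin : (\int[leb]_t (expR (- t ^+ 2 / 4))%:E < +oo)%E.
Proof.
have s2 : Num.sqrt 2 != 0 :> R by rewrite gt_eqF// sqrtr_gt0.
have pk := normal_peak_gt0 s2.
rewrite (_ : (\int[leb]_t _)%E =
    (\int[leb]_t ((normal_peak (Num.sqrt 2))^-1%:E * (normal_pdf 0 (Num.sqrt 2) t)%:E))%E).
  rewrite ge0_integralZl//; last 3 first.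
  - by apply/measurable_EFinP; exact: measurable_normal_pdf.
  - by move=> t _; rewrite lee_fin normal_pdf_ge0.
  - by rewrite lee_fin invr_ge0 ltW.
  by rewrite integral_normal_pdf mule1 ltry.
apply: eq_integral => t _; rewrite -EFinM normal_pdfE// mulKf ?gt_eqF//.
rewrite /normal_fun subr0 sqr_sqrtr//.
by rewrite -mulrnA.
Qed.

End weights.

Section integrals.
Context d (T : measurableType d) (R : realType).
Variables (mu : {measure set T -> \bar R}) (D : set T).
Hypothesis mD : measurable D.

Lemma Rintegral_dominated_cvg (f_ : nat -> T -> R) (f g : T -> R) :
  (forall n, measurable_fun D (f_ n)) ->
  (forall x, D x -> f_ n x @[n --> \oo] --> f x) ->
  mu.-integrable D (EFin \o g) -> (forall n x, D x -> `|f_ n x| <= g x) ->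
  \int[mu]_(x in D) f_ n x @[n --> \oo] --> \int[mu]_(x in D) f x.
Proof.
move=> mf cf ig fg; apply: fine_cvg; rewrite fineK; last first.
  have mf' : measurable_fun D f by exact: measurable_fun_cvg mf cf.
  apply: (integrable_fin_num mD); apply: le_integrable ig => //; first exact/measurable_EFinP.
  move=> x Dx /=; rewrite lee_fin (ger0_norm (le_trans (normr_ge0 _) (fg 0%N x Dx))).
  have cn : `|f_ n x| @[n --> \oo] --> `|f x| by apply: cvg_norm; exact: cf.
  rewrite -(cvg_lim _ cn)//; apply: limr_le; first by apply/cvg_ex; exists `|f x|.
  by apply: nearW => n; exact: fg.
apply: (dominated_cvg mD (g := EFin \o g)) => //.
- by move=> n; exact/measurable_EFinP.
- by move=> x Dx; apply: cvg_EFin; [exact: nearW|exact: cf].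
Qed.

Variable w : T -> R.
Hypothesis mw : measurable_fun D w.
Hypothesis w_ge0 : forall x, D x -> 0 <= w x.

Lemma L2w_le (u v : T -> R) : measurable_fun D u -> (forall x, D x -> `|u x| <= `|v x|) ->
  L2w mu D w v -> L2w mu D w u /\ ip mu D w u u <= ip mu D w v v.
Proof.
move=> mu1 uv Lv.
have le : (\int[mu]_(x in D) (u x ^+ 2 * w x)%:E <= \int[mu]_(x in D) (v x ^+ 2 * w x)%:E)%E.
  apply: le_integral_nomeas => x Dx; rewrite lee_fin.
    by rewrite mulr_ge0 ?sqr_ge0 ?w_ge0.
  rewrite ler_wpM2r ?w_ge0// -real_normK ?num_real// -[leRHS]real_normK ?num_real//.
  by rewrite ler_sqr ?nnegrE// uv.
have Lu : L2w mu D w u by split => //; apply: le_lt_trans le _; case: Lv.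
by split => //; rewrite -lee_fin !ip_sq.
Qed.

End integrals.

(** * Bounds and limits of the cut-offs *)

Section flat_limits.
Variable R : realType.
Implicit Types z : R.

Lemma dflat1E z : 0 < z -> flat (dflat 1) z = z^-1 ^+ 2 * expR (- z^-1).
Proof.
move=> z0; rewrite /flat ifT// /dflat -polyC1 derivC subr0 mulr1 hornerXn; congr (_ * _).
Qed.

Lemma flat1E z : 0 < z -> flat 1 z = expR (- z^-1).
Proof. by move=> z0; rewrite /flat ifT// hornerC mul1r. Qed.

Lemma dflat1_bound z : 0 <= flat (dflat 1) z <= 2.
Proof.
have [z0|z0] := ltP 0 z; last by rewrite flat0// lexx ler0n.
have s0 : 0 < z^-1 by rewrite invr_gt0.
rewrite dflat1E//; apply/andP; split; first by rewrite mulr_ge0 ?sqr_ge0 ?expR_ge0.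
exact: (expRN_pow_le 2 s0).
Qed.

(** z + 1 stands for the factor (n+1)(1-x^2) in the derivative of the cut-off. Since (z+1) z^-2 =
    z^-1 + z^-2, the bounds 1! and 2! add up to 3. *)
Lemma succ_dflat1_bound z : 0 <= (z + 1) * flat (dflat 1) z <= 3.
Proof.
have [z0|z0] := ltP 0 z; last by rewrite flat0// mulr0 lexx ler0n.
have s0 : 0 < z^-1 by rewrite invr_gt0.
have := dflat1_bound z; rewrite dflat1E// => /andP[h1 h2].
have -> : (z + 1) * (z^-1 ^+ 2 * expR (- z^-1)) =
   z^-1 ^+ 1 * expR (- z^-1) + z^-1 ^+ 2 * expR (- z^-1) by rewrite expr1; field; rewrite gt_eqF.
have := expRN_pow_le 1 s0; rewrite expr1 => h3.
have : 0 <= z^-1 * expR (- z^-1) by rewrite mulr_ge0 ?expR_ge0 ?ltW.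
by rewrite (_ : 1`!%:R = 1 :> R)// in h3; move=> h4; apply/andP; split; lra.
Qed.

Lemma cvg_flat_infty (z : nat -> R) : z n @[n --> \oo] --> +oo ->
  [/\ flat 1 (z n) @[n --> \oo] --> (1 : R),
      flat (dflat 1) (z n) @[n --> \oo] --> (0 : R) &
      (z n + 1) * flat (dflat 1) (z n) @[n --> \oo] --> (0 : R)].
Proof.
move=> zoo; have z0 : \forall n \near \oo, 0 < z n by move/cvgryPgt : zoo; exact.
have s0 : (z n)^-1 @[n --> \oo] --> (0 : R) by apply/gtr0_cvgV0.
have e1 : expR (- (z n)^-1) @[n --> \oo] --> (1 : R).
  rewrite -[X in _ --> X]expR0; apply: cvg_comp; last exact: continuous_expR.
  by rewrite -oppr0; apply: cvgN.
have f2 : (z n)^-1 ^+ 2 * expR (- (z n)^-1) @[n --> \oo] --> (0 : R).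
  rewrite -(mul0r (1 : R)) -(mul0r (0 : R)); apply: cvgM => //.
  by under eq_fun do rewrite expr2; exact: cvgM.
have f1 : (z n)^-1 * expR (- (z n)^-1) @[n --> \oo] --> (0 : R).
  by rewrite -(mul0r (1 : R)); exact: cvgM.
split.
- apply: cvg_trans e1; apply: near_eq_cvg; near=> n.
  by rewrite flat1E//; near: n.
- apply: cvg_trans f2; apply: near_eq_cvg; near=> n.
  by rewrite dflat1E//; near: n.
- have f3 : (z n)^-1 * expR (- (z n)^-1) + (z n)^-1 ^+ 2 * expR (- (z n)^-1)
      @[n --> \oo] --> (0 : R) by rewrite -(addr0 (0 : R)); exact: cvgD.
  apply: cvg_trans f3; apply: near_eq_cvg; near=> n.
  have zn : 0 < z n by near: n.
  by rewrite /= dflat1E//; field; rewrite gt_eqF.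
Unshelve. all: by end_near. Qed.

Lemma cvg_natM_infty (y c : R) : 0 < y -> n.+1%:R * y + c @[n --> \oo] --> +oo.
Proof.
move=> y0; apply/cvgryPge => A; near=> n.
rewrite -lerBlDr -ler_pdivrMr//; apply: (@le_trans _ _ n%:R); last by rewrite ler_nat.
near: n; exact: nbhs_infty_ger.
Unshelve. all: by end_near. Qed.

End flat_limits.

Section L2_tensors.
Variables (R : realType) (d : nat).
Hypothesis d0 : (0 < d)%N.
Local Notation T2 := (measurableTypeR R * measurableTypeR R)%type.
Local Notation leb := (@lebesgue_measure R).
Local Notation pdf := (normal_pdf (0 : R) 1).
Local Notation L2r m := (L2w (leb2 R) (strip R : set T2) (rho d m)).
Local Notation dot m := (ip (leb2 R) (strip R : set T2) (rho d m)).

Definition tens (p q : {poly R}) (z : R * R) : R := p.[z.1] * q.[z.2].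

Lemma continuous_tens p q : continuous (tens p q).
Proof.
by apply: continuous_mul2; [apply: continuous_fst_comp|apply: continuous_snd_comp];
  exact: continuous_horner.
Qed.

Lemma measurable_tens p q (D : set T2) : measurable_fun D (tens p q).
Proof. by apply: measurable_funTS; apply: continuous_measurable2; exact: continuous_tens. Qed.

Lemma poly_bound1 (p : {poly R}) : exists2 C, 0 <= C & forall x, -1 < x < 1 -> `|p.[x]| <= C.
Proof.
exists (\sum_(i < size p) `|p`_i|); first by apply: sumr_ge0.
move=> x x1; rewrite horner_coef; apply: le_trans (ler_norm_sum _ _ _) _.
apply: ler_sum => i _; rewrite normrM ler_piMr// normrX exprn_ile1//.
by rewrite ltW// ltr_norml.
Qed.

(** The integrand is dominated by a function of x times a function of t, each of finite integral.
    [poly_gauss_bound] is applied to q^2, because the Gaussian density occurs only once. *)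
Lemma L2_tens m p q : L2r m (tens p q).
Proof.
split; first exact: measurable_tens.
have [C1 C10 H1] := poly_bound1 p.
have [C2 C20 H2] := poly_gauss_bound (q ^+ 2).
pose c : R := (Num.sqrt (2 * pi))^-1.
have c0 : 0 <= c by rewrite invr_ge0 ltW// sqrt2pi_gt0.
pose A (x : R) : \bar R := ((C1 ^+ 2 * c * C2)%:E * ((EFin \o jweight d m) \_ `](-1)%R, 1%R[) x)%E.
pose B (t : R) : \bar R := (expR (- t ^+ 2 / 4))%:E.
have mA : measurable_fun setT A.
  apply: emeasurable_funM => //; apply: (iffLR (measurable_restrictT _ (measurable_itv _))).
  by apply: measurable_funTS; apply/measurable_EFinP; exact: measurable_jweight.
have mB : measurable_fun setT B.
  apply/measurable_EFinP; apply: measurableT_comp => //; apply: measurable_funM => //.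
  by apply: measurableT_comp => //; exact: measurable_funX.
have A0 x : (0 <= A x)%E.
  apply: mule_ge0; first by rewrite lee_fin !mulr_ge0// exprn_ge0.
  by rewrite /patch; case: ifPn => // _; rewrite lee_fin powR_ge0.
have B0 t : (0 <= B t)%E by rewrite lee_fin expR_ge0.
apply: (@le_lt_trans _ _ (\int[leb2 R]_z (A z.1 * B z.2))%E).
  rewrite integral_mkcond; apply: le_integral_nomeas => z _; rewrite /patch.
    by case: ifPn => // /set_mem Sz; rewrite lee_fin mulr_ge0 ?sqr_ge0// rho_ge0.
  case: ifPn => [/set_mem Sz|_]; last exact: mule_ge0.
  rewrite /A /patch ifT; last by rewrite inE/= in_itv/=.
  rewrite -!EFinM lee_fin /tens /rho exprMn normal_pdf01 -/c.
  have j0 := ltW (jweight_gt0 d m Sz); have e4 := expR_ge0 (- z.2 ^+ 2 / 4).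
  have h2 := H2 z.2; rewrite horner_exp (ger0_norm (sqr_ge0 _)) in h2.
  have h1 : p.[z.1] ^+ 2 <= C1 ^+ 2.
    rewrite -[leLHS]real_normK ?num_real// ler_sqr ?nnegrE//; exact: H1.
  have -> : p.[z.1] ^+ 2 * q.[z.2] ^+ 2 * (jweight d m z.1 * (c * expR (- z.2 ^+ 2 / 2))) =
    p.[z.1] ^+ 2 * (c * jweight d m z.1 * (q.[z.2] ^+ 2 * expR (- z.2 ^+ 2 / 2))) by ring.
  have -> : C1 ^+ 2 * c * C2 * jweight d m z.1 * expR (- z.2 ^+ 2 / 4) =
    C1 ^+ 2 * (c * jweight d m z.1 * (C2 * expR (- z.2 ^+ 2 / 4))) by ring.
  have cj : 0 <= c * jweight d m z.1 by exact: mulr_ge0.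
  apply: ler_pM => //; first exact: sqr_ge0.
    by apply: mulr_ge0 => //; apply: mulr_ge0; [exact: sqr_ge0|exact: expR_ge0].
  exact: ler_wpM2l.
rewrite fubini_tonelli1//; last 2 first.
- by apply: emeasurable_funM; apply: measurableT_comp.
- by move=> z; exact: mule_ge0.
rewrite /fubini_F/=.
under eq_integral do rewrite ge0_integralZl//.
rewrite ge0_integralZr//; last exact: integral_ge0.
have IB := integral_expR4_fin R.
have IA : (\int[leb]_x A x < +oo)%E.
  rewrite ge0_integralZl//; last 3 first.
  - apply: (iffLR (measurable_restrictT _ (measurable_itv _))).
    by apply: measurable_funTS; apply/measurable_EFinP; exact: measurable_jweight.
  - by move=> x _; rewrite /patch; case: ifPn => // _; rewrite lee_fin powR_ge0.
  - by rewrite lee_fin !mulr_ge0// exprn_ge0.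
  rewrite -integral_mkcond lte_mul_pinfty//; first by rewrite lee_fin !mulr_ge0// exprn_ge0.
  exact: integral_jweight_fin.
apply: lte_mul_pinfty => //; first exact: integral_ge0.
by rewrite ge0_fin_numE//; exact: integral_ge0.
Qed.

End L2_tensors.

(** * Coefficients of weak derivatives *)

Section one_step.
Variables (R : realType) (d : nat).
Hypothesis d0 : (0 < d)%N.
Local Notation T2 := (measurableTypeR R * measurableTypeR R)%type.
Local Notation leb := (@lebesgue_measure R).
Local Notation pdf := (normal_pdf (0 : R) 1).
Local Notation L2r m := (L2w (leb2 R) (strip R : set T2) (rho d m)).
Local Notation dot m := (ip (leb2 R) (strip R : set T2) (rho d m)).

Let mS := @measurable_strip R.
Let mr m := @measurable_rho R d m (strip R).
Let r0 m := @rho_ge0 R d m.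

Definition cutx (n : nat) (x : R) : R := flat 1 (n.+1%:R * (1 - x ^+ 2) + - 1).
Definition cutt (n : nat) (t : R) : R := flat 1 (n.+1%:R * 1 + - t ^+ 2).

Lemma is_derive_sub_sq (c x : R) : is_derive x (1 : R) (fun y : R => c + - y ^+ 2) (- (2 * x)).
Proof.
have := is_derive_poly (c%:P - 'X^2) x.
rewrite (_ : horner _ = (fun x : R => c + - x ^+ 2)); last first.
  by apply/funext => y; rewrite hornerD hornerN hornerC hornerXn.
by move=> /is_derive_eq; apply; rewrite derivB derivXn derivC !hornerE/=; ring.
Qed.

Lemma smooth_sub_sq (c : R) : smooth (fun y : R => c + - y ^+ 2).
Proof.
have := smooth_horner (c%:P - 'X^2).
rewrite (_ : horner _ = (fun x : R => c + - x ^+ 2))//.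
by apply/funext => y; rewrite hornerD hornerN hornerC hornerXn.
Qed.

(** The weight (1-x^2)^s is built into the test function, so that pairing with it in Lebesgue
    measure is a weighted inner product up to the cut-off. *)
Definition test_x (s : R) (y : {poly R}) (n : nat) (x : R) : R :=
  y.[x] * cutpow s 1 n.+1%:R (1 + - x ^+ 2).

Lemma smooth_test_x s y n : smooth (test_x s y n).
Proof.
apply: smoothM; first exact: smooth_horner.
apply: (@smooth_comp R (cutpow s 1 n.+1%:R) (fun x => 1 + - x ^+ 2)); last exact: smooth_sub_sq.
exact: smooth_cutpow.
Qed.

Lemma test_x_out s y n x : x \notin `[- (1 - (2 * n.+1%:R)^-1), 1 - (2 * n.+1%:R)^-1] ->
  test_x s y n x = 0.
Proof.
rewrite in_itv/= -ler_norml -ltNge => h; rewrite /test_x /cutpow flat0 ?mulr0//.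
set M : R := n.+1%:R in h *; have M1 : 1 <= M by rewrite ler1n.
(* With e = 1/(2M), |x| > 1 - e gives 1 - x^2 <= 2e, hence M(1-x^2) <= 1 and a nonpositive argument
   of [flat]. *)
set e := (2 * M)^-1 in h; have e0 : 0 < e by rewrite invr_gt0; lra.
have eM : M * e = 1 / 2 by rewrite /e; field; rewrite gt_eqF//; lra.
have e2 : e <= 1 / 2 by rewrite -eM ler_peMl// ltW.
have : (1 - e) ^+ 2 <= `|x| ^+ 2 by rewrite ler_sqr ?nnegrE//; lra.
rewrite real_normK ?num_real// => hx.
have : M * (1 - x ^+ 2) <= M * (2 * e) by apply: ler_wpM2l; nra.
by rewrite (_ : M * (2 * e) = 1); [lra|rewrite mulrCA eM; field].
Qed.

Definition test_t (q : {poly R}) (n : nat) (t : R) : R := q.[t] * (pdf t * cutt n t).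

Lemma smooth_pdf : smooth pdf.
Proof.
have -> : pdf = (fun t => (Num.sqrt (2 * pi))^-1%:P.[t] * expR ((- 2^-1 *: 'X^2).[t])).
  by apply/funext => t; rewrite normal_pdf01 hornerC hornerZ hornerXn; congr (_ * expR _); field.
apply: smoothM; first exact: smooth_horner.
by apply: smooth_comp; [exact: smooth_expR|exact: smooth_horner].
Qed.

Lemma is_derive_pdf (t : R) : is_derive t (1 : R) pdf (- t * pdf t).
Proof.
have -> : pdf = (fun t => (Num.sqrt (2 * pi))^-1 * ((He R 0).[t] * expR (- (t ^+ 2) / 2))).
  by apply/funext => s; rewrite normal_pdf01 hornerC mul1r.
have := is_derive_scale (Num.sqrt (2 * pi))^-1 (is_derive_HeM 0 t).
move=> /is_derive_eq; apply.
by rewrite /= hornerC -polyC1 derivC subr0 mulr1 hornerX; ring.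
Qed.

Lemma smooth_test_t q n : smooth (test_t q n).
Proof.
apply: smoothM; first exact: smooth_horner.
apply: smoothM; first exact: smooth_pdf.
apply: (@smooth_comp R (flat 1) (fun t => n.+1%:R * 1 + - t ^+ 2)); first exact: smooth_flat.
exact: smooth_sub_sq.
Qed.

Lemma test_t_out q n t : t \notin `[- n.+1%:R, n.+1%:R] -> test_t q n t = 0.
Proof.
rewrite in_itv/= -ler_norml -ltNge => h; rewrite /test_t /cutt flat0 ?mulr0// mulr1.
have M1 : 1 <= n.+1%:R :> R by rewrite ler1n.
have : n.+1%:R ^+ 2 <= `|t| ^+ 2 by rewrite ler_sqr ?nnegrE// ltW.
rewrite real_normK ?num_real//; nra.
Qed.

Lemma test_width n : 0 < 1 - (2 * (n.+1%:R : R))^-1 < 1.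
Proof.
have M1 : 1 <= n.+1%:R :> R by rewrite ler1n.
by rewrite subr_gt0 invf_lt1 ?gtrDl ?oppr_lt0 ?invr_gt0; lra.
Qed.

Lemma wderiv_test s y q n (u v : R * R -> R) j k : is_wderiv2_real j k u v ->
  \int[leb2 R]_(p in strip R) (u p * (derive1n j (test_x s y n) p.1 * derive1n k (test_t q n) p.2)) =
  (-1) ^+ (j + k) * \int[leb2 R]_(p in strip R) (v p * (test_x s y n p.1 * test_t q n p.2)).
Proof.
move=> [_ _ H].
exact: (H _ (test_jet2_tensor (smooth_test_x s y n) (smooth_test_t q n) (test_width n)
  (@test_x_out s y n) (@test_t_out q n))).
Qed.

Lemma cutx_le1 n x : `|cutx n x| <= 1.
Proof. by have /andP[h1 h2] := flat1_le1 (n.+1%:R * (1 - x ^+ 2) + - 1); rewrite ger0_norm. Qed.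

Lemma cutt_le1 n t : `|cutt n t| <= 1.
Proof. by have /andP[h1 h2] := flat1_le1 (n.+1%:R * 1 + - t ^+ 2); rewrite ger0_norm. Qed.

(* Derivatives of the cut-offs up to bounded factors; [edgex] and [edget] are
   bounded and tend to [0] pointwise, so that the boundary terms of the
   integrations by parts disappear. *)
Definition edgex (n : nat) (x : R) : R :=
  n.+1%:R * (1 - x ^+ 2) * flat (dflat 1) (n.+1%:R * (1 - x ^+ 2) + - 1).
Definition edget (n : nat) (t : R) : R := flat (dflat 1) (n.+1%:R * 1 + - t ^+ 2).

Lemma edgex_bound n x : `|edgex n x| <= 3.
Proof.
have /andP[h1 h2] := succ_dflat1_bound (n.+1%:R * (1 - x ^+ 2) + - 1).
by rewrite subrK in h1 h2; rewrite ger0_norm.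
Qed.

Lemma edget_bound n x : `|edget n x| <= 2.
Proof.
have /andP[h1 h2] := dflat1_bound (n.+1%:R * 1 + - x ^+ 2).
by rewrite ger0_norm.
Qed.

Lemma cvg_cutx x : -1 < x < 1 ->
  cutx n x @[n --> \oo] --> (1 : R) /\ edgex n x @[n --> \oo] --> (0 : R).
Proof.
move=> x1; have /andP[h _] := @strip_x R (x, 0) x1.
have [h1 _ h3] := cvg_flat_infty (cvg_natM_infty (- 1) h); split => //.
by apply: cvg_trans h3; apply: near_eq_cvg; apply: nearW => n; rewrite subrK.
Qed.

Lemma cvg_cutt t : cutt n t @[n --> \oo] --> (1 : R) /\ edget n t @[n --> \oo] --> (0 : R).
Proof. by have [h1 h2 _] := cvg_flat_infty (cvg_natM_infty (- t ^+ 2) (@ltr01 R)). Qed.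

(** From the weight of index m+1 one derivative leaves the weight of index m and, in front of
    [cutx], the first-order operator that the Gegenbauer equation evaluates. What falls on the
    cut-off itself is collected in [edgex]. *)
Lemma derive1_test_x m y n x : -1 < x < 1 ->
  (test_x (d%:R / 2 - 1 + m.+1%:R) y n)^`()%classic x =
  jweight d m x * (cutx n x * ((1 - 'X^2) * y^`() - (d%:R + 2 * m%:R) * 'X * y).[x]
     - 2 * edgex n x * ('X * y).[x]).
Proof.
move=> x1; have /= /andP[h _] := @strip_x R (x, 0) x1.
set s := _ + m.+1%:R.
have dtx z : is_derive z (1 : R) (test_x s y n) (y^`().[z] * cutpow s 1 n.+1%:R (1 + - z ^+ 2) +
   y.[z] * ((s * cutpow (s - 1) 1 n.+1%:R (1 + - z ^+ 2) + n.+1%:R * cutpow s (dflat 1) n.+1%:R (1 + - z ^+ 2)) * - (2 * z))).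
  apply: (@is_derive_mul R (horner y) (fun z => cutpow s 1 n.+1%:R (1 + - z ^+ 2))).
  exact: (@is_derive_comp R (cutpow s 1 n.+1%:R) (fun x => 1 + - x ^+ 2) z _ _
    (is_derive_cutpow s 1 (1 + - z ^+ 2) (ltr0Sn R n)) (is_derive_sub_sq 1 z)).
rewrite (derive1_is_derive dtx).
have sE : s = d%:R / 2 - 1 + m%:R + 1 by rewrite /s -[m.+1%:R]natr1 addrA.
have s1 : s - 1 = d%:R / 2 - 1 + m%:R by rewrite sE addrK.
have js : (1 + - x ^+ 2) `^ s = (1 - x ^+ 2) * jweight d m x.
  exact: (@jweightS R d m (x, 0) x1).
rewrite /cutpow js s1 -/(jweight d m x) /cutx /edgex !hornerE/=.
have nx k : (k%:R : {poly R}).[x] = k%:R by rewrite -polyC_natr hornerC.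
by rewrite sE !nx; field.
Qed.

Lemma derive1_test_t q n t :
  (test_t q n)^`()%classic t =
  pdf t * (cutt n t * (q^`() - 'X * q).[t] - 2 * edget n t * ('X * q).[t]).
Proof.
have dtt z : is_derive z (1 : R) (test_t q n) (q^`().[z] * (pdf z * cutt n z) + q.[z] *
  ((- z * pdf z) * cutt n z + pdf z * (flat (dflat 1) (n.+1%:R * 1 + - z ^+ 2) * - (2 * z)))).
  apply: (@is_derive_mul R (horner q) (fun z => pdf z * cutt n z)).
  apply: (@is_derive_mul R pdf (cutt n)); first exact: is_derive_pdf.
  exact: (@is_derive_comp R (flat 1) (fun t => n.+1%:R * 1 + - t ^+ 2) z _ _
    (is_derive_flat 1 _) (is_derive_sub_sq _ z)).
by rewrite (derive1_is_derive dtt) /edget !hornerE/=; ring.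
Qed.

Lemma measurable_test_xt s y q n (D : set T2) :
  measurable_fun D (fun p : T2 => test_x s y n p.1 * test_t q n p.2).
Proof.
apply: measurable_funM; [apply: measurable_comp_fst|apply: measurable_comp_snd];
apply: continuous_measurable_fun; apply: smooth_continuous;
[exact: smooth_test_x|exact: smooth_test_t].
Qed.

Lemma integrable_abs m u p q : L2r m u ->
  (leb2 R).-integrable (strip R : set T2) (EFin \o (fun z => `|u z * tens p q z * rho d m z|)).
Proof.
move=> Lu; have := integrable_abse (L2w_integrable mS (mr m) (@r0 m) Lu (L2_tens d0 m p q)).
by apply: eq_integrable => //.
Qed.

Lemma cvg_test_rhs s m y q v : L2r m v -> s = d%:R / 2 - 1 + m%:R ->
  \int[leb2 R]_(p in strip R) (v p * (test_x s y n p.1 * test_t q n p.2)) @[n --> \oo] -->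
  dot m v (tens y q).
Proof.
move=> Lv ->; apply: (Rintegral_dominated_cvg mS _ _ (integrable_abs y q Lv)).
- move=> n; apply: measurable_funM; [by case: Lv|exact: measurable_test_xt].
- move=> p Sp; have [h1 _] := cvg_cutx Sp; have [h2 _] := cvg_cutt p.2.
  have -> : v p * tens y q p * rho d m p = v p * tens y q p * rho d m p * (1 * 1) by rewrite !mulr1.
  rewrite (_ : (fun n => _) = (fun n => v p * tens y q p * rho d m p * (cutx n p.1 * cutt n p.2))).
    by apply: cvgM; [exact: cvg_cst|exact: cvgM].
  apply/funext => n; rewrite /test_x /test_t /cutpow /tens /rho /jweight /cutx; ring.
- move=> n p Sp.
  have -> : v p * (test_x (d%:R / 2 - 1 + m%:R) y n p.1 * test_t q n p.2) =
     v p * tens y q p * rho d m p * (cutx n p.1 * cutt n p.2).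
    rewrite /test_x /test_t /cutpow /tens /rho /jweight /cutx; ring.
  rewrite normrM ler_piMr// normrM mulr_ile1// ?cutx_le1// cutt_le1//.
Qed.

(** One integration by parts against the cut-off product. Dominated convergence removes the cut-offs
    on both sides, and the equation for [y1] turns the limit into a multiple of the product with
    [y0]. The weights differ by one index because the derivative lowers it. *)
Lemma dot_dx m K (y0 y1 q : {poly R}) u v :
  (1 - 'X^2) * y1^`() - (d%:R + 2 * m%:R) * 'X * y1 = - K *: y0 ->
  L2r m u -> L2r m.+1 v -> is_wderiv2_real 1 0 u v ->
  dot m.+1 v (tens y1 q) = K * dot m u (tens y0 q).
Proof.
move=> ode Lu Lv H.
pose s : R := d%:R / 2 - 1 + m.+1%:R.
have rhs := cvg_test_rhs (y := y1) (q := q) Lv (erefl s).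
have mu_ : measurable_fun (strip R : set T2) u by case: Lu.
have md n : measurable_fun (strip R : set T2) (fun p => u p * (derive1n 1 (test_x s y1 n) p.1 * test_t q n p.2)).
  apply: measurable_funM => //.
  apply: measurable_funM; [apply: measurable_comp_fst|apply: measurable_comp_snd];
  apply: continuous_measurable_fun; apply: smooth_continuous.
    by apply: smooth_derive1n; exact: smooth_test_x.
  exact: smooth_test_t.
have E n p : strip R p -> u p * (derive1n 1 (test_x s y1 n) p.1 * test_t q n p.2) =
   u p * tens y0 q p * rho d m p * (- K * (cutx n p.1 * cutt n p.2)) +
   u p * tens ('X * y1) q p * rho d m p * (- 2 * (edgex n p.1 * cutt n p.2)).
  move=> Sp; rewrite derive1n1 derive1_test_x// ode /tens /test_t /rho !hornerE/=; ring.
have lhs : \int[leb2 R]_(p in strip R) (u p * (derive1n 1 (test_x s y1 n) p.1 * test_t q n p.2))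
    @[n --> \oo] --> \int[leb2 R]_(p in strip R) (- K * (u p * tens y0 q p * rho d m p)).
  have i1 := integrableZl mS `|K| (integrable_abs y0 q Lu).
  (* 6 is the factor 2 times the bound 3 of [edgex] times the bound 1 of [cutt]. *)
  have i2 := integrableZl mS 6 (integrable_abs ('X * y1) q Lu).
  apply: (Rintegral_dominated_cvg mS md _ (integrableD mS i1 i2)).
  - move=> p Sp; have [h1 h2] := cvg_cutx Sp; have [h3 _] := cvg_cutt p.2.
    rewrite (_ : (fun n => _) = (fun n => u p * tens y0 q p * rho d m p * (- K * (cutx n p.1 * cutt n p.2)) +
      u p * tens ('X * y1) q p * rho d m p * (- 2 * (edgex n p.1 * cutt n p.2)))); last first.
      by apply/funext => n; exact: E.
    rewrite [X in _ --> X](_ : _ = u p * tens y0 q p * rho d m p * (- K * (1 * 1)) +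
      u p * tens ('X * y1) q p * rho d m p * (- 2 * (0 * 1))); last by ring.
    apply: cvgD; (apply: cvgM; first exact: cvg_cst); (apply: cvgM; first exact: cvg_cst); exact: cvgM.
  - move=> n p Sp; rewrite E//; apply: le_trans (ler_normD _ _) _.
    have c1 := cutx_le1 n p.1; have c2 := cutt_le1 n p.2; have c3 := edgex_bound n p.1.
    apply: lerD; rewrite normrM [leRHS]mulrC ler_wpM2l// normrM normrN.
      by rewrite ler_piMr// normrM mulr_ile1.
    rewrite normr_nat (_ : (6 : R) = 2 * (3 * 1)); last by ring.
    by rewrite ler_wpM2l// normrM ler_pM.
have e n : \int[leb2 R]_(p in strip R) (u p * (derive1n 1 (test_x s y1 n) p.1 * test_t q n p.2)) =
    - \int[leb2 R]_(p in strip R) (v p * (test_x s y1 n p.1 * test_t q n p.2)).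
  by have := wderiv_test s y1 q n H; rewrite derive1n0 expr1 mulN1r.
move: lhs; rewrite (_ : (fun n => _) = (fun n => - \int[leb2 R]_(p in strip R) (v p * (test_x s y1 n p.1 * test_t q n p.2)))); last first.
  by apply/funext => n; exact: e.
move=> /(cvg_unique (@Rhausdorff R) (cvgN rhs)).
rewrite RintegralZl//; last exact: (L2w_integrable mS (mr m) (@r0 m) Lu (L2_tens d0 m y0 q)).
by rewrite mulNr => /oppr_inj.
Qed.

Lemma dot_dt m K (y q0 q1 : {poly R}) u v :
  q1^`() - 'X * q1 = - K *: q0 ->
  L2r m u -> L2r m v -> is_wderiv2_real 0 1 u v ->
  dot m v (tens y q1) = K * dot m u (tens y q0).
Proof.
move=> ode Lu Lv H.
pose s : R := d%:R / 2 - 1 + m%:R.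
have rhs := cvg_test_rhs (y := y) (q := q1) Lv (erefl s).
have mu_ : measurable_fun (strip R : set T2) u by case: Lu.
have md n : measurable_fun (strip R : set T2) (fun p => u p * (test_x s y n p.1 * derive1n 1 (test_t q1 n) p.2)).
  apply: measurable_funM => //.
  apply: measurable_funM; [apply: measurable_comp_fst|apply: measurable_comp_snd];
  apply: continuous_measurable_fun; apply: smooth_continuous.
    exact: smooth_test_x.
  by apply: smooth_derive1n; exact: smooth_test_t.
have E n p : strip R p -> u p * (test_x s y n p.1 * derive1n 1 (test_t q1 n) p.2) =
   u p * tens y q0 p * rho d m p * (- K * (cutx n p.1 * cutt n p.2)) +
   u p * tens y ('X * q1) p * rho d m p * (- 2 * (cutx n p.1 * edget n p.2)).
  move=> Sp; rewrite derive1n1 derive1_test_t ode /tens /test_x /cutpow /rho /jweight /cutx !hornerE/=; ring.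
have lhs : \int[leb2 R]_(p in strip R) (u p * (test_x s y n p.1 * derive1n 1 (test_t q1 n) p.2))
    @[n --> \oo] --> \int[leb2 R]_(p in strip R) (- K * (u p * tens y q0 p * rho d m p)).
  have i1 := integrableZl mS `|K| (integrable_abs y q0 Lu).
  (* 4 is the factor 2 times the bound 1 of [cutx] times the bound 2 of [edget]. *)
  have i2 := integrableZl mS 4 (integrable_abs y ('X * q1) Lu).
  apply: (Rintegral_dominated_cvg mS md _ (integrableD mS i1 i2)).
  - move=> p Sp; have [h1 _] := cvg_cutx Sp; have [h3 h2] := cvg_cutt p.2.
    rewrite (_ : (fun n => _) = (fun n => u p * tens y q0 p * rho d m p * (- K * (cutx n p.1 * cutt n p.2)) +
      u p * tens y ('X * q1) p * rho d m p * (- 2 * (cutx n p.1 * edget n p.2)))); last first.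
      by apply/funext => n; exact: E.
    rewrite [X in _ --> X](_ : _ = u p * tens y q0 p * rho d m p * (- K * (1 * 1)) +
      u p * tens y ('X * q1) p * rho d m p * (- 2 * (1 * 0))); last by ring.
    apply: cvgD; (apply: cvgM; first exact: cvg_cst); (apply: cvgM; first exact: cvg_cst); exact: cvgM.
  - move=> n p Sp; rewrite E//; apply: le_trans (ler_normD _ _) _.
    have c1 := cutx_le1 n p.1; have c2 := cutt_le1 n p.2; have c3 := edget_bound n p.2.
    apply: lerD; rewrite normrM [leRHS]mulrC ler_wpM2l// normrM normrN.
      by rewrite ler_piMr// normrM mulr_ile1.
    rewrite normr_nat (_ : (4 : R) = 2 * (1 * 2)); last by ring.
    by rewrite ler_wpM2l// normrM ler_pM.
have e n : \int[leb2 R]_(p in strip R) (u p * (test_x s y n p.1 * derive1n 1 (test_t q1 n) p.2)) =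
    - \int[leb2 R]_(p in strip R) (v p * (test_x s y n p.1 * test_t q1 n p.2)).
  by have := wderiv_test s y q1 n H; rewrite derive1n0 expr1 mulN1r.
move: lhs; rewrite (_ : (fun n => _) = (fun n => - \int[leb2 R]_(p in strip R) (v p * (test_x s y n p.1 * test_t q1 n p.2)))); last first.
  by apply/funext => n; exact: e.
move=> /(cvg_unique (@Rhausdorff R) (cvgN rhs)).
rewrite RintegralZl//; last exact: (L2w_integrable mS (mr m) (@r0 m) Lu (L2_tens d0 m y q0)).
by rewrite mulNr => /oppr_inj.
Qed.

End one_step.

(** * The polynomial basis: eigenvalues, orthogonality, norms *)

Section hgb.
Variables (R : realType) (d : nat).
Hypothesis d0 : (0 < d)%N.
Local Notation T2 := (measurableTypeR R * measurableTypeR R)%type.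
Local Notation pdf := (normal_pdf (0 : R) 1).
Local Notation L2r m := (L2w (leb2 R) (strip R : set T2) (rho d m)).
Local Notation dot m := (ip (leb2 R) (strip R : set T2) (rho d m)).

Let mS := @measurable_strip R.
Let mr m := @measurable_rho R d m (strip R).
Let r0 m := @rho_ge0 R d m.

Let dotZl m c (u v : T2 -> R) : L2r m u -> L2r m v ->
  dot m (fun x => c * u x) v = c * dot m u v.
Proof. exact: ipZl mS (mr m) (@r0 m) _ _ _. Qed.

Let dotZr m c (u v : T2 -> R) : L2r m u -> L2r m v ->
  dot m v (fun x => c * u x) = c * dot m v u.
Proof. exact: ipZr mS (mr m) (@r0 m) _ _ _. Qed.

Let dotDl m (u v z : T2 -> R) : L2r m u -> L2r m v -> L2r m z ->
  dot m (fun x => u x + v x) z = dot m u z + dot m v z.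
Proof. exact: ipDl mS (mr m) (@r0 m) _ _ _. Qed.

Let L2Z m c (u : T2 -> R) : L2r m u -> L2r m (fun x => c * u x).
Proof. exact: L2wZ mS (mr m) (@r0 m) _ _. Qed.

Definition hgb (m l k j : nat) : R * R -> R := tens ((geg R d j)^`(m)) ((He R k)^`(l)).

Lemma L2_basis a m l k j : L2r a (hgb m l k j).
Proof. exact: L2_tens. Qed.

(* The factors by which [m] derivatives in x and [l] in t act on coefficients. *)
Definition lamx (m j : nat) : R := \prod_(i < m) ((j%:R - i%:R) * (j%:R + i%:R + d%:R - 1)).
Definition lamt (l k : nat) : R := \prod_(i < l) (k%:R - i%:R).

Lemma derive1n_horner m (p : {poly R}) : derive1n m (horner p) = horner (p^`(m)).
Proof.
elim: m => [|m IH]; first by rewrite derive1n0 derivn0.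
rewrite derive1nS IH derivnS; apply: derive1_is_derive => x; exact: is_derive_poly.
Qed.

Lemma is_wderiv2_tens j k (p q : {poly R}) :
  is_wderiv2_real j k (tens p q) (tens (p^`(j)) (q^`(k))).
Proof.
have := is_wderiv2_real_tensor j k (smooth_horner p) (smooth_horner q).
by rewrite !derive1n_horner.
Qed.

Lemma geg_ode_scale j m : (1 - 'X^2) * ((geg R d j)^`(m.+1))^`() -
   (d%:R + 2 * m%:R) * 'X * (geg R d j)^`(m.+1) =
  - ((j%:R - m%:R) * (j%:R + m%:R + d%:R - 1)) *: (geg R d j)^`(m).
Proof.
rewrite -derivnS geg_ode// -[RHS]mul_polyC; congr (_ * _).
by rewrite polyCN polyCM !polyCB !polyCD !polyC_natr polyC1.
Qed.

Lemma He_ode_scale k l : ((He R k)^`(l.+1))^`() - 'X * (He R k)^`(l.+1) =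
  - (k%:R - l%:R) *: (He R k)^`(l).
Proof.
by rewrite -derivnS He_ode -[RHS]mul_polyC polyCN polyCB !polyC_natr.
Qed.

Lemma dot_wderiv (f : R * R -> R) (u : nat -> nat -> R * R -> R) m l :
  (forall a b, (a <= m)%N -> (b <= l)%N -> is_wderiv2_real a b f (u a b) /\ L2r a (u a b)) ->
  forall k j, dot m (u m l) (hgb m l k j) =
    lamx m j * lamt l k * dot 0 (u 0%N 0%N) (hgb 0 0 k j).
Proof.
elim: m => [|m IH] H k j; last first.
  have [w1 L1] := H m l (leqnSn m) (leqnn l); have [w2 L2] := H m.+1 l (leqnn _) (leqnn l).
  rewrite (dot_dx d0 _ (geg_ode_scale j m) L1 L2 (is_wderiv2_real_dx w1 w2)).
  rewrite IH; last by move=> a b am; apply: H; exact: leqW.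
  by rewrite /lamx big_ord_recr/=; ring.
elim: l H => [|l IH] H; first by rewrite /lamx /lamt !big_ord0 !mul1r.
have [w1 L1] := H 0%N l (leqnn _) (leqnSn l); have [w2 L2] := H 0%N l.+1 (leqnn _) (leqnn _).
rewrite (dot_dt d0 _ (He_ode_scale k l) L1 L2 (is_wderiv2_real_dt w1 w2)).
rewrite IH; last by move=> a b am bl; apply: H => //; exact: leqW.
by rewrite /lamt big_ord_recr/=; ring.
Qed.

Lemma is_wderiv2_basis k j a b : is_wderiv2_real a b (hgb 0 0 k j) (hgb a b k j).
Proof. exact: is_wderiv2_tens. Qed.

Lemma dot_basis_deriv m l k j k' j' : dot m (hgb m l k' j') (hgb m l k j) =
  lamx m j * lamt l k * dot 0 (hgb 0 0 k' j') (hgb 0 0 k j).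
Proof.
apply: (@dot_wderiv (hgb 0 0 k' j') (fun a b => hgb a b k' j')) => a b _ _.
by split; [exact: is_wderiv2_basis|exact: L2_basis].
Qed.

Lemma lamx1 j : lamx 1 j = j%:R * (j%:R + d%:R - 1).
Proof. by rewrite /lamx big_ord1 subr0 addr0. Qed.

Lemma lamt1 k : lamt 1 k = k%:R.
Proof. by rewrite /lamt big_ord1 subr0. Qed.

(** The product of the first derivatives of two basis functions is symmetric and equals either
    eigenvalue times the product of the functions. The eigenvalues in t separate k; those in x
    separate j, since for distinct j and j' they differ by (j - j')(j + j' + d - 1), which is
    nonzero. *)
Lemma dot_basis_orth k j k' j' : (k, j) != (k', j') ->
  dot 0 (hgb 0 0 k j) (hgb 0 0 k' j') = 0.
Proof.
move=> h; have [ek|nk] := eqVneq k k'.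
  have nj : j != j' by apply: contraNneq h => ->; rewrite ek.
  have := dot_basis_deriv 1 0 k' j' k j; have := dot_basis_deriv 1 0 k j k' j'.
  rewrite (ipC (leb2 R) _ _ (hgb 1 0 k' j')) (ipC (leb2 R) _ _ (hgb 0 0 k' j')) => -> /eqP.
  rewrite -subr_eq0 -mulrBl mulf_eq0 /lamt !big_ord0 !mulr1 !lamx1 => /orP[|/eqP//].
  have -> : j%:R * (j%:R + d%:R - 1) - j'%:R * (j'%:R + d%:R - 1) =
     (j%:R - j'%:R) * (j%:R + j'%:R + d%:R - 1) :> R by ring.
  rewrite mulf_eq0 subr_eq0 eqr_nat (negbTE nj)/=.
  have : (0 < j + j')%N by lia.
  rewrite -(ltr_nat R) natrD => j1; have : 1 <= d%:R :> R by rewrite ler1n.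
  by move=> d1 /eqP; lra.
have := dot_basis_deriv 0 1 k' j' k j; have := dot_basis_deriv 0 1 k j k' j'.
rewrite (ipC (leb2 R) _ _ (hgb 0 1 k' j')) (ipC (leb2 R) _ _ (hgb 0 0 k' j')) => -> /eqP.
rewrite -subr_eq0 -mulrBl mulf_eq0 /lamx !big_ord0 !mul1r !lamt1 => /orP[|/eqP//].
by rewrite subr_eq0 eqr_nat (negbTE nk).
Qed.

Definition nrm k j : R := dot 0 (hgb 0 0 k j) (hgb 0 0 k j).

(** The t-derivative of the function with [He k.+1] has squared norm (k+1)^2 [nrm k j] directly, and
    (k+1) [nrm k.+1 j] by the eigenvalue. *)
Lemma nrmS k j : nrm k.+1 j = k.+1%:R * nrm k j.
Proof.
have := dot_basis_deriv 0 1 k.+1 j k.+1 j.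
rewrite /lamx big_ord0 mul1r lamt1 -/(nrm k.+1 j).
have e : forall p, strip R p -> hgb 0 1 k.+1 j p = k.+1%:R * hgb 0 0 k j p.
  move=> p _; rewrite /hgb /tens derivn1 He_deriv !derivn0 hornerM.
  by rewrite -polyC_natr hornerC; ring.
have Lb := L2_basis 0 0 0 k j.
rewrite (eq_ip (leb2 R) _ e e) (dotZl _ Lb (L2Z _ Lb)) (dotZr _ Lb Lb).
have k0 : k.+1%:R != 0 :> R by rewrite pnatr_eq0.
by move=> h; apply: (mulfI k0); rewrite -h.
Qed.

Lemma nrm_fact k j : nrm k j = k`!%:R * nrm 0 j.
Proof.
elim: k => [|k IH]; first by rewrite fact0 mul1r.
by rewrite nrmS IH factS natrM mulrA.
Qed.

Let xgeg k i j : R := dot 0 (tens ('X * geg R d i) (He R k)) (hgb 0 0 k j).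

Let xgegC k i j : xgeg k i j = xgeg k j i.
Proof.
rewrite /xgeg /ip; apply: eq_Rintegral => p _.
by rewrite /hgb /tens !derivn0 !hornerM; ring.
Qed.

Let xgeg_rec k i j : (2 * i + d + 1)%:R * xgeg k i.+1 j =
  (i + d)%:R * dot 0 (hgb 0 0 k i.+2) (hgb 0 0 k j) +
  i.+1%:R * dot 0 (hgb 0 0 k i) (hgb 0 0 k j).
Proof.
rewrite /xgeg -!dotZl; try exact: L2_tens.
rewrite -dotDl; try exact: L2_tens; try by apply: L2Z; exact: L2_tens.
apply: eq_ip => // p _; rewrite /hgb /tens !derivn0.
have := congr1 (fun q : {poly R} => q.[p.1]) (gegSS R d0 i).
rewrite hornerD hornerN !hornerM -!polyC_natr !hornerC => e.
by rewrite !mulrA e; ring.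
Qed.

Lemma nrm_x1 k : (d%:R + 1) * nrm k 1 = nrm k 0.
Proof.
have := xgeg_rec k 0 0; rewrite dot_basis_orth ?mulr0 ?add0r; last first.
  by rewrite xpair_eqE eqxx.
rewrite mul1r -/(nrm k 0) => <-; rewrite xgegC muln0 add0n natrD; congr (_ * _).
by apply: eq_ip => // p _; rewrite /hgb /tens !derivn0 geg0 geg1 mulr1.
Qed.

(** Multiplication by x is symmetric: the product of x C_(j+1) with C_(j+2) is evaluated by applying
    the recurrence to either factor, and orthogonality leaves one norm each time. *)
Lemma nrm_xS k j : (j.+1%:R + d%:R - 1) * (2 * j.+1%:R + d%:R + 1) * nrm k j.+2 =
  j.+2%:R * (2 * j.+1%:R + d%:R - 1) * nrm k j.+1.
Proof.
have neq (a b : nat) : a != b -> dot 0 (hgb 0 0 k a) (hgb 0 0 k b) = 0.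
  by move=> ab; rewrite dot_basis_orth// xpair_eqE eqxx.
have h1 := xgeg_rec k j j.+2; have h2 := xgeg_rec k j.+1 j.+1.
rewrite (neq j j.+2) ?mulr0 ?addr0 in h1; last by lia.
rewrite (neq j.+3 j.+1) ?mulr0 ?add0r in h2; last by lia.
rewrite xgegC -/(nrm k j.+1) in h2; rewrite -/(nrm k j.+2) in h1.
rewrite (_ : (j.+1%:R + d%:R - 1 : R) = (j + d)%:R); last by rewrite natrD -natr1; ring.
rewrite (_ : (2 * j.+1%:R + d%:R + 1 : R) = (2 * j.+1 + d + 1)%:R); last by rewrite !natrD natrM.
rewrite (_ : (2 * j.+1%:R + d%:R - 1 : R) = (2 * j + d + 1)%:R); last first.
  by rewrite natrD natrD natrM -natr1; ring.
transitivity ((2 * j.+1 + d + 1)%:R * ((j + d)%:R * nrm k j.+2)); first by ring.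
rewrite -h1.
transitivity ((2 * j + d + 1)%:R * ((2 * j.+1 + d + 1)%:R * xgeg k j.+1 j.+2)); first by ring.
by rewrite h2; ring.
Qed.

(** In j, [nrm] and [dim_harm] obey reciprocal two-term recurrences, so their product is
    constant. *)
Lemma nrm_dim k j : nrm k j * dim_harm R d j = k`!%:R * nrm 0 0.
Proof.
rewrite nrm_fact -mulrA; congr (_ * _).
have d1 : 1 <= d%:R :> R by rewrite ler1n.
elim: j => [|[|j] IH]; first by rewrite dim_harm0 mulr1.
  by rewrite dim_harm1// mulrC nrm_x1.
have A : j.+2%:R * (2 * j.+1%:R + d%:R - 1) != 0 :> R.
  have j1 : 1 <= j.+1%:R :> R by rewrite ler1n.
  by apply: mulf_neq0; rewrite ?pnatr_eq0// gt_eqF//; lra.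
apply: (mulfI A); have e1 := dim_harmS R d0 (ltn0Sn j); have e2 := nrm_xS 0 j.
rewrite -IH.
transitivity (nrm 0 j.+2 * (dim_harm R d j.+2 * (j.+2%:R * (2 * j.+1%:R + d%:R - 1)))); first by ring.
rewrite e1.
transitivity (dim_harm R d j.+1 * ((j.+1%:R + d%:R - 1) * (2 * j.+1%:R + d%:R + 1) * nrm 0 j.+2)); first by ring.
by rewrite e2; ring.
Qed.

Lemma rho_lower m a T : 0 < a < 1 -> exists2 c : R, 0 < c & forall p, box a T p -> c <= rho d m p.
Proof.
move=> /andP[a0 a1].
have a2 : 0 < 1 - a ^+ 2 by rewrite subr_gt0 -(expr1n R 2) ltr_sqr ?nnegrE//; lra.
set s : R := d%:R / 2 - 1 + m%:R.
(* The minimum with 1 covers a negative exponent, for which the Jacobi weight is at least 1. *)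
exists (Num.min 1 ((1 - a ^+ 2) `^ s) * ((Num.sqrt (2 * pi))^-1 * expR (- (T ^+ 2) / 2))).
  by rewrite mulr_gt0 ?lt_min ?ltr01 ?powR_gt0// mulr_gt0 ?expR_gt0// invr_gt0 sqrt2pi_gt0.
move=> p bp; have Sp := box_strip a1 bp; have /boxP[p1 p2] := bp.
have /andP[h1 h2] := strip_x Sp.
rewrite /rho normal_pdf01; apply: ler_pM.
- by rewrite le_min ler01 powR_ge0.
- by rewrite mulr_ge0 ?expR_ge0// invr_ge0 ltW// sqrt2pi_gt0.
- rewrite /jweight -/s ge_min.
  have px : p.1 ^+ 2 <= a ^+ 2 by rewrite -(real_normK (num_real p.1)) ler_sqr ?nnegrE// ltW.
  have [s0|s0] := leP 0 s.
    by apply/orP; right; apply: ge0_ler_powR => //; rewrite ?nnegrE ?(ltW a2) ?(ltW h1)//; lra.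
  have h12 : 0 < 1 - p.1 ^+ 2 <= 1 by rewrite h1.
  by have := ger_powR h12 (ltW s0); rewrite powRr0 => ->.
- rewrite ler_wpM2l ?invr_ge0 ?sqrtr_ge0// ler_expR ler_wpM2r// lerN2.
  by rewrite -(real_normK (num_real p.2)) ler_sqr ?nnegrE// (le_trans _ p2).
Qed.

Lemma nrm00_gt0 : 0 < nrm 0 0.
Proof.
have [|c c0 H] := @rho_lower 0 (1 / 2) 1; first by apply/andP; split; lra.
rewrite -lte_fin /nrm (ip_sq mS (mr 0) (@r0 0)); last exact: L2_basis.
apply: (@lt_le_trans _ _ (\int[leb2 R]_(p in (box (1 / 2) 1 : set T2)) (cst c%:E) p)%E).
  rewrite integral_cst; last exact: measurable_box.
  rewrite mule_gt0//= product_measure1E//; try exact: measurable_itv.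
  have H0 (a : R) : 0 < a -> (0 < (@lebesgue_measure R) [set` `[(- a)%R, a]])%E.
    move=> a0; rewrite lebesgue_measure_itv/= lte_fin ifT; last by lra.
    by rewrite -EFinB lte_fin; lra.
  by rewrite mule_gt0//; apply: H0; lra.
apply: (@le_trans _ _ (\int[leb2 R]_(p in (box (1 / 2) 1 : set T2)) (hgb 0 0 0 0 p ^+ 2 * rho d 0 p)%:E)%E).
  apply: le_integral_nomeas => p bp; first by rewrite lee_fin ltW.
  by rewrite lee_fin /hgb /tens !derivn0 geg0 /= !hornerC mulr1 expr1n mul1r H.
apply: subset_integral_nomeas.
  by apply: box_strip; lra.
by move=> p Sp; rewrite lee_fin mulr_ge0 ?sqr_ge0 ?r0.
Qed.

Lemma nrm_gt0 k j : 0 < nrm k j.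
Proof.
have := nrm_dim k j; have D := dim_harm_gt0 R j d0 => e.
by rewrite -(pmulr_lgt0 _ D) e mulr_gt0 ?nrm00_gt0// ltr0n fact_gt0.
Qed.

Lemma bessel_wderiv (f : R * R -> R) (u : nat -> nat -> R * R -> R) m l (s : seq (nat * nat)) : uniq s ->
  (forall a b, (a <= m)%N -> (b <= l)%N -> is_wderiv2_real a b f (u a b) /\ L2r a (u a b)) ->
  \sum_(i <- s) lamx m i.2 * lamt l i.1 * dot 0 (u 0%N 0%N) (hgb 0 0 i.1 i.2) ^+ 2 / nrm i.1 i.2
    <= dot m (u m l) (u m l).
Proof.
move=> us H; have [_ Lu] := H m l (leqnn _) (leqnn _).
have oe (i i' : nat * nat) : i != i' -> dot m (hgb m l i.1 i.2) (hgb m l i'.1 i'.2) = 0.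
  move=> ii; rewrite dot_basis_deriv dot_basis_orth ?mulr0// -!surjective_pairing.
have Lb (i : nat * nat) : L2r m (hgb m l i.1 i.2) by exact: L2_basis.
apply: le_trans (bessel mS (mr m) (@r0 m) us Lb oe Lu).
rewrite le_eqVlt; apply/orP; left; apply/eqP; apply: eq_bigr => i _.
rewrite (dot_wderiv H) dot_basis_deriv -/(nrm i.1 i.2).
have N0 := lt0r_neq0 (nrm_gt0 i.1 i.2).
set L := lamx m i.2 * lamt l i.1; set c := ip _ _ _ _ _.
(* When L = 0 the differentiated basis function has norm 0, and both terms are 0, one of them by the
   convention on division. Otherwise (L c)^2 / (L nrm) loses one factor L. *)
have [->|L0] := eqVneq L 0; first by rewrite !mul0r invr0 mulr0.
by field; rewrite N0 L0.
Qed.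

End hgb.

(** * Comparison of the derivative factors with powers of the indices *)

Section index_bounds.
Variables (R : realType) (d : nat).
Hypothesis d0 : (0 < d)%N.

Lemma lamt_small l k : (k < l)%N -> lamt R l k = 0.
Proof.
by move=> kl; apply/eqP/prodf_eq0; exists (Ordinal kl) => //=; rewrite subrr.
Qed.

Lemma lamx_small m j : (j < m)%N -> lamx R d m j = 0.
Proof.
by move=> jm; apply/eqP/prodf_eq0; exists (Ordinal jm) => //=; rewrite subrr mul0r.
Qed.

Lemma lamt_bounds l k : 0 <= lamt R l k <= (maxn k 1)%:R ^+ l.
Proof.
have [kl|lk] := ltnP k l; first by rewrite lamt_small// lexx/= exprn_ge0.
have F (i : 'I_l) : 0 <= (k%:R - i%:R : R) <= (maxn k 1)%:R.
  have ik : (i <= k)%N by rewrite (leq_trans _ lk)// ltnW.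
  rewrite subr_ge0 ler_nat ik/= (@le_trans _ _ k%:R)//; first by rewrite gerBl.
  by rewrite ler_nat leq_maxl.
apply/andP; split; first by apply: prodr_ge0 => i _; case/andP: (F i).
have -> : (maxn k 1)%:R ^+ l = \prod_(i < l) (maxn k 1)%:R :> R by rewrite prodr_const card_ord.
by apply: ler_prod => i _; exact: F.
Qed.

Lemma lamx_bounds m j : 0 <= lamx R d m j <= (d.+1%:R * (maxn j 1)%:R ^+ 2) ^+ m.
Proof.
have [jm|mj] := ltnP j m; first by rewrite lamx_small// lexx/= exprn_ge0// mulr_ge0// exprn_ge0.
have F (i : 'I_m) : 0 <= ((j%:R - i%:R) * (j%:R + i%:R + d%:R - 1) : R) <= d.+1%:R * (maxn j 1)%:R ^+ 2.
  have ij : (i <= j)%N by rewrite (leq_trans _ mj)// ltnW.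
  have dd : 1 <= d%:R :> R by rewrite ler1n.
  have h1 : 0 <= (i%:R : R) <= j%:R by rewrite ler0n ler_nat.
  have h2 : j%:R <= (maxn j 1)%:R :> R by rewrite ler_nat leq_maxl.
  have h3 : 1 <= (maxn j 1)%:R :> R by rewrite ler1n leq_maxr.
  have h4 : (i < j)%N by exact: leq_trans mj.
  have h5 : i%:R + 1 <= j%:R :> R by rewrite natr1 ler_nat.
  move: h1 h2 h3 h5; rewrite -natr1; move: (maxn j 1)%:R (j%:R) (i%:R) (d%:R) dd => J x y D dd /andP[y0 yx] xJ J1 yx1.
  apply/andP; split; first by rewrite mulr_ge0; lra.
  apply: (@le_trans _ _ (J * ((D + 1) * J))); last by rewrite expr2 mulrCA.
  apply: ler_pM; [lra|lra|lra|].
  have : 0 <= (D - 1) * (J - 1) by apply: mulr_ge0; lra.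
  lra.
apply/andP; split; first by apply: prodr_ge0 => i _; case/andP: (F i).
rewrite (_ : _ ^+ m = \prod_(i < m) (d.+1%:R * (maxn j 1)%:R ^+ 2)); last by rewrite prodr_const card_ord.
by apply: ler_prod => i _; exact: F.
Qed.

Lemma sub_ge_ratio n i (k : nat) : (i < n)%N -> (n <= k)%N -> k%:R <= n%:R * (k%:R - i%:R) :> R.
Proof.
move=> ni nk; have : (k + n * i <= n * k)%N by nia.
by rewrite -(ler_nat R) natrD !natrM; lra.
Qed.

(** The product vanishes for k < n, hence the added 1: there the left side is at most n^n, and from
    n on each of the n factors k - i is at least k/n. *)
Lemma lamt_lower n k : (maxn k 1)%:R ^+ n <= n%:R ^+ n * (1 + lamt R n k).
Proof.
have /andP[l0 _] := lamt_bounds n k.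
have [kn|nk] := ltnP k n.
  apply: (@le_trans _ _ (n%:R ^+ n)).
    by apply: lerXn2r; rewrite ?nnegrE// ler_nat; lia.
  by rewrite ler_peMr ?exprn_ge0//; lra.
have [->|n0] := posnP n; first by rewrite !expr0 /lamt big_ord0; lra.
apply: (@le_trans _ _ (n%:R ^+ n * lamt R n k)); last by rewrite ler_wpM2l ?exprn_ge0//; lra.
have -> : maxn k 1 = k by lia.
rewrite (_ : _ ^+ n * _ = \prod_(i < n) (n%:R * (k%:R - i%:R))); last first.
  by rewrite big_split/= prodr_const card_ord.
rewrite (_ : k%:R ^+ n = \prod_(i < n) k%:R); last by rewrite prodr_const card_ord.
by apply: ler_prod => i _; rewrite ler0n/= sub_ge_ratio.
Qed.

Lemma lamx_lower n j : (maxn j 1)%:R ^+ (2 * n) <= n%:R ^+ (2 * n) * (1 + lamx R d n j).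
Proof.
have /andP[l0 _] := lamx_bounds n j; rewrite !exprM.
have [jn|nj] := ltnP j n.
  apply: (@le_trans _ _ ((n%:R ^+ 2) ^+ n)).
    by rewrite -!exprM; apply: lerXn2r; rewrite ?nnegrE// ler_nat; lia.
  by rewrite ler_peMr ?exprn_ge0//; lra.
have [->|n0] := posnP n; first by rewrite !expr0 /lamx big_ord0; lra.
apply: (@le_trans _ _ ((n%:R ^+ 2) ^+ n * lamx R d n j)); last by rewrite ler_wpM2l ?exprn_ge0//; lra.
have -> : maxn j 1 = j by lia.
rewrite (_ : _ ^+ n * _ = \prod_(i < n) (n%:R ^+ 2 * ((j%:R - i%:R) * (j%:R + i%:R + d%:R - 1)))); last first.
  by rewrite big_split/= prodr_const card_ord.
rewrite (_ : _ ^+ n = \prod_(i < n) j%:R ^+ 2); last by rewrite prodr_const card_ord.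
apply: ler_prod => i _; rewrite exprn_ge0//=.
have h := sub_ge_ratio (ltn_ord i) nj; have n1 : 1 <= n%:R :> R by rewrite ler1n.
have dd : 1 <= d%:R :> R by rewrite ler1n.
have i0 : 0 <= (i : nat)%:R :> R by [].
have j0 : 0 <= j%:R :> R by [].
rewrite expr2 mulrACA -expr2; apply: ler_pM => //.
apply: (@le_trans _ _ (1 * (j%:R + (i : nat)%:R + d%:R - 1))); first by lra.
by apply: ler_wpM2r => //; lra.
Qed.

End index_bounds.

(** * Closedness of weak derivatives under weighted L2 limits *)

Section limits.
Variables (R : realType) (d : nat).
Hypothesis d0 : (0 < d)%N.
Local Notation T2 := (measurableTypeR R * measurableTypeR R)%type.
Local Notation L2r m := (L2w (leb2 R) (strip R : set T2) (rho d m)).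
Local Notation dot m := (ip (leb2 R) (strip R : set T2) (rho d m)).

Let mS := @measurable_strip R.
Let mr m := @measurable_rho R d m (strip R).
Let r0 m := @rho_ge0 R d m.

Lemma dot_cvg m (u : nat -> R * R -> R) (v g : R * R -> R) : (forall i, L2r m (u i)) -> L2r m v -> L2r m g ->
  dot m (fun p => v p - u n p) (fun p => v p - u n p) @[n --> \oo] --> 0 ->
  dot m (u n) g @[n --> \oo] --> dot m v g.
Proof.
move=> Lu Lv Lg h.
have LB n : L2r m (fun p => v p - u n p) by exact: (L2wB mS (mr m) (@r0 m) Lv (Lu n)).
have G0 := ip_ge0 (leb2 R) (@r0 m) g.
apply: (@cvg_sub0 _ _ _ _ _ _ (fun=> dot m v g)); last exact: cvg_cst.
have {}h : Num.sqrt (dot m (fun p => v p - u n p) (fun p => v p - u n p) * dot m g g) @[n --> \oo] --> 0.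
  rewrite -(sqrtr0 R) -(mul0r (dot m g g)).
  by apply: continuous_cvg; [exact: sqrt_continuous|apply: cvgMl].
apply/norm_cvg0P; apply: (squeeze_cvgr _ (cvg_cst 0) h); apply: nearW => n.
set X := Num.sqrt _; change (0 <= `|dot m (u n) g - dot m v g| <= X); rewrite /X.
rewrite normr_ge0/= -(ipBl mS (mr m) (@r0 m) (Lu n) Lv Lg) -sqrtr_sqr ler_wsqrtr//.
rewrite (_ : _ ^+ 2 = dot m (fun p => v p - u n p) g ^+ 2); last first.
  by rewrite (ipBl mS (mr m) (@r0 m) (Lu n) Lv Lg) (ipBl mS (mr m) (@r0 m) Lv (Lu n) Lg) -sqrrN opprB.
exact: (ip_CS mS (mr m) (@r0 m) (LB n) Lg).
Qed.

(** On a compact subset of the strip the weight is at least some c > 0, so |u| <= 1 + u^2 <= 1 + u^2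
    rho / c. *)
Lemma L2_loc_integrable m u : L2r m u -> loc_integrable2 u.
Proof.
move=> Lu; have [mu1 fu] := Lu; split=> // K cK KS.
have [a [T [a0 a1 T0 Kb]]] := compact_sub_box cK KS.
have [|c c0 H] := @rho_lower R d m a T; first by rewrite a0.
have mK := @compact_measurable2 R K cK.
apply: (@le_lt_trans _ _ (\int[leb2 R]_(p in (K : set T2)) (1%:E + (c^-1)%:E * (u p ^+ 2 * rho d m p)%:E))%E).
  apply: le_integral_nomeas => p Kp//.
  have h := H _ (Kb _ Kp); rewrite -EFinM -EFinD lee_fin.
  apply: (@le_trans _ _ (1 + u p ^+ 2)).
    have := sqr_ge0 (`|u p| - 1); have := real_normK (num_real (u p)); have := normr_ge0 (u p); nra.
  by rewrite lerD2l mulrCA ler_peMr ?sqr_ge0// ler_pdivlMl// mulr1.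
have mE : measurable_fun (K : set T2) (fun p : T2 => (u p ^+ 2 * rho d m p)%:E).
  apply/measurable_EFinP; apply: (measurable_funS mS KS).
  by apply: measurable_funM => //; exact: measurable_funX.
rewrite ge0_integralD//; last 2 first.
- by move=> p Kp; rewrite -EFinM lee_fin; apply: mulr_ge0; [by rewrite invr_ge0 ltW|by rewrite mulr_ge0 ?sqr_ge0// rho_ge0//; exact: KS].
- exact: measurable_funeM.
rewrite integral_cst// mul1e ge0_integralZl//; last 2 first.
- by move=> p Kp; rewrite lee_fin mulr_ge0 ?sqr_ge0// rho_ge0//; exact: KS.
- by rewrite lee_fin invr_ge0 ltW.
apply: lte_add_pinfty.
  by apply: le_lt_trans (box_measure a T); apply: le_measure; rewrite ?inE//; exact: measurable_box.
rewrite lte_mul_pinfty// ?lee_fin ?invr_ge0 ?(ltW c0)//.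
apply: le_lt_trans fu; apply: subset_integral_nomeas => // p Sp.
by rewrite lee_fin mulr_ge0 ?sqr_ge0// r0.
Qed.

(** Dividing by the weight, which is bounded below on the support, makes a Lebesgue pairing with a
    test function an inner product in the weight of any index, hence continuous for convergence in
    that norm. *)
Lemma test_over_rho m (phi : nat -> nat -> R * R -> R) j k : test_jet2 phi ->
  L2r m (fun p => phi j k p / rho d m p).
Proof.
move=> tphi; have [a [T [_ a01 T0 H]]] := test_jet2_box tphi.
have [c c0 rc] := @rho_lower R d m a T a01; have /andP[a0 a1] := a01.
have [C C0 HC] : exists2 C, 0 <= C & forall p, box a T p -> `|phi j k p| <= C.
  by apply: continuous_box_bounded; case: tphi.
have mb := @measurable_box R a T.
have mq : measurable_fun (strip R : set T2) (fun p => phi j k p / rho d m p).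
  apply: measurable_funM; first exact: measurable_test.
  apply: (@eq_measurable_fun _ _ _ _ _ (fun p => rho d m p `^ (-1))).
    by move=> p /set_mem Sp; rewrite powR_inv1// r0.
  by apply: (measurableT_comp (measurable_powR _)); exact: mr.
split=> //.
apply: (@le_lt_trans _ _ (\int[leb2 R]_(p in (strip R : set T2)) ((C ^+ 2 / c)%:E * (\1_(box a T : set T2) p)%:E))%E).
  apply: le_integral_nomeas => p Sp; first by rewrite lee_fin mulr_ge0 ?sqr_ge0// r0.
  have rp := @rho_gt0 R d m p Sp.
  rewrite -EFinM lee_fin indicE; have [bp|nbp] := pselect (box a T p); last first.
    by rewrite H// mul0r expr0n mul0r memNset// mulr0.
  rewrite mem_set// mulr1 (_ : _ * rho d m p = phi j k p ^+ 2 * (rho d m p)^-1); last by field; rewrite gt_eqF.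
  apply: ler_pM; rewrite ?sqr_ge0 ?invr_ge0 ?(ltW rp)//.
    by rewrite -(real_normK (num_real (phi j k p))) ler_sqr ?nnegrE// HC.
  by rewrite lef_pV2 ?posrE// rc.
rewrite ge0_integralZl//; first last.
  by rewrite lee_fin divr_ge0 ?sqr_ge0// ltW.
  by apply/measurable_EFinP; exact: measurable_indic.
rewrite lte_mul_pinfty// ?lee_fin ?divr_ge0 ?sqr_ge0 ?(ltW c0)//.
rewrite integral_indic// (@le_lt_trans _ _ (leb2 R (box a T)))//; last exact: box_measure.
by apply: le_measure; rewrite ?inE; [exact: measurableI|exact: mb|exact: subIsetl].
Qed.

Lemma dot_test m (u psi : R * R -> R) :
  \int[leb2 R]_(p in strip R) (u p * psi p) = dot m u (fun p => psi p / rho d m p).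
Proof.
apply: eq_Rintegral => p /set_mem Sp; have := @rho_gt0 R d m p Sp => rp.
by rewrite mulrA divfK// gt_eqF.
Qed.

(** The functions converge in the weight of index 0 and the derivatives in that of index m; each
    side of the defining identity is an inner product in the matching weight. *)
Lemma is_wderiv2_real_lim m l (u v : nat -> R * R -> R) f g :
  (forall i, is_wderiv2_real m l (u i) (v i)) -> (forall i, L2r 0 (u i)) -> (forall i, L2r m (v i)) ->
  L2r 0 f -> L2r m g ->
  dot 0 (fun p => f p - u n p) (fun p => f p - u n p) @[n --> \oo] --> 0 ->
  dot m (fun p => g p - v n p) (fun p => g p - v n p) @[n --> \oo] --> 0 ->
  is_wderiv2_real m l f g.
Proof.
move=> wuv Lu Lv Lf Lg cu cv; split; [exact: L2_loc_integrable Lf|exact: L2_loc_integrable Lg|].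
move=> phi tphi; rewrite (dot_test 0) (dot_test m).
have c1 := dot_cvg Lu Lf (test_over_rho 0 m l tphi) cu.
have c2 := dot_cvg Lv Lg (test_over_rho m 0 0 tphi) cv.
have c3 := @cvgMr _ _ _ _ _ ((-1) ^+ (m + l)) _ c2.
rewrite -(cvg_lim (@Rhausdorff R) c1) -(cvg_lim (@Rhausdorff R) (c3 _)); congr (lim (_ @ \oo)).
by apply/funext => n; rewrite -!dot_test; case: (wuv n) => _ _ ->.
Qed.

End limits.

(** * Partial sums of orthogonal expansions *)

Section series.
Variables (R : realType) (d : nat).
Hypothesis d0 : (0 < d)%N.
Local Notation T2 := (measurableTypeR R * measurableTypeR R)%type.
Local Notation L2r m := (L2w (leb2 R) (strip R : set T2) (rho d m)).
Local Notation dot m := (ip (leb2 R) (strip R : set T2) (rho d m)).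

Let mS := @measurable_strip R.
Let mr m := @measurable_rho R d m (strip R).
Let r0 m := @rho_ge0 R d m.

(** Double sums are truncated along squares, as in [HG_expansion]; a list of pairs makes them sums
    over a single index. *)
Definition square (N : nat) : seq (nat * nat) := [seq (k, j) | k <- iota 0 N, j <- iota 0 N].

Lemma mem_square N i : (i \in square N) = (i.1 < N)%N && (i.2 < N)%N.
Proof.
case: i => k j; rewrite /square; apply/allpairsP/idP => [[[a b] [ha hb [-> ->]]]|/andP[kN jN]].
  by move: ha hb; rewrite !mem_iota !add0n/= => -> ->.
by exists (k, j); rewrite !mem_iota !add0n/= kN jN.
Qed.

Lemma uniq_square N : uniq (square N).
Proof.
by apply: allpairs_uniq; rewrite ?iota_uniq// => -[? ?] [? ?] _ _ /= [-> ->].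
Qed.

Lemma big_square (V : nmodType) N (F : nat -> nat -> V) :
  \sum_(k < N) \sum_(j < N) F k j = \sum_(i <- square N) F i.1 i.2.
Proof.
rewrite big_allpairs/= -(big_mkord xpredT (fun k => \sum_(j < N) F k j)) /index_iota subn0.
by apply: eq_bigr => k _; rewrite -(big_mkord xpredT (F k)) /index_iota subn0.
Qed.

Lemma big_square_sub (V : nmodType) M N (F : nat * nat -> V) : (M <= N)%N ->
  \sum_(i <- square M) F i = \sum_(i <- square N | i \in square M) F i.
Proof.
move=> MN; have pe : perm_eq (square M) [seq i <- square N | i \in square M]; last first.
  by rewrite -[RHS]big_filter; exact: perm_big.
apply: uniq_perm; [exact: uniq_square|exact/filter_uniq/uniq_square|].
move=> i; rewrite mem_filter; case: (boolP (i \in square M)) => //=.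
by rewrite !mem_square => /andP[h1 h2]; rewrite (leq_trans h1)// (leq_trans h2).
Qed.

Definition psum (a : nat * nat -> R) (m l : nat) (s : seq (nat * nat)) (p : R * R) : R :=
  \sum_(i <- s) a i * hgb d m l i.1 i.2 p.

Lemma L2_psum b a m l s : L2r b (psum a m l s).
Proof.
apply: (L2w_sum mS (mr b) (@r0 b)) => i; apply: (L2wZ mS (mr b) (@r0 b)); exact: (L2_basis R d0).
Qed.

Lemma is_wderiv2_psum a m l s : is_wderiv2_real m l (psum a 0 0 s) (psum a m l s).
Proof.
apply: is_wderiv2_real_sum => i; apply: is_wderiv2_realZ; exact: is_wderiv2_basis.
Qed.

Definition mode (m l : nat) (i : nat * nat) : R := lamx R d m i.2 * lamt R l i.1.

Lemma mode_ge0 m l i : 0 <= mode m l i.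
Proof.
by apply: mulr_ge0; [case/andP: (lamx_bounds R d0 m i.2)|case/andP: (lamt_bounds R l i.1)].
Qed.

Lemma dot_psum a m l s : uniq s -> dot m (psum a m l s) (psum a m l s) =
  \sum_(i <- s) mode m l i * (a i ^+ 2 * nrm R d i.1 i.2).
Proof.
move=> us; rewrite (ip_sum_orth mS (mr m) (@r0 m)) //.
- by apply: eq_bigr => i _; rewrite (dot_basis_deriv R d0) /mode /nrm; ring.
- by move=> i; exact: (L2_basis R d0).
by move=> i j ij; rewrite (dot_basis_deriv R d0) (dot_basis_orth R d0) ?mulr0// -!surjective_pairing.
Qed.

Lemma psum_sub a m l M N : (M <= N)%N -> forall p,
  psum a m l (square N) p - psum a m l (square M) p =
  psum (fun i => a i * (i \notin square M)%:R) m l (square N) p.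
Proof.
move=> MN p; rewrite /psum [X in _ - X](big_square_sub _ MN) [X in _ - X]big_mkcond -sumrB.
by apply: eq_bigr => i _; case: (i \in square M) => /=; ring.
Qed.

(** Orthogonality makes the squared norm of a difference a difference of squared norms, so that a
    bound on the sums yields a Cauchy sequence. *)
Lemma dot_psum_sub a m l M N : (M <= N)%N ->
  dot m (fun p => psum a m l (square N) p - psum a m l (square M) p)
        (fun p => psum a m l (square N) p - psum a m l (square M) p) =
  \sum_(i <- square N) mode m l i * (a i ^+ 2 * nrm R d i.1 i.2) -
  \sum_(i <- square M) mode m l i * (a i ^+ 2 * nrm R d i.1 i.2).
Proof.
move=> MN; have e p : strip R p -> _ := fun _ => psum_sub a m l MN p.
rewrite (eq_ip (leb2 R) _ e e) dot_psum ?uniq_square//.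
rewrite [X in _ - X](big_square_sub _ MN) [X in _ - X]big_mkcond -sumrB.
by apply: eq_bigr => i _; case: (i \in square M) => /=; ring.
Qed.

Lemma nondecreasing_bounded_cauchy (T : nat -> R) B : (forall M N, (M <= N)%N -> T M <= T N) ->
  (forall N, T N <= B) -> forall e, 0 < e -> exists N, forall m n, (N <= m)%N -> (m <= n)%N ->
  T n - T m <= e.
Proof.
move=> ndT TB e e0.
have hs : has_sup (range T) by split; [exists (T 0%N); exists 0%N|exists B => _ [n _ <-]].
have [_ [N _ <-] hN] := sup_adherent e0 hs.
exists N => m n Nm mn; have h1 := ndT _ _ Nm.
have h2 : T n <= sup (range T) by apply: ub_le_sup; [case: hs|exists n].
lra.
Qed.

Lemma rho_fin m : (\int[leb2 R]_(p in (strip R : set T2)) (rho d m p)%:E < +oo)%E.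
Proof.
have [_] := @L2_tens R d d0 m 1 1; apply: le_lt_trans; rewrite le_eqVlt; apply/orP; left; apply/eqP.
by apply: eq_integral => p _; rewrite /tens !hornerC mulr1 expr1n mul1r.
Qed.

Lemma psum_limit (a : nat * nat -> R) m l (u : R * R -> R) B : L2r 0 u ->
  dot 0 (fun p => u p - psum a 0 0 (square N) p) (fun p => u p - psum a 0 0 (square N) p) @[N --> \oo] --> 0 ->
  (forall N, \sum_(i <- square N) mode m l i * (a i ^+ 2 * nrm R d i.1 i.2) <= B) ->
  exists g, [/\ is_wderiv2_real m l u g, L2r m g,
    dot m (fun p => g p - psum a m l (square N) p) (fun p => g p - psum a m l (square N) p) @[N --> \oo] --> 0 &
    dot m g g <= B].
Proof.
move=> Lu cu HB; set T := fun N => \sum_(i <- square N) mode m l i * (a i ^+ 2 * nrm R d i.1 i.2).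
have ndT M N : (M <= N)%N -> T M <= T N.
  move=> MN; rewrite -subr_ge0 /T -dot_psum_sub//.
  exact: (ip_ge0 (leb2 R) (@r0 m)).
have cau := nondecreasing_bounded_cauchy ndT HB.
have Lp N := L2_psum m a m l (square N).
have [|g [Lg cg]] := riesz_fischer mS (mr m) (@rho_gt0 R d m) (rho_fin m) Lp.
  move=> e e0; have [N0 hN0] := cau _ e0; exists N0 => M N hM hN.
  have [MN|/ltnW NM] := leqP M N; last by rewrite dot_psum_sub//; apply: hN0.
  rewrite (_ : ip _ _ _ _ _ = dot m (fun p => psum a m l (square N) p - psum a m l (square M) p)
    (fun p => psum a m l (square N) p - psum a m l (square M) p)).
    by rewrite dot_psum_sub//; apply: hN0.
  by apply: eq_Rintegral => p _; ring.
exists g; split=> //.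
  exact: (is_wderiv2_real_lim (fun N => is_wderiv2_psum a m l (square N))
    (fun N => L2_psum 0 a 0 0 (square N)) Lp Lu Lg cu cg).
have h1 := dot_cvg Lp Lg Lg cg.
have h2 : dot m (psum a m l (square N)) g ^+ 2 @[N --> \oo] --> dot m g g ^+ 2.
  by rewrite expr2; under eq_fun do rewrite expr2; apply: cvgM.
have G0 := ip_ge0 (leb2 R) (@r0 m) g.
(* The bound on the limit comes from Cauchy-Schwarz: <p_N,g>^2 <= B <g,g> for the partial sums p_N,
   whose limit is <g,g>^2 <= B <g,g>; a nonzero <g,g> is then cancelled. *)
have h3 : dot m g g ^+ 2 <= B * dot m g g.
  apply: (cvgr_to_le h2); apply: nearW => N /=.
  apply: (le_trans (ip_CS mS (mr m) (@r0 m) (Lp N) Lg)).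
  by rewrite ler_wpM2r// dot_psum ?uniq_square//; exact: HB.
move: h3 G0; set X := ip _ _ _ g g => h3 G0; have [->|X0] := eqVneq X 0.
  by apply: le_trans (HB 0%N); rewrite big_nil.
have {}X0 : 0 < X by rewrite lt_def X0.
by rewrite -(ler_pM2r X0) -expr2.
Qed.

(** The inner product of the partial sum with a basis function is constant once the square contains
    (k, j), so the limit is read off. *)
Lemma psum_coef (a : nat * nat -> R) (u : R * R -> R) k j : L2r 0 u ->
  dot 0 (fun p => u p - psum a 0 0 (square N) p) (fun p => u p - psum a 0 0 (square N) p) @[N --> \oo] --> 0 ->
  dot 0 u (hgb d 0 0 k j) = a (k, j) * nrm R d k j.
Proof.
move=> Lu cu; have Lb := L2_basis R d0 0 0 0 k j.
have h := dot_cvg (fun N => L2_psum 0 a 0 0 (square N)) Lu Lb cu.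
rewrite -(cvg_lim (@Rhausdorff R) h); apply/cvg_lim; first exact: Rhausdorff.
apply: cvg_near_cst; near=> N.
rewrite (ip_suml mS (mr 0) (@r0 0)) //; last by move=> i; apply: (L2wZ mS (mr 0) (@r0 0)); exact: (L2_basis R d0).
rewrite (bigD1_seq (k, j)) ?uniq_square//=; last first.
  by rewrite mem_square; apply/andP; split; near: N; exact: nbhs_infty_gt.
have e (b : R) k' j' : dot 0 (fun x => b * hgb d 0 0 k' j' x) (hgb d 0 0 k j) =
    b * dot 0 (hgb d 0 0 k' j') (hgb d 0 0 k j).
  by apply: (ipZl mS (mr 0) (@r0 0)) => //; exact: (L2_basis R d0).
rewrite e big1 ?addr0// => i ij; rewrite e (dot_basis_orth R d0) ?mulr0//.
Unshelve. all: by end_near. Qed.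

End series.

(** * Seminorms of complex functions and the weighted Bessel bound *)

Section complex_norms.
Variables (R : realType) (d : nat).
Hypothesis d0 : (0 < d)%N.
Local Notation T2 := (measurableTypeR R * measurableTypeR R)%type.
Local Notation L2r m := (L2w (leb2 R) (strip R : set T2) (rho d m)).
Local Notation dot m := (ip (leb2 R) (strip R : set T2) (rho d m)).

Let mS := @measurable_strip R.
Let mr m := @measurable_rho R d m (strip R).
Let r0 m := @rho_ge0 R d m.

Lemma is_wderiv2_real_id (u : R * R -> R) : loc_integrable2 u -> is_wderiv2_real 0 0 u u.
Proof. by move=> lu; split=> // phi _; rewrite expr0 mul1r. Qed.

Lemma ae_L2 m (v v' : R * R -> R) : ae_eq (leb2 R) (strip R : set T2) v v' ->
  measurable_fun (strip R : set T2) v' -> L2r m v -> L2r m v'.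
Proof.
move=> h mv' [mv fv]; split=> //; apply: le_lt_trans fv.
rewrite le_eqVlt; apply/orP; left; apply/eqP; apply: ae_eq_integral => //.
- by apply/measurable_EFinP; apply: measurable_funM; [exact: measurable_funX|exact: mr].
- by apply/measurable_EFinP; apply: measurable_funM; [exact: measurable_funX|exact: mr].
by apply: filterS h => p + Sp => /(_ Sp) /= ->.
Qed.

Lemma ae_dot m (v v' g : R * R -> R) : ae_eq (leb2 R) (strip R : set T2) v v' ->
  L2r m v -> L2r m v' -> L2r m g -> dot m v g = dot m v' g.
Proof.
move=> h Lv Lv' Lg; rewrite /ip /Rintegral; congr fine; apply: ae_eq_integral => //.
- exact: (measurable_int _ (L2w_integrable mS (mr m) (@r0 m) Lv Lg)).
- exact: (measurable_int _ (L2w_integrable mS (mr m) (@r0 m) Lv' Lg)).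
by apply: filterS h => p + Sp => /(_ Sp) /= ->.
Qed.

Lemma wintE m (f : R * R -> R[i]) :
  measurable_fun (strip R : set T2) (fun p => complex.Re (f p)) ->
  measurable_fun (strip R : set T2) (fun p => complex.Im (f p)) ->
  (wint d m f = \int[leb2 R]_(p in (strip R : set T2)) (complex.Re (f p) ^+ 2 * rho d m p)%:E +
    \int[leb2 R]_(p in (strip R : set T2)) (complex.Im (f p) ^+ 2 * rho d m p)%:E)%E.
Proof.
move=> m1 m2; rewrite /wint ge0_integral_dxdnu; first last.
- by move=> p Sp; rewrite lee_fin mulr_ge0 ?powR_ge0// addr_ge0 ?sqr_ge0.
- apply/measurable_EFinP; apply: measurable_funM; last exact: (measurable_comp_fst (measurable_jweight _ _)).
  by apply: measurable_funD; exact: measurable_funX.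
rewrite -ge0_integralD//.
- by apply: eq_integral => p _; rewrite -EFinM -EFinD /sqabs /rho; congr EFin; ring.
- by move=> p Sp; rewrite lee_fin mulr_ge0 ?sqr_ge0// r0.
- by apply/measurable_EFinP; apply: measurable_funM; [exact: measurable_funX|exact: mr].
- by move=> p Sp; rewrite lee_fin mulr_ge0 ?sqr_ge0// r0.
by apply/measurable_EFinP; apply: measurable_funM; [exact: measurable_funX|exact: mr].
Qed.

Lemma wint_dot m (f : R * R -> R[i]) : L2r m (fun p => complex.Re (f p)) ->
  L2r m (fun p => complex.Im (f p)) ->
  wint d m f = (dot m (fun p => complex.Re (f p)) (fun p => complex.Re (f p)) +
                dot m (fun p => complex.Im (f p)) (fun p => complex.Im (f p)))%:E.
Proof.
move=> L1 L2; rewrite wintE; [|by case: L1|by case: L2].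
by rewrite EFinD (ip_sq mS (mr m) (@r0 m) L1) (ip_sq mS (mr m) (@r0 m) L2).
Qed.

Lemma wint_L2 m (f : R * R -> R[i]) :
  measurable_fun (strip R : set T2) (fun p => complex.Re (f p)) ->
  measurable_fun (strip R : set T2) (fun p => complex.Im (f p)) ->
  (wint d m f < +oo)%E -> L2r m (fun p => complex.Re (f p)) /\ L2r m (fun p => complex.Im (f p)).
Proof.
move=> m1 m2; rewrite wintE// => h.
have p1 (g : T2 -> R) : (0 <= \int[leb2 R]_(p in (strip R : set T2)) (g p ^+ 2 * rho d m p)%:E)%E.
  by apply: integral_ge0 => p Sp; rewrite lee_fin mulr_ge0 ?sqr_ge0// r0.
by split; split=> //; apply: le_lt_trans h; [rewrite leeDl|rewrite leeDr].
Qed.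

Lemma wseminorm2_ge0 m l (f : R * R -> R[i]) : (0 <= wseminorm2 d m l f)%E.
Proof.
rewrite /wseminorm2; case: ifP => // _; apply: integral_ge0 => p _.
by rewrite lee_fin mulr_ge0 ?powR_ge0// addr_ge0 ?sqr_ge0.
Qed.

Lemma wderiv2P m l (f : R * R -> R[i]) : wderivable2 m l f -> is_wderiv2 m l f (wderiv2 m l f).
Proof. by move=> [g hg]; apply: (@xgetPex _ _ [set g | is_wderiv2 m l f g]); exists g. Qed.

Lemma is_wderiv2_measurable m l (u v : R * R -> R) : is_wderiv2_real m l u v ->
  measurable_fun (strip R : set T2) v.
Proof. by case=> _ [+ _] _. Qed.

Lemma wseminorm2_fin m l (f : R * R -> R[i]) : (wseminorm2 d m l f < +oo)%E ->
  [/\ wderivable2 m l f, L2r m (fun p => complex.Re (wderiv2 m l f p)),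
      L2r m (fun p => complex.Im (wderiv2 m l f p)) & wseminorm2 d m l f = wint d m (wderiv2 m l f)].
Proof.
rewrite /wseminorm2; case: asboolP => // hw hfin; have [w1 w2] := wderiv2P hw.
by have [] := wint_L2 (is_wderiv2_measurable w1) (is_wderiv2_measurable w2) hfin.
Qed.

(** The seminorm is defined through the chosen [wderiv2]; uniqueness almost everywhere lets any
    square-integrable weak derivatives of the two parts compute it. *)
Lemma wseminorm2E m l (f : R * R -> R[i]) g1 g2 :
  is_wderiv2_real m l (fun p => complex.Re (f p)) g1 ->
  is_wderiv2_real m l (fun p => complex.Im (f p)) g2 -> L2r m g1 -> L2r m g2 ->
  wseminorm2 d m l f = (dot m g1 g1 + dot m g2 g2)%:E.
Proof.
move=> w1 w2 L1 L2; have hw : wderivable2 m l f by exists (fun p => g1 p +i* g2 p).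
have [v1 v2] := wderiv2P hw; rewrite /wseminorm2 asboolT//.
have a1 := wderiv2_real_unique w1 v1; have a2 := wderiv2_real_unique w2 v2.
have K1 := ae_L2 a1 (is_wderiv2_measurable v1) L1.
have K2 := ae_L2 a2 (is_wderiv2_measurable v2) L2.
rewrite wint_dot// (ae_dot a1 L1 K1 L1) (ae_dot a2 L2 K2 L2).
by rewrite (ipC (leb2 R) _ _ _ g1) (ipC (leb2 R) _ _ _ g2) (ae_dot a1 L1 K1 K1) (ae_dot a2 L2 K2 K2).
Qed.

Lemma Wn_norm2_ge0 n (f : R * R -> R[i]) : (0 <= Wn_norm2 d n f)%E.
Proof. by apply: sume_ge0 => a _; apply: sume_ge0 => b _; exact: wseminorm2_ge0. Qed.

Lemma wseminorm2_le n m l (f : R * R -> R[i]) : (m <= n)%N -> (l <= n)%N ->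
  (wseminorm2 d m l f <= Wn_norm2 d n f)%E.
Proof.
move=> mn ln; rewrite /Wn_norm2 (bigD1 (inord m : 'I_n.+1))//= inordK//.
rewrite (bigD1 (inord l : 'I_n.+1))//= inordK//.
rewrite -addeA leeDl// adde_ge0//; first by apply: sume_ge0 => b _; exact: wseminorm2_ge0.
by apply: sume_ge0 => a _; apply: sume_ge0 => b _; exact: wseminorm2_ge0.
Qed.

(** The seminorm of order (0,0) measures the chosen [wderiv2 0 0 f] and not f. Since a locally
    integrable f is a weak derivative of itself of order 0, uniqueness identifies the two. *)
Lemma Wn_L2 n (f : R * R -> R[i]) : (Wn_norm2 d n f < +oo)%E ->
  L2r 0 (fun p => complex.Re (f p)) /\ L2r 0 (fun p => complex.Im (f p)).
Proof.
move=> h; have h0 := le_lt_trans (wseminorm2_le f (leq0n n) (leq0n n)) h.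
have [hw L1 L2 _] := wseminorm2_fin h0; have [v1 v2] := wderiv2P hw.
have [l1 l2] : loc_integrable2 (fun p => complex.Re (f p)) /\ loc_integrable2 (fun p => complex.Im (f p)).
  by case: v1 v2 => [? _ _] [? _ _].
have a1 := wderiv2_real_unique v1 (is_wderiv2_real_id l1).
have a2 := wderiv2_real_unique v2 (is_wderiv2_real_id l2).
by split; [apply: (ae_L2 a1 _ L1); case: l1|apply: (ae_L2 a2 _ L2); case: l2].
Qed.

(** The squared length in W^0 of the projection of f on the mode i. It is invariant under rescaling
    of the basis function, so the polynomials may stay unnormalized. *)
Definition energy (f : R * R -> R[i]) (i : nat * nat) : R :=
  (dot 0 (fun p => complex.Re (f p)) (hgb d 0 0 i.1 i.2) ^+ 2 +
   dot 0 (fun p => complex.Im (f p)) (hgb d 0 0 i.1 i.2) ^+ 2) / nrm R d i.1 i.2.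

Lemma energy_ge0 f i : 0 <= energy f i.
Proof. by rewrite divr_ge0 ?addr_ge0 ?sqr_ge0// ltW// (nrm_gt0 R d0). Qed.

Lemma bessel_real n (u : R * R -> R) (v : nat -> nat -> R * R -> R) m l s : L2r 0 u ->
  (forall a b, (a <= n)%N -> (b <= n)%N -> is_wderiv2_real a b u (v a b) /\ L2r a (v a b)) ->
  (m <= n)%N -> (l <= n)%N -> uniq s ->
  \sum_(i <- s) mode R d m l i * (dot 0 u (hgb d 0 0 i.1 i.2) ^+ 2 / nrm R d i.1 i.2) <=
  dot m (v m l) (v m l).
Proof.
move=> Lu H mn ln us.
have H' a b : (a <= m)%N -> (b <= l)%N -> is_wderiv2_real a b u (v a b) /\ L2r a (v a b).
  by move=> am bl; apply: H; [exact: leq_trans mn|exact: leq_trans ln].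
apply: le_trans (bessel_wderiv d0 us H').
rewrite le_eqVlt; apply/orP; left; apply/eqP; apply: eq_bigr => i _.
have [h0 L0] := H 0%N 0%N (leq0n _) (leq0n _).
have a0 := wderiv2_real_unique (is_wderiv2_real_id (L2_loc_integrable Lu)) h0.
by rewrite /mode (ae_dot a0 Lu L0 (L2_basis R d0 _ _ _ _ _)) !mulrA.
Qed.

Lemma bessel_seminorm n (f : R * R -> R[i]) m l s : (Wn_norm2 d n f < +oo)%E ->
  (m <= n)%N -> (l <= n)%N -> uniq s ->
  ((\sum_(i <- s) mode R d m l i * energy f i)%:E <= wseminorm2 d m l f)%E.
Proof.
move=> fin mn ln us; have [Lf1 Lf2] := Wn_L2 fin.
have F a b : (a <= n)%N -> (b <= n)%N -> (wseminorm2 d a b f < +oo)%E.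
  by move=> an bn; apply: le_lt_trans fin; exact: wseminorm2_le.
have [_ L1 L2 ->] := wseminorm2_fin (F m l mn ln).
rewrite wint_dot// lee_fin.
apply: (@le_trans _ _ (
  \sum_(i <- s) mode R d m l i * (dot 0 (fun p => complex.Re (f p)) (hgb d 0 0 i.1 i.2) ^+ 2 / nrm R d i.1 i.2) +
  \sum_(i <- s) mode R d m l i * (dot 0 (fun p => complex.Im (f p)) (hgb d 0 0 i.1 i.2) ^+ 2 / nrm R d i.1 i.2))).
  rewrite -big_split/= le_eqVlt; apply/orP; left; apply/eqP; apply: eq_bigr => i _.
  by rewrite /energy; ring.
have H1 a b : (a <= n)%N -> (b <= n)%N -> is_wderiv2_real a b (fun p => complex.Re (f p))
    (fun p => complex.Re (wderiv2 a b f p)) /\ L2r a (fun p => complex.Re (wderiv2 a b f p)).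
  by move=> an bn; have [/wderiv2P[? _] ? _ _] := wseminorm2_fin (F a b an bn).
have H2 a b : (a <= n)%N -> (b <= n)%N -> is_wderiv2_real a b (fun p => complex.Im (f p))
    (fun p => complex.Im (wderiv2 a b f p)) /\ L2r a (fun p => complex.Im (wderiv2 a b f p)).
  by move=> an bn; have [/wderiv2P[_ ?] _ ? _] := wseminorm2_fin (F a b an bn).
have B1 := @bessel_real n _ (fun a b p => complex.Re (wderiv2 a b f p)) m l s Lf1 H1 mn ln us.
have B2 := @bessel_real n _ (fun a b p => complex.Im (wderiv2 a b f p)) m l s Lf2 H2 mn ln us.
exact: (lerD B1 B2).
Qed.

Definition weight n (i : nat * nat) : R := (maxn i.1 1)%:R ^+ n * (maxn i.2 1)%:R ^+ (2 * n).

Lemma weight_gt0 n i : 0 < weight n i.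
Proof. by rewrite mulr_gt0// exprn_gt0// ltr0n leq_max orbT. Qed.

(** The four modes are the expansion of (1 + lamt)(1 + lamx), in which the 1's take care of the low
    indices. *)
Lemma weight_mode n : exists2 C : R, 0 < C & forall i,
  weight n i <= C * (mode R d 0 0 i + mode R d 0 n i + mode R d n 0 i + mode R d n n i).
Proof.
exists (n%:R ^+ n * n%:R ^+ (2 * n)).
  by have [->|n0] := posnP n; rewrite ?expr0 ?mulr1// mulr_gt0// exprn_gt0// ltr0n.
move=> i; have /andP[l0 _] := lamt_bounds R n i.1; have /andP[x0 _] := lamx_bounds R d0 n i.2.
have x1 : lamx R d 0 i.2 = 1 by rewrite /lamx big_ord0.
have l1 : lamt R 0 i.1 = 1 by rewrite /lamt big_ord0.
apply: (@le_trans _ _ ((n%:R ^+ n * (1 + lamt R n i.1)) * (n%:R ^+ (2 * n) * (1 + lamx R d n i.2)))).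
  by apply: ler_pM; rewrite ?exprn_ge0//; [exact: (lamt_lower R d0)|exact: (lamx_lower R d0)].
rewrite /mode x1 l1; move: (lamt R n i.1) (lamx R d n i.2) (n%:R ^+ n : R) (n%:R ^+ (2 * n) : R) => x y a b.
by rewrite le_eqVlt; apply/orP; left; apply/eqP; ring.
Qed.

Lemma weight_bessel n : exists2 C : R, 0 < C & forall (f : R * R -> R[i]) s,
  (Wn_norm2 d n f < +oo)%E -> uniq s ->
  ((\sum_(i <- s) weight n i * energy f i)%:E <= C%:E * Wn_norm2 d n f)%E.
Proof.
(* Four seminorms enter, each at most the whole squared norm. *)
have [C C0 hC] := weight_mode n; exists (C * 4); first by rewrite mulr_gt0.
move=> f s fin us.
have B m l : (m <= n)%N -> (l <= n)%N ->
    \sum_(i <- s) mode R d m l i * energy f i <= fine (Wn_norm2 d n f).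
  move=> mn ln; rewrite -lee_fin fineK; last by rewrite ge0_fin_numE ?Wn_norm2_ge0.
  by apply: le_trans (wseminorm2_le f mn ln); exact: (bessel_seminorm fin).
rewrite -[Wn_norm2 d n f]fineK; last by rewrite ge0_fin_numE ?Wn_norm2_ge0.
rewrite -EFinM lee_fin.
apply: (@le_trans _ _ (\sum_(i <- s) C * (mode R d 0 0 i * energy f i + mode R d 0 n i * energy f i +
  mode R d n 0 i * energy f i + mode R d n n i * energy f i))).
  by apply: ler_sum => i _; rewrite -!mulrDl mulrA ler_wpM2r ?energy_ge0.
rewrite -mulr_sumr -mulrA ler_wpM2l ?(ltW C0)// !big_split/=.
have := B 0%N 0%N (leq0n _) (leq0n _); have := B 0%N n (leq0n _) (leqnn _).
have := B n 0%N (leqnn _) (leq0n _); have := B n n (leqnn _) (leqnn _).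
lra.
Qed.

End complex_norms.

(** * Norm bounds for convergent expansions *)

Section expansions.
Variables (R : realType) (d : nat).
Hypothesis d0 : (0 < d)%N.
Local Notation T2 := (measurableTypeR R * measurableTypeR R)%type.
Local Notation L2r m := (L2w (leb2 R) (strip R : set T2) (rho d m)).
Local Notation dot m := (ip (leb2 R) (strip R : set T2) (rho d m)).

Let mS := @measurable_strip R.
Let mr m := @measurable_rho R d m (strip R).
Let r0 m := @rho_ge0 R d m.

Lemma mode_weight n m l i : (m <= n)%N -> (l <= n)%N ->
  mode R d m l i <= d.+1%:R ^+ n * weight R n i.
Proof.
move=> mn ln; rewrite /mode /weight.
have /andP[x0 x1] := lamx_bounds R d0 m i.2; have /andP[t0 t1] := lamt_bounds R l i.1.
have h (a : R) b c : 1 <= a -> (b <= c)%N -> a ^+ b <= a ^+ c by move=> a1 bc; rewrite ler_weXn2l.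
have k1 : 1 <= (maxn i.1 1)%:R :> R by rewrite ler1n leq_maxr.
have j1 : 1 <= (maxn i.2 1)%:R :> R by rewrite ler1n leq_maxr.
rewrite mulrCA mulrC; apply: ler_pM => //; first by apply: (le_trans t1); exact: h.
apply: (le_trans x1); rewrite exprMn -exprM; apply: ler_pM; rewrite ?exprn_ge0//.
  by apply: h => //; rewrite ler1n.
by apply: h => //; rewrite leq_mul2l mn orbT.
Qed.

Definition cf (u : R * R -> R) (i : nat * nat) : R := dot 0 u (hgb d 0 0 i.1 i.2) / nrm R d i.1 i.2.

Definition gconv (u : R * R -> R) (a : nat * nat -> R) : Prop :=
  dot 0 (fun p => u p - psum d a 0 0 (square N) p) (fun p => u p - psum d a 0 0 (square N) p)
    @[N --> \oo] --> 0.

Lemma conv_cf u a : L2r 0 u -> gconv u a -> cf u = a.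
Proof.
move=> Lu cu; apply/funext => -[k j]; rewrite /cf/= (psum_coef d0 _ _ Lu cu) mulfK//.
by rewrite gt_eqF// (nrm_gt0 R d0).
Qed.

Lemma convB u v a b : L2r 0 u -> L2r 0 v -> gconv u a -> gconv v b ->
  gconv (fun p => u p - v p) (fun i => a i - b i).
Proof.
move=> Lu Lv cu cv; have LB (w : R * R -> R) c N : L2r 0 w -> L2r 0 (fun p => w p - psum d c 0 0 (square N) p).
  by move=> Lw; apply: (L2wB mS (mr 0) (@r0 0) Lw); exact: (L2_psum d0).
have h : 2 * (dot 0 (fun p => u p - psum d a 0 0 (square N) p) (fun p => u p - psum d a 0 0 (square N) p) +
  dot 0 (fun p => v p - psum d b 0 0 (square N) p) (fun p => v p - psum d b 0 0 (square N) p)) @[N --> \oo] --> 0.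
  by have := @cvgMr _ _ _ _ _ (2 : R) _ (cvgD cu cv); rewrite addr0 mulr0; exact.
apply: (squeeze_cvgr _ (cvg_cst 0) h); apply: nearW => N.
rewrite (ip_ge0 (leb2 R) (@r0 0))/=.
apply: le_trans (ipBB_le mS (mr 0) (@r0 0) (LB _ a N Lu) (LB _ b N Lv)).
rewrite le_eqVlt; apply/orP; left; apply/eqP; apply: eq_ip => p _.
  by rewrite /psum (eq_bigr (fun i => a i * hgb d 0 0 i.1 i.2 p - b i * hgb d 0 0 i.1 i.2 p)) ?sumrB; [ring|move=> i _; ring].
by rewrite /psum (eq_bigr (fun i => a i * hgb d 0 0 i.1 i.2 p - b i * hgb d 0 0 i.1 i.2 p)) ?sumrB; [ring|move=> i _; ring].
Qed.

Lemma big_sub_seq (V : nmodType) (s t : seq (nat * nat)) (F : nat * nat -> V) :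
  uniq s -> uniq t -> {subset s <= t} -> \sum_(i <- s) F i = \sum_(i <- t | i \in s) F i.
Proof.
move=> us ut st; have pe : perm_eq s [seq i <- t | i \in s]; last first.
  by rewrite -[RHS]big_filter; exact: perm_big.
apply: uniq_perm => //; first exact: filter_uniq.
by move=> i; rewrite mem_filter; case: (boolP (i \in s)) => //= /st.
Qed.

Lemma square_absorbs (s : seq (nat * nat)) : exists M, forall N, (M <= N)%N -> {subset s <= square N}.
Proof.
elim: s => [|i s [M IH]]; first by exists 0%N.
exists (maxn M (maxn i.1 i.2).+1) => N hN k; rewrite inE => /orP[/eqP->|ks].
  by move: hN; rewrite mem_square geq_max gtn_max => /andP[].
by apply: IH ks; apply: leq_trans hN; exact: leq_maxl.
Qed.

(** Once the square contains [s] the difference is identically 0. *)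
Lemma conv_psum a s : uniq s -> gconv (psum d a 0 0 s) (fun i => a i * (i \in s)%:R).
Proof.
move=> us; have [M hM] := square_absorbs s.
apply: cvg_near_cst; exists M => // N /= MN.
rewrite -[RHS](ip0l (leb2 R) (rho d 0) mS (fun=> 0)).
have e p : psum d a 0 0 s p - psum d (fun i => a i * (i \in s)%:R) 0 0 (square N) p = 0.
  apply/eqP; rewrite subr_eq0; apply/eqP.
  rewrite /psum (big_sub_seq _ us (uniq_square N) (hM _ MN)) big_mkcond; apply: eq_bigr => i _.
  by case: (i \in s); rewrite ?mulr1 ?mulr0 ?mul0r.
by apply: eq_ip.
Qed.

Definition expands (f : R * R -> R[i]) : Prop :=
  [/\ L2r 0 (fun p => complex.Re (f p)), L2r 0 (fun p => complex.Im (f p)),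
      gconv (fun p => complex.Re (f p)) (cf (fun p => complex.Re (f p))) &
      gconv (fun p => complex.Im (f p)) (cf (fun p => complex.Im (f p)))].

Lemma energyE f i : energy d f i =
  (cf (fun p => complex.Re (f p)) i ^+ 2 + cf (fun p => complex.Im (f p)) i ^+ 2) * nrm R d i.1 i.2.
Proof. by rewrite /energy /cf; field; rewrite gt_eqF// (nrm_gt0 R d0). Qed.

Definition part (f : R * R -> R[i]) (s : seq (nat * nat)) (p : R * R) : R[i] :=
  psum d (cf (fun p => complex.Re (f p))) 0 0 s p +i* psum d (cf (fun p => complex.Im (f p))) 0 0 s p.

(** Coefficients are determined by any convergent expansion ([conv_cf]), so those of a partial sum
    are known without evaluating an inner product. *)
Lemma expands_part f s : uniq s -> expands (part f s) /\
  forall i, energy d (part f s) i = (i \in s)%:R * energy d f i.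
Proof.
move=> us; set a1 := cf (fun p => complex.Re (f p)); set a2 := cf (fun p => complex.Im (f p)).
have L1 : L2r 0 (psum d a1 0 0 s) by exact: (L2_psum d0).
have L2 : L2r 0 (psum d a2 0 0 s) by exact: (L2_psum d0).
have c1 := conv_psum a1 us; have c2 := conv_psum a2 us.
have e1 := conv_cf L1 c1; have e2 := conv_cf L2 c2.
split; last first.
  move=> i; rewrite !energyE -/a1 -/a2.
  change ((cf (psum d a1 0 0 s) i ^+ 2 + cf (psum d a2 0 0 s) i ^+ 2) * nrm R d i.1 i.2 =
    (i \in s)%:R * ((a1 i ^+ 2 + a2 i ^+ 2) * nrm R d i.1 i.2)).
  by rewrite e1 e2; case: (i \in s) => /=; ring.
split; [exact: L1|exact: L2| |].
  by change (gconv (psum d a1 0 0 s) (cf (psum d a1 0 0 s))); rewrite e1.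
by change (gconv (psum d a2 0 0 s) (cf (psum d a2 0 0 s))); rewrite e2.
Qed.

Lemma expands_rem f s : expands f -> uniq s -> expands (fun p => f p - part f s p) /\
  forall i, energy d (fun p => f p - part f s p) i = (i \notin s)%:R * energy d f i.
Proof.
move=> [Lf1 Lf2 cf1 cf2] us.
set a1 := cf (fun p => complex.Re (f p)); set a2 := cf (fun p => complex.Im (f p)).
have L1 : L2r 0 (psum d a1 0 0 s) by exact: (L2_psum d0).
have L2 : L2r 0 (psum d a2 0 0 s) by exact: (L2_psum d0).
have c1 := convB Lf1 L1 cf1 (conv_psum a1 us); have c2 := convB Lf2 L2 cf2 (conv_psum a2 us).
have K1 := L2wB mS (mr 0) (@r0 0) Lf1 L1; have K2 := L2wB mS (mr 0) (@r0 0) Lf2 L2.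
have e1 := conv_cf K1 c1; have e2 := conv_cf K2 c2.
have E1 : (fun p => complex.Re (f p - part f s p)) = (fun p => complex.Re (f p) - psum d a1 0 0 s p).
  by apply/funext => p; rewrite raddfB.
have E2 : (fun p => complex.Im (f p - part f s p)) = (fun p => complex.Im (f p) - psum d a2 0 0 s p).
  by apply/funext => p; rewrite raddfB.
split; first by split; [rewrite E1; exact: K1|rewrite E2; exact: K2|rewrite E1 e1; exact: c1|rewrite E2 e2; exact: c2].
move=> i; rewrite !energyE E1 E2 e1 e2 -/a1 -/a2.
by case: (i \in s) => /=; ring.
Qed.

Lemma series_norm n : exists2 C : R, 0 < C & forall f (B : R), expands f ->
  (forall N, \sum_(i <- square N) weight R n i * energy d f i <= B) ->
  (Wn_norm2 d n f <= (C * B)%:E)%E.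
Proof.
(* One term for each of the (n+1)^2 orders: (d+1)^n comes from [mode_weight], and the factor 2 from
   the real and imaginary parts. *)
exists (\sum_(j < n.+1) \sum_(k < n.+1) (d.+1%:R ^+ n *+ 2)).
  by rewrite !sumr_const !card_ord !pmulrn_rgt0// exprn_gt0// ltr0n.
move=> f B [L1 L2 c1 c2] HB.
rewrite mulr_suml -sumEFin; apply: lee_sum => m _.
rewrite mulr_suml -sumEFin; apply: lee_sum => l _.
have mn : (m <= n)%N by rewrite -ltnS. have ln : (l <= n)%N by rewrite -ltnS.
have D0 : 0 <= (d.+1%:R : R) ^+ n by rewrite exprn_ge0.
have H (a : nat * nat -> R) : (forall i, a i ^+ 2 * nrm R d i.1 i.2 <= energy d f i) -> forall N,
    \sum_(i <- square N) mode R d m l i * (a i ^+ 2 * nrm R d i.1 i.2) <= d.+1%:R ^+ n * B.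
  move=> aE N; apply: le_trans (ler_wpM2l D0 (HB N)); rewrite mulr_sumr; apply: ler_sum => i _.
  rewrite [leRHS]mulrA; apply: ler_pM => //; first exact: (mode_ge0 R d0).
    by rewrite mulr_ge0 ?sqr_ge0// ltW// (nrm_gt0 R d0).
  exact: mode_weight.
have [|g1 [w1 K1 _ b1]] := psum_limit d0 (m := m) (l := l) L1 c1 (H _ _).
  by move=> i; rewrite energyE mulrDl lerDl mulr_ge0 ?sqr_ge0// ltW// (nrm_gt0 R d0).
have [|g2 [w2 K2 _ b2]] := psum_limit d0 (m := m) (l := l) L2 c2 (H _ _).
  by move=> i; rewrite energyE mulrDl lerDr mulr_ge0 ?sqr_ge0// ltW// (nrm_gt0 R d0).
by rewrite (wseminorm2E w1 w2 K1 K2) lee_fin mulrnAl mulr2n lerD.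
Qed.

(** The remainder keeps only the energies outside a large square; their weighted sum is a tail,
    brought down to e/(2C), which [series_norm] turns into a squared norm of at most e/2. *)
Lemma part_near n f B (e : R) : expands f -> 0 < e ->
  (forall N, \sum_(i <- square N) weight R n i * energy d f i <= B) ->
  exists s, uniq s /\ (Wn_norm2 d n (fun p => (f p - part f s p)%R) < e%:E)%E.
Proof.
move=> ef e0 HB; have [C C0 hC] := series_norm n.
set T := fun N => \sum_(i <- square N) weight R n i * energy d f i.
have W0 i : 0 <= weight R n i * energy d f i by rewrite mulr_ge0 ?(energy_ge0 d0)// ltW// weight_gt0.
have tail M N : (M <= N)%N -> T N - T M = \sum_(i <- square N) weight R n i * ((i \notin square M)%:R * energy d f i).
  move=> MN; rewrite /T (big_square_sub _ MN) [X in _ - X]big_mkcond -sumrB; apply: eq_bigr => i _.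
  by case: (i \in square M) => /=; ring.
have ndT M N : (M <= N)%N -> T M <= T N.
  move=> MN; rewrite -subr_ge0 tail//; apply: sumr_ge0 => i _; rewrite mulrCA mulr_ge0//.
have e1 : 0 < e / (2 * C) by rewrite divr_gt0// mulr_gt0.
have [M hM] := nondecreasing_bounded_cauchy ndT HB e1.
exists (square M); split; first exact: uniq_square.
have [ex En] := expands_rem ef (uniq_square M).
apply: (@le_lt_trans _ _ (C * (e / (2 * C)))%:E); last first.
  by rewrite lte_fin (_ : _ * _ = e / 2); [lra|field; rewrite gt_eqF].
apply: hC => // N; rewrite (eq_bigr (fun i => weight R n i * ((i \notin square M)%:R * energy d f i))); last first.
  by move=> i _; rewrite En.
apply: (@le_trans _ _ (T (maxn M N) - T M)); last by apply: hM => //; exact: leq_maxl.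
rewrite tail ?leq_maxl// (big_square_sub _ (leq_maxr M N)) big_mkcond; apply: ler_sum => i _.
by case: ifP => _ //; rewrite mulrCA mulr_ge0.
Qed.

End expansions.

(** * Density of tensor products *)

Section damping.
Variables (R : realType).
Implicit Types (q : {poly R}) (e t : R).
Local Notation leb := (@lebesgue_measure R).

Definition damp e t : R := expR (- (e * t ^+ 2)).

Lemma is_derive_damp e t : is_derive t (1 : R) (damp e) (- (2 * e * t) * damp e t).
Proof.
have h : is_derive t (1 : R) (fun t => - (e * t ^+ 2)) (- (2 * e * t)).
  have := is_derive_poly (- e *: 'X^2) t; rewrite derivZ derivXn hornerZ hornerMn hornerXn.
  have -> : horner (- e *: 'X^2) = (fun t => - (e * t ^+ 2)).
    by apply/funext => s; rewrite hornerZ hornerXn mulNr.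
  by congr is_derive; rewrite /=; ring.
have := @is_derive_comp R expR (fun t => - (e * t ^+ 2)) t _ _ (is_derive_expR (- (e * t ^+ 2))) h.
by rewrite mulrC.
Qed.

Lemma smooth_damp e : smooth (damp e).
Proof.
have -> : damp e = (fun t => expR ((- e *: 'X^2 : {poly R}).[t])).
  by apply/funext => t; rewrite hornerZ hornerXn mulNr.
by apply: smooth_comp; [exact: smooth_expR|exact: smooth_horner].
Qed.

(* [undamp e l q] is the derivative of order [l] of [q * (1 - damp e)], in a
   form in which the factor [e] of its bound is visible. *)
Fixpoint undamp e l q t : R :=
  if l is l'.+1 then
    undamp e l' q^`() t + 2 * e * (('X * q)^`(l')).[t] - 2 * e * undamp e l' ('X * q) t
  else q.[t] * (1 - damp e t).

(** A nonnegative polynomial majorant of |undamp|/e that follows the recursion of [undamp]. |p| is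
    replaced by 1 + p^2 in order to stay among polynomials, whose tensors are known to be
    square-integrable. *)
Fixpoint undamp_bound l q : {poly R} :=
  if l is l'.+1 then
    undamp_bound l' q^`() + 2 *: (1 + (('X * q)^`(l')) ^+ 2) + 2 *: undamp_bound l' ('X * q)
  else 'X^2 * (1 + q ^+ 2).

Lemma is_derive_undamp e l q t : is_derive t (1 : R) (undamp e l q) (undamp e l.+1 q t).
Proof.
elim: l q t => [|l IH] q t.
  have h : is_derive t (1 : R) (fun t => 1 + (-1) * damp e t) (0 + (-1) * (- (2 * e * t) * damp e t)).
    by apply: is_derive_add; apply: is_derive_scale; exact: is_derive_damp.
  have := is_derive_mul (is_derive_poly q t) h.
  have -> : (fun y : R => q.[y] * (1 + -1 * damp e y)) = undamp e 0 q.
    by apply/funext => s /=; rewrite mulN1r.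
  by congr is_derive; rewrite /= hornerM hornerX; ring.
have h1 := IH q^`() t; have h2 := is_derive_scale (2 * e) (is_derive_poly ('X * q)^`(l) t).
have h3 := is_derive_scale (- (2 * e)) (IH ('X * q) t).
have := is_derive_add (is_derive_add h1 h2) h3.
have -> : (fun y => undamp e l q^`() y + 2 * e * (('X * q)^`(l)).[y] + - (2 * e) * undamp e l ('X * q) y) =
  undamp e l.+1 q by apply/funext => y /=; ring.
change (undamp e l.+2 q t) with
  (undamp e l.+1 q^`() t + 2 * e * (('X * q)^`(l.+1)).[t] - 2 * e * undamp e l.+1 ('X * q) t).
by congr is_derive; rewrite -derivnS mulNr.
Qed.

Lemma derive1n_undamp e l q : derive1n l (fun t => q.[t] * (1 - damp e t)) = undamp e l q.
Proof.
elim: l => [|l IH]; first by rewrite derive1n0.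
by rewrite derive1nS IH; apply: derive1_is_derive => t; exact: is_derive_undamp.
Qed.

Lemma abs_le_1sq (x : R) : `|x| <= 1 + x ^+ 2.
Proof. have := sqr_ge0 (`|x| - 1); have := real_normK (num_real x); have := normr_ge0 x; nra. Qed.

(** The induction starts from 1 - exp(-e t^2) <= e t^2. In the recursive step the last term carries
    e twice, and e <= 1 disposes of one of them. *)
Lemma undampP e l q t : 0 <= e <= 1 -> `|undamp e l q t| <= e * (undamp_bound l q).[t].
Proof.
move=> /andP[e0 e1]; elim: l q t => [|l IH] q t /=.
  have d1 : 0 <= 1 - damp e t <= e * t ^+ 2.
    rewrite /damp; have := expR_ge1Dx (- (e * t ^+ 2)).
    have : expR (- (e * t ^+ 2)) <= 1 by rewrite -[leRHS]expR0 ler_expR oppr_le0 mulr_ge0 ?sqr_ge0.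
    by move=> ? ?; apply/andP; split; lra.
  rewrite hornerM hornerXn hornerD horner_exp hornerC normrM mulrA mulrC.
  have /andP[d2 d3] := d1.
  by apply: ler_pM => //; [rewrite ger0_norm|exact: abs_le_1sq].
rewrite !hornerD !hornerZ !hornerD horner_exp hornerC !mulrDr.
apply: le_trans (ler_normB _ _) _; apply: lerD.
  apply: le_trans (ler_normD _ _) _; apply: lerD; first exact: IH.
  rewrite normrM ger0_norm ?mulr_ge0//.
  have e20 : 0 <= 2 * e by rewrite mulr_ge0.
  have := ler_wpM2l e20 (abs_le_1sq ((('X * q)^`(l)).[t])); lra.
rewrite normrM ger0_norm ?mulr_ge0//.
apply: (@le_trans _ _ (2 * e * (e * (undamp_bound l ('X * q)).[t]))); first by rewrite ler_wpM2l ?mulr_ge0.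
have B0 : 0 <= (undamp_bound l ('X * q)).[t].
  elim: l {IH} ('X * q) => [|l IH] r /=.
    by rewrite hornerM hornerXn hornerD horner_exp hornerC mulr_ge0 ?sqr_ge0// addr_ge0 ?sqr_ge0.
  by rewrite !hornerD !hornerZ !hornerD horner_exp hornerC !addr_ge0 ?mulr_ge0 ?addr_ge0 ?sqr_ge0.
have : e * (e * (undamp_bound l ('X * q)).[t]) <= e * (undamp_bound l ('X * q)).[t].
  by rewrite ler_wpM2l// ler_piMl.
lra.
Qed.

Fixpoint dampn e l q : {poly R} :=
  if l is l'.+1 then (dampn e l' q)^`() - (2 * e) *: ('X * dampn e l' q) else q.

Lemma derive1n_damp e l q : derive1n l (fun t => q.[t] * damp e t) = (fun t => (dampn e l q).[t] * damp e t).
Proof.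
elim: l => [|l IH]; first by rewrite derive1n0.
rewrite derive1nS IH; apply: derive1_is_derive => t.
have := is_derive_mul (is_derive_poly (dampn e l q) t) (is_derive_damp e t).
by congr is_derive; rewrite /= hornerD hornerN hornerZ hornerM hornerX; ring.
Qed.

Lemma integral_gauss_fin (s : R) : 0 < s -> (\int[leb]_t (expR (- (s * t ^+ 2) / 2))%:E < +oo)%E.
Proof.
move=> s0; set si := Num.sqrt s^-1.
have s2 : si != 0 by rewrite gt_eqF// sqrtr_gt0 invr_gt0.
have pk := normal_peak_gt0 s2.
rewrite (_ : (\int[leb]_t _)%E =
    (\int[leb]_t ((normal_peak si)^-1%:E * (normal_pdf 0 si t)%:E))%E).
  rewrite ge0_integralZl//; last 3 first.
  - by apply/measurable_EFinP; exact: measurable_normal_pdf.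
  - by move=> t _; rewrite lee_fin normal_pdf_ge0.
  - by rewrite lee_fin invr_ge0 ltW.
  by rewrite integral_normal_pdf mule1 ltry.
apply: eq_integral => t _; rewrite -EFinM normal_pdfE// mulKf ?gt_eqF//.
rewrite /normal_fun subr0 sqr_sqrtr ?invr_ge0 ?(ltW s0)//; congr (expR _)%:E.
by rewrite -mulr_natr; field; rewrite gt_eqF.
Qed.

(** Rescaling the variable by sqrt(2e) reduces to [poly_gauss_bound], whose exponent is fixed. *)
Lemma integral_poly_gauss_fin (q : {poly R}) (e : R) : 0 < e ->
  (\int[leb]_t (`|q.[t]| * expR (- (e * t ^+ 2)))%:E < +oo)%E.
Proof.
move=> e0; have s0 : 0 < Num.sqrt (2 * e) by rewrite sqrtr_gt0 mulr_gt0.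
have [C C0 hC] := poly_gauss_bound (q \Po ((Num.sqrt (2 * e))^-1 *: 'X)).
apply: (@le_lt_trans _ _ (\int[leb]_t (C%:E * (expR (- (e * t ^+ 2) / 2))%:E))%E).
  apply: le_integral_nomeas => t _; first by rewrite lee_fin mulr_ge0 ?expR_ge0.
  have := hC (Num.sqrt (2 * e) * t).
  rewrite horner_comp hornerZ hornerX mulKf ?gt_eqF// exprMn sqr_sqrtr ?mulr_ge0 ?(ltW e0)//.
  rewrite -EFinM lee_fin (_ : - (2 * e * t ^+ 2) / 2 = - (e * t ^+ 2)); last by field.
  by rewrite (_ : - (2 * e * t ^+ 2) / 4 = - (e * t ^+ 2) / 2)//; field.
have mE : measurable_fun setT (fun t : R => (expR (- (e * t ^+ 2) / 2))%:E).
  apply/measurable_EFinP; apply: continuous_measurable_fun => t.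
  have : {for t, continuous (fun t => expR ((- (e / 2) *: 'X^2 : {poly R}).[t]))}.
    by apply: smooth_continuous; apply: smooth_comp; [exact: smooth_expR|exact: smooth_horner].
  by congr continuous_at; apply/funext => s; rewrite hornerZ hornerXn; congr expR; field.
rewrite ge0_integralZl//.
by rewrite lte_mul_pinfty//; exact: integral_gauss_fin.
Qed.

End damping.

Section sobolev_members.
Variables (R : realType).
Local Notation leb := (@lebesgue_measure R).

Lemma is_wderiv1_realZ_smooth (I : set R) m c (g : R -> R) : open I -> measurable I ->
  (forall K, compact K -> K `<=` I -> exists2 b : R, 0 < b & K `<=` `[- b, b] /\ `[- b, b] `<=` I) ->
  smooth g -> is_wderiv1_real I m (fun x => c * g x) (fun x => c * derive1n m g x).
Proof.
move=> oI mI KI sg; have sc : smooth (fun x => c * g x).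
  have := smoothM (smooth_horner c%:P) sg; congr smooth.
  by apply/funext => x; rewrite hornerC.
have := is_wderiv1_real_smooth m oI mI KI sc; congr is_wderiv1_real.
elim: m => [|m IH]; first by rewrite !derive1n0.
rewrite derive1nS IH; apply: derive1_is_derive => x; apply: is_derive_scale.
exact: smooth_is_derive1n.
Qed.

Lemma sobolev_poly n (a b : R) (p : {poly R}) :
  sobolev n `]-1, 1[%classic (fun x => (a * p.[x]) +i* (b * p.[x])).
Proof.
move=> m mn; have KI K : compact K -> K `<=` `](-1)%R, (1 : R)[%classic ->
    exists2 b : R, 0 < b & K `<=` `[- b, b] /\ `[- b, b] `<=` `](-1)%R, (1 : R)[%classic.
  (* The compact set is placed in the plane as K x {0}, so that [compact_sub_box] supplies the
     interval. *)
  move=> cK KI; have cK' : compact (K `*` [set (0 : R)]) by apply: compact_setX => //; exact: compact_set1.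
  have KS : K `*` [set (0 : R)] `<=` strip R by move=> [x t] [/= /KI + _]; rewrite /= in_itv.
  have [c [T [c0 c1 T0 Kb]]] := compact_sub_box cK' KS.
  exists c => //; split=> x.
    by move=> Kx; have /boxP[+ _] := Kb (x, 0) (conj Kx erefl); rewrite /= in_itv/= ler_norml.
  by rewrite /= !in_itv/= => /andP[h1 h2]; apply/andP; split; lra.
exists (fun x => (a * derive1n m (horner p) x) +i* (b * derive1n m (horner p) x)); split.
  by split; apply: is_wderiv1_realZ_smooth => //; exact: smooth_horner.
rewrite derive1n_horner; have [C C0 hC] := poly_bound1 (p^`(m)).
apply: (@le_lt_trans _ _ (\int[leb]_(x in `](-1)%R, 1%R[) (cst ((a ^+ 2 + b ^+ 2) * C ^+ 2)%:E) x)%E).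
  apply: le_integral_nomeas => x xI; first by rewrite lee_fin addr_ge0 ?sqr_ge0.
  rewrite lee_fin /sqabs/= !exprMn -mulrDl ler_wpM2l ?addr_ge0 ?sqr_ge0//.
  rewrite -(real_normK (num_real (p^`(m)).[x])) ler_sqr ?nnegrE// hC//.
rewrite integral_cst//= lebesgue_measure_itv/=.
by case: ifPn => _; rewrite ?mule0 ?ltry// -EFinB -EFinM ltry.
Qed.

(** A nonzero polynomial is not square-integrable on the line, so the Hermite factor enters H^n(R)
    only after damping; its derivatives keep the form polynomial times [damp e], and the square of
    [damp e] is [damp (2 * e)]. *)
Lemma sobolev_damp n (q : {poly R}) (e : R) : 0 < e ->
  sobolev n setT (fun t => (q.[t] * damp e t)%:C).
Proof.
move=> e0 m mn; have sq : smooth (fun t => q.[t] * damp e t).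
  by apply: smoothM; [exact: smooth_horner|exact: smooth_damp].
have KI K : compact K -> K `<=` [set: R] ->
    exists2 b : R, 0 < b & K `<=` `[- b, b] /\ `[- b, b] `<=` [set: R].
  move=> cK _; have [M [Mr hM]] := compact_bounded cK.
  exists (`|M| + 1); first by rewrite ltr_wpDl.
  split=> // x Kx; rewrite /= in_itv/= -ler_norml; apply: hM => //.
  by rewrite (le_lt_trans (ler_norm M))// ltrDl.
have w := is_wderiv1_real_smooth m openT measurableT KI sq.
have w0 := is_wderiv1_realZ_smooth m 0 openT measurableT KI sq.
exists (fun t => (derive1n m (fun t => q.[t] * damp e t) t)%:C); split.
  split=> //=; move: w0; congr is_wderiv1_real; apply/funext => t; exact: mul0r.
rewrite derive1n_damp.
have e2 : 0 < 2 * e by rewrite mulr_gt0.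
apply: le_lt_trans (integral_poly_gauss_fin ((dampn e m q) ^+ 2) e2).
apply: le_integral_nomeas => t _; first by rewrite lee_fin addr_ge0 ?sqr_ge0.
rewrite lee_fin /sqabs/= expr0n addr0 horner_exp ger0_norm ?sqr_ge0// exprMn ler_wpM2l ?sqr_ge0//.
rewrite /damp -expRM_natl le_eqVlt; apply/orP; left; apply/eqP; congr expR; rewrite /=; ring.
Qed.

End sobolev_members.

Section density.
Variables (R : realType) (d : nat).
Hypothesis d0 : (0 < d)%N.
Local Notation T2 := (measurableTypeR R * measurableTypeR R)%type.
Local Notation L2r m := (L2w (leb2 R) (strip R : set T2) (rho d m)).
Local Notation dot m := (ip (leb2 R) (strip R : set T2) (rho d m)).

Let mS := @measurable_strip R.
Let mr m := @measurable_rho R d m (strip R).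
Let r0 m := @rho_ge0 R d m.

Lemma wseminorm2D m l (f g : R * R -> R[i]) : (wseminorm2 d m l f < +oo)%E -> (wseminorm2 d m l g < +oo)%E ->
  (wseminorm2 d m l (fun p => (f p + g p)%R) <= 2%:E * (wseminorm2 d m l f + wseminorm2 d m l g))%E.
Proof.
move=> /wseminorm2_fin[/wderiv2P[f1 f2] Lf1 Lf2 _] /wseminorm2_fin[/wderiv2P[g1 g2] Lg1 Lg2 _].
have h1 := is_wderiv2_realD f1 g1; have h2 := is_wderiv2_realD f2 g2.
have K1 := L2wD mS (mr m) (@r0 m) Lf1 Lg1; have K2 := L2wD mS (mr m) (@r0 m) Lf2 Lg2.
have E1 : (fun p => complex.Re (f p + g p)) = (fun p => complex.Re (f p) + complex.Re (g p)).
  by apply/funext => p; rewrite raddfD.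
have E2 : (fun p => complex.Im (f p + g p)) = (fun p => complex.Im (f p) + complex.Im (g p)).
  by apply/funext => p; rewrite raddfD.
rewrite -E1 in h1; rewrite -E2 in h2.
rewrite (wseminorm2E h1 h2 K1 K2) (wseminorm2E f1 f2 Lf1 Lf2) (wseminorm2E g1 g2 Lg1 Lg2).
rewrite -EFinD -EFinM lee_fin.
have D1 := ipDD_le mS (mr m) (@r0 m) Lf1 Lg1; have D2 := ipDD_le mS (mr m) (@r0 m) Lf2 Lg2.
by have := lerD D1 D2; rewrite -mulrDr addrACA.
Qed.

Lemma Wn_norm2D n (f g : R * R -> R[i]) : (Wn_norm2 d n f < +oo)%E -> (Wn_norm2 d n g < +oo)%E ->
  (Wn_norm2 d n (fun p => (f p + g p)%R) <= 2%:E * (Wn_norm2 d n f + Wn_norm2 d n g))%E.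
Proof.
move=> ff fg; rewrite /Wn_norm2 -big_split/= ge0_sume_distrr; last first.
  by move=> i _; rewrite adde_ge0//; apply: sume_ge0 => j _; exact: wseminorm2_ge0.
apply: lee_sum => m _; rewrite -big_split/= ge0_sume_distrr; last first.
  by move=> i _; rewrite adde_ge0//; exact: wseminorm2_ge0.
apply: lee_sum => l _; have mn : (m <= n)%N by rewrite -ltnS. have ln : (l <= n)%N by rewrite -ltnS.
by apply: wseminorm2D; [apply: le_lt_trans ff|apply: le_lt_trans fg]; exact: wseminorm2_le.
Qed.

Lemma Wn_norm2_fin n (f : R * R -> R[i]) : (forall m l : 'I_n.+1, (wseminorm2 d m l f < +oo)%E) ->
  (Wn_norm2 d n f < +oo)%E.
Proof. by move=> h; apply/lte_sum_pinfty => m _; apply/lte_sum_pinfty => l _; exact: h. Qed.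

Lemma Wn_norm2_part n (f : R * R -> R[i]) s : (Wn_norm2 d n (part d f s) < +oo)%E.
Proof.
apply: Wn_norm2_fin => m l.
have w (a : nat * nat -> R) := is_wderiv2_psum d a m l s.
have L (a : nat * nat -> R) : L2r m (psum d a m l s) by exact: (L2_psum d0).
set a1 := cf d (fun p => complex.Re (f p)); set a2 := cf d (fun p => complex.Im (f p)).
by rewrite (@wseminorm2E _ _ m l (part d f s) _ _ (w a1) (w a2) (L a1) (L a2)) ltry.
Qed.

Definition damped (a1 a2 : nat * nat -> R) (e : R) (s : seq (nat * nat)) (p : R * R) : R[i] :=
  \sum_(i <- s) ((a1 i * (geg R d i.2).[p.1]) +i* (a2 i * (geg R d i.2).[p.1])) *
                ((He R i.1).[p.2] * damp e p.2)%:C.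

Lemma sobolev_tensor_damped n a1 a2 e s : 0 < e -> sobolev_tensor n (damped a1 a2 e s).
Proof.
move=> e0; pose i0 : nat * nat := (0%N, 0%N).
exists (size s), (fun k x => let i := nth i0 s k in (a1 i * (geg R d i.2).[x]) +i* (a2 i * (geg R d i.2).[x])),
  (fun k t => let i := nth i0 s k in ((He R i.1).[t] * damp e t)%:C); split.
- by move=> k; exact: sobolev_poly.
- by move=> k; exact: sobolev_damp.
by move=> p _; rewrite /damped (big_nth i0) big_mkord.
Qed.

(** The error of damping a partial sum, differentiated m times in x and l times in t. *)
Definition undamped (a : nat * nat -> R) e m l s (p : R * R) : R :=
  \sum_(i <- s) a i * (((geg R d i.2)^`(m)).[p.1] * undamp e l (He R i.1) p.2).

Lemma is_wderiv2_undamped a e m l s : is_wderiv2_real m l (undamped a e 0 0 s) (undamped a e m l s).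
Proof.
apply: is_wderiv2_real_sum => i; apply: is_wderiv2_realZ.
have sm : smooth (fun t => (He R i.1).[t] * (1 - damp e t)).
  have := smoothM (smooth_horner (He R i.1)) (smoothD (smooth_horner 1) (smoothM (smooth_horner (- 1)%:P) (smooth_damp e))).
  by congr smooth; apply/funext => t; rewrite !hornerC mulN1r.
have := is_wderiv2_real_tensor m l (smooth_horner (geg R d i.2)) sm.
by rewrite derive1n_horner derive1n_undamp derivn0.
Qed.

Lemma measurable_undamp e l q : measurable_fun [set: R] (undamp e l q).
Proof.
by apply: continuous_measurable_fun => t; exact: is_derive_continuous (is_derive_undamp e l q t).
Qed.

(** The error is at most e times a fixed square-integrable G, a finite sum of absolute values of
    polynomials; its squared norm is then at most e^2 <G,G>, and e <= 1. *)
Lemma undamped_small (a : nat * nat -> R) m l s : exists2 K : R, 0 <= K & forall e, 0 < e <= 1 ->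
  L2r m (undamped a e m l s) /\ dot m (undamped a e m l s) (undamped a e m l s) <= e * K.
Proof.
pose G p := \sum_(i <- s) `|a i| * `|tens ((geg R d i.2)^`(m)) (undamp_bound l (He R i.1)) p|.
have LG : L2r m G.
  apply: (L2w_sum mS (mr m) (@r0 m)) => i; apply: (L2wZ mS (mr m) (@r0 m)).
  set q := tens _ _; have Lq : L2r m q by exact: L2_tens.
  have mq : measurable_fun (strip R : set T2) (fun p => `|q p|).
    by apply: measurableT_comp => //; exact: measurable_tens.
  have bq p : strip R p -> Num.norm (Num.norm (q p)) <= Num.norm (q p) by rewrite normr_id.
  by have [] := L2w_le mS (mr m) (@r0 m) mq bq Lq.
exists (dot m G G); first exact: (ip_ge0 (leb2 R) (@r0 m)).
move=> e /andP[e0 e1]; have e01 : 0 <= e <= 1 by rewrite ltW.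
have LeG := L2wZ mS (mr m) (@r0 m) e LG.
have mU : measurable_fun (strip R : set T2) (undamped a e m l s).
  apply: measurable_sum => i; apply: measurable_funM => //; apply: measurable_funM.
    by apply: measurable_comp_fst; apply: continuous_measurable_fun; apply: smooth_continuous; exact: smooth_horner.
  by apply: measurable_comp_snd; exact: measurable_undamp.
have bU p : strip R p -> `|undamped a e m l s p| <= `|e * G p|.
  move=> _; rewrite [leRHS]ger0_norm; last by rewrite mulr_ge0 ?(ltW e0)// sumr_ge0// => i _; rewrite mulr_ge0.
  rewrite /G mulr_sumr; apply: le_trans (ler_norm_sum _ _ _) _; apply: ler_sum => i _.
  rewrite normrM mulrCA ler_wpM2l// /tens !normrM mulrCA ler_wpM2l//.
  apply: le_trans (undampP l (He R i.1) p.2 e01) _.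
  by rewrite ler_wpM2l ?(ltW e0)// ler_norm.
have [LU le1] := L2w_le mS (mr m) (@r0 m) mU bU LeG.
split=> //; apply: (le_trans le1).
rewrite (ipZl mS (mr m) (@r0 m) e LG LeG) (ipZr mS (mr m) (@r0 m) e LG LG).
rewrite ler_wpM2l ?(ltW e0)// ler_piMl//; exact: (ip_ge0 (leb2 R) (@r0 m)).
Qed.

Lemma damped_near n (f : R * R -> R[i]) s (e : R) : 0 < e ->
  exists g, sobolev_tensor n g /\ (Wn_norm2 d n (fun p => (part d f s p - g p)%R) < e%:E)%E.
Proof.
move=> e0; set a1 := cf d (fun p => complex.Re (f p)); set a2 := cf d (fun p => complex.Im (f p)).
have [K1 hK1] := boolp.choice (fun ml : nat * nat =>
  let: ex_intro2 K H1 H2 := undamped_small a1 ml.1 ml.2 s in ex_intro _ K (conj H1 H2)).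
have [K2 hK2] := boolp.choice (fun ml : nat * nat =>
  let: ex_intro2 K H1 H2 := undamped_small a2 ml.1 ml.2 s in ex_intro _ K (conj H1 H2)).
set K : R := \sum_(m < n.+1) \sum_(l < n.+1) (K1 (m : nat, l : nat) + K2 (m : nat, l : nat)).
have K0 : 0 <= K.
  apply: sumr_ge0 => m _; apply: sumr_ge0 => l _.
  by rewrite addr_ge0//; [case: (hK1 (m : nat, l : nat))|case: (hK2 (m : nat, l : nat))].
(* This value makes both x <= 1 and x K < e. *)
set x : R := e / (K + e + 1).
have x01 : 0 < x <= 1.
  by rewrite divr_gt0//= ?ler_pdivrMr; lra.
exists (damped a1 a2 x s); split; first by apply: sobolev_tensor_damped; case/andP: x01.
have reS (F : nat * nat -> R[i]) : complex.Re (\sum_(i <- s) F i) = \sum_(i <- s) complex.Re (F i).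
  by apply: (big_morph (@complex.Re R)) => // -[? ?] [? ?].
have imS (F : nat * nat -> R[i]) : complex.Im (\sum_(i <- s) F i) = \sum_(i <- s) complex.Im (F i).
  by apply: (big_morph (@complex.Im R)) => // -[? ?] [? ?].
have reB (z w : R[i]) : complex.Re (z - w) = complex.Re z - complex.Re w by case: z w => [? ?] [? ?].
have imB (z w : R[i]) : complex.Im (z - w) = complex.Im z - complex.Im w by case: z w => [? ?] [? ?].
have E1 : (fun p => complex.Re (part d f s p - damped a1 a2 x s p)) = undamped a1 x 0 0 s.
  apply/funext => p; rewrite reB /damped reS /= /psum /undamped -sumrB.
  by apply: eq_bigr => i _; rewrite /hgb /tens !derivn0 /= -/a1; ring.
have E2 : (fun p => complex.Im (part d f s p - damped a1 a2 x s p)) = undamped a2 x 0 0 s.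
  apply/funext => p; rewrite imB /damped imS /= /psum /undamped -sumrB.
  by apply: eq_bigr => i _; rewrite /hgb /tens !derivn0 /= -/a2; ring.
apply: (@le_lt_trans _ _ (x * K)%:E); last first.
  by rewrite lte_fin /x mulrAC ltr_pdivrMr; [nra|lra].
rewrite /K mulr_sumr -sumEFin; apply: lee_sum => m _.
rewrite mulr_sumr -sumEFin; apply: lee_sum => l _.
have [L1 b1] := (hK1 (m : nat, l : nat)).2 x x01; have [L2 b2] := (hK2 (m : nat, l : nat)).2 x x01.
have w1 := is_wderiv2_undamped a1 x m l s; have w2 := is_wderiv2_undamped a2 x m l s.
rewrite -E1 in w1; rewrite -E2 in w2.
by rewrite (wseminorm2E w1 w2 L1 L2) lee_fin mulrDr lerD.
Qed.

Lemma Wn_part n (f : R * R -> R[i]) s : Wn d n (part d f s).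
Proof. by split; [exact: Wn_norm2_part|move=> e e0; exact: damped_near]. Qed.

Lemma Wn_expands n (f : R * R -> R[i]) B : expands d f ->
  (forall N, \sum_(i <- square N) weight R n i * energy d f i <= B) -> Wn d n f.
Proof.
move=> ef HB; have [C C0 hC] := series_norm R d0 n.
split; first by apply: le_lt_trans (hC _ _ ef HB) _; rewrite ltry.
(* A quarter for each of the two terms, since [Wn_norm2D] loses a factor 2. *)
move=> e e0; have e4 : 0 < e / 4 by rewrite divr_gt0.
have [s [us hs]] := part_near d0 ef e4 HB; have [g [tg hg]] := damped_near n f s e4.
exists g; split=> //.
have -> : (fun p => f p - g p) = (fun p => (f p - part d f s p) + (part d f s p - g p)).
  by apply/funext => p; rewrite addrA subrK.
apply: le_lt_trans (Wn_norm2D _ _) _; [exact: lt_trans hs (ltry _)|exact: lt_trans hg (ltry _)|].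
apply: (@lt_le_trans _ _ (2%:E * ((e / 4)%:E + (e / 4)%:E))%E).
  have dbl (x y z : \bar R) : (x < z -> y < z -> 2%:E * (x + y) < 2%:E * (z + z))%E.
    by move=> h1 h2; rewrite lte_pmul2l// lteD.
  exact: dbl hs hg.
by rewrite -EFinD -EFinM lee_fin; lra.
Qed.

End density.

(** * Double series and their square partial sums *)

Section double_series.
Variables (R : realType) (E : nat * nat -> R).
Hypothesis E0 : forall i, 0 <= E i.

Lemma square_sumE N : \sum_(i <- square N) E i = \sum_(k < N) \sum_(j < N) E (k : nat, j : nat).
Proof. by rewrite (big_square N (fun k j => E (k, j))); apply: eq_bigr => -[]. Qed.

Lemma square_sum_le_series N :
  ((\sum_(i <- square N) E i)%:E <= \sum_(0 <= k <oo) \sum_(0 <= j <oo) (E (k, j))%:E)%E.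
Proof.
rewrite square_sumE -sumEFin.
apply: (@le_trans _ _ (\sum_(0 <= k < N) \sum_(0 <= j <oo) (E (k, j))%:E)%E); last first.
  by apply: nneseries_lim_ge => k _ _; apply: nneseries_ge0 => j _ _; rewrite lee_fin.
rewrite big_mkord; apply: lee_sum => k _; rewrite -sumEFin -(big_mkord xpredT (fun j => (E (k : nat, j))%:E)).
by apply: nneseries_lim_ge => j _ _; rewrite lee_fin.
Qed.

Lemma sum_le_series (s : seq (nat * nat)) : uniq s ->
  ((\sum_(i <- s) E i)%:E <= \sum_(0 <= k <oo) \sum_(0 <= j <oo) (E (k, j))%:E)%E.
Proof.
move=> us; have [N hN] := square_absorbs s; apply: le_trans (square_sum_le_series N).
rewrite lee_fin (big_sub_seq _ us (uniq_square N) (hN N (leqnn N))) big_mkcond.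
by apply: ler_sum => i _; case: ifP.
Qed.

(** A finite outer sum is exchanged with the inner series; after that every finite rectangle of
    indices lies in a square. *)
Lemma series_le (B : \bar R) : (forall N, ((\sum_(i <- square N) E i)%:E <= B)%E) ->
  (\sum_(0 <= k <oo) \sum_(0 <= j <oo) (E (k, j))%:E <= B)%E.
Proof.
move=> HB; apply: nneseries_le => [k|K]; first by apply: nneseries_ge0 => j _ _; rewrite lee_fin.
rewrite -nneseries_sum_nat; last by move=> k j; rewrite lee_fin.
apply: nneseries_le => [j|J]; first by apply: sume_ge0 => k _; rewrite lee_fin.
apply: le_trans (HB (maxn K J)).
rewrite square_sumE exchange_big/= big_mkord -sumEFin.
rewrite (big_ord_widen (maxn K J) (fun i => \sum_(0 <= j < J) (E (i, j))%:E)%E) ?leq_maxl// big_mkcond.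
apply: lee_sum => k _; case: ifP => _; last by rewrite lee_fin sumr_ge0.
rewrite big_mkord (big_ord_widen (maxn K J) (fun j => (E (k : nat, j))%:E)) ?leq_maxr// big_mkcond.
rewrite -sumEFin; apply: lee_sum => j _; case: ifP => _ //; by rewrite lee_fin.
Qed.

End double_series.

(** * Expansions in the products H_k C_j *)

Section hermite_gegenbauer.
Variables (R : realType) (d : nat).
Hypothesis d0 : (0 < d)%N.
Local Notation T2 := (measurableTypeR R * measurableTypeR R)%type.
Local Notation L2r m := (L2w (leb2 R) (strip R : set T2) (rho d m)).
Local Notation dot m := (ip (leb2 R) (strip R : set T2) (rho d m)).
Local Notation r := ((d%:R - 1) / 2 : R).

Let mS := @measurable_strip R.
Let mr m := @measurable_rho R d m (strip R).
Let r0 m := @rho_ge0 R d m.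

Lemma HGE k j p : HG r k j p = herm_scale R k * hgb d 0 0 k j p.
Proof.
rewrite /HG hermiteE gegenbauer_stdE// /hgb /tens !derivn0; ring.
Qed.

Lemma Rintegral_HG (u : R * R -> R) k j : L2r 0 u ->
  \int[dxdnu R]_(p in strip R) (u p * HG r k j p * jweight d 0 p.1) =
  herm_scale R k * dot 0 u (hgb d 0 0 k j).
Proof.
move=> Lu; have Lb := L2_basis R d0 0 0 0 k j.
rewrite -(ipZr mS (mr 0) (@r0 0) _ Lb Lu) Rintegral_dxdnu.
  by apply: eq_Rintegral => p _; rewrite HGE /rho; ring.
apply: measurable_funM; last exact: (measurable_comp_fst (measurable_jweight _ _)).
apply: measurable_funM; first by case: Lu.
have -> : HG r k j = (fun p => herm_scale R k * hgb d 0 0 k j p) by apply/funext => p; exact: HGE.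
by apply: measurable_funM => //; exact: measurable_tens.
Qed.

(** The factorial of the Hermite normalization cancels against the one in [nrm]. The dimension left
    in the denominator supplies the j^(1-d) that offsets the j^(d-1) of [HG_sum]. *)
Lemma sqabs_HG_coef f k j : L2r 0 (fun p => complex.Re (f p)) -> L2r 0 (fun p => complex.Im (f p)) ->
  sqabs (HG_coef d r f k j) = nrm R d 0 0 / Num.sqrt (2 * pi) / dim_harm R d j * energy d f (k, j).
Proof.
move=> L1 L2; rewrite /sqabs /HG_coef/= !Rintegral_HG// !exprMn -mulrDr herm_scale_sq /energy/=.
have hd := lt0r_neq0 (dim_harm_gt0 R j d0); have hs := lt0r_neq0 (sqrt2pi_gt0 R).
have hk : k`!%:R != 0 :> R by rewrite pnatr_eq0 -lt0n fact_gt0.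
have hn := lt0r_neq0 (nrm_gt0 R d0 k j); have h0 := lt0r_neq0 (nrm00_gt0 R d0).
have -> : nrm R d k j = k`!%:R * nrm R d 0 0 / dim_harm R d j by rewrite -(nrm_dim R d0 k j) mulfK.
move: (ip _ _ _ _ _) (ip _ _ _ _ _) => A B; move: h0 hs hk hd.
move: (nrm _ _ _ _) (Num.sqrt _) (k`!%:R : R) (dim_harm _ _ _) => a b x y h0 hs hk hd.
by field; rewrite hd hs hk h0.
Qed.

(** The squared W^0 distance is the sum of those of the two parts; both are nonnegative, so each is
    squeezed to 0. *)
Lemma HG_expansion_conv (a : nat -> nat -> R[i]) f :
  L2r 0 (fun p => complex.Re (f p)) -> L2r 0 (fun p => complex.Im (f p)) -> HG_expansion d r a f ->
  gconv d (fun p => complex.Re (f p)) (fun i => complex.Re (a i.1 i.2) * herm_scale R i.1) /\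
  gconv d (fun p => complex.Im (f p)) (fun i => complex.Im (a i.1 i.2) * herm_scale R i.1).
Proof.
move=> L1 L2 h; set a1 := fun i : nat * nat => complex.Re (a i.1 i.2) * herm_scale R i.1.
set a2 := fun i : nat * nat => complex.Im (a i.1 i.2) * herm_scale R i.1.
have reS (s : seq (nat * nat)) (F : nat * nat -> R[i]) : complex.Re (\sum_(i <- s) F i) = \sum_(i <- s) complex.Re (F i).
  by apply: (big_morph (@complex.Re R)) => // -[? ?] [? ?].
have imS (s : seq (nat * nat)) (F : nat * nat -> R[i]) : complex.Im (\sum_(i <- s) F i) = \sum_(i <- s) complex.Im (F i).
  by apply: (big_morph (@complex.Im R)) => // -[? ?] [? ?].
have reB (z w : R[i]) : complex.Re (z - w) = complex.Re z - complex.Re w by case: z w => [? ?] [? ?].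
have imB (z w : R[i]) : complex.Im (z - w) = complex.Im z - complex.Im w by case: z w => [? ?] [? ?].
have reM (z : R[i]) (x : R) : complex.Re (z * x%:C) = complex.Re z * x by case: z => [? ?] /=; ring.
have imM (z : R[i]) (x : R) : complex.Im (z * x%:C) = complex.Im z * x by case: z => [? ?] /=; ring.
pose F N p := f p - \sum_(k < N) \sum_(j < N) a k j * (HG r k j p)%:C.
have E1 N : (fun p => complex.Re (F N p)) = (fun p => complex.Re (f p) - psum d a1 0 0 (square N) p).
  apply/funext => p; rewrite /F (big_square N (fun k j => a k j * (HG r k j p)%:C)) reB reS.
  by congr (_ - _); apply: eq_bigr => i _; rewrite reM HGE mulrA.
have E2 N : (fun p => complex.Im (F N p)) = (fun p => complex.Im (f p) - psum d a2 0 0 (square N) p).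
  apply/funext => p; rewrite /F (big_square N (fun k j => a k j * (HG r k j p)%:C)) imB imS.
  by congr (_ - _); apply: eq_bigr => i _; rewrite imM HGE mulrA.
pose x N := dot 0 (fun p => complex.Re (f p) - psum d a1 0 0 (square N) p) (fun p => complex.Re (f p) - psum d a1 0 0 (square N) p).
pose y N := dot 0 (fun p => complex.Im (f p) - psum d a2 0 0 (square N) p) (fun p => complex.Im (f p) - psum d a2 0 0 (square N) p).
have W N : wint d 0 (F N) = (x N + y N)%:E.
  have K1 := L2wB mS (mr 0) (@r0 0) L1 (L2_psum d0 0 a1 0 0 (square N)).
  have K2 := L2wB mS (mr 0) (@r0 0) L2 (L2_psum d0 0 a2 0 0 (square N)).
  by rewrite -E1 in K1; rewrite -E2 in K2; rewrite (wint_dot K1 K2) E1 E2.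
have hxy : x N + y N @[N --> \oo] --> 0.
  have h' : (fun N => (x N + y N)%:E) @ \oo --> (0 : R)%:E.
    by apply: cvg_trans h; apply: near_eq_cvg; apply: nearW => N; rewrite -[RHS]W.
  exact: (fine_cvg h').
have x0 N : 0 <= x N by exact: (ip_ge0 (leb2 R) (@r0 0)).
have y0 N : 0 <= y N by exact: (ip_ge0 (leb2 R) (@r0 0)).
split; apply: (squeeze_cvgr _ (cvg_cst 0) hxy); apply: nearW => N.
  by apply/andP; split; [exact: x0|rewrite lerDl; exact: y0].
by apply/andP; split; [exact: y0|rewrite lerDr; exact: x0].
Qed.

Lemma expands_of_HG (a : nat -> nat -> R[i]) f :
  L2r 0 (fun p => complex.Re (f p)) -> L2r 0 (fun p => complex.Im (f p)) -> HG_expansion d r a f ->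
  expands d f /\ forall k j, energy d f (k, j) =
    nrm R d 0 0 / Num.sqrt (2 * pi) / dim_harm R d j * sqabs (a k j).
Proof.
move=> L1 L2 h; have [c1 c2] := HG_expansion_conv L1 L2 h.
have e1 := conv_cf d0 L1 c1; have e2 := conv_cf d0 L2 c2.
split; first by split; rewrite ?e1 ?e2.
move=> k j; rewrite (energyE d0) e1 e2/= !exprMn -mulrDl herm_scale_sq /sqabs.
have hd := lt0r_neq0 (dim_harm_gt0 R j d0); have hs := lt0r_neq0 (sqrt2pi_gt0 R).
have hk : k`!%:R != 0 :> R by rewrite pnatr_eq0 -lt0n fact_gt0.
have -> : nrm R d k j = k`!%:R * nrm R d 0 0 / dim_harm R d j by rewrite -(nrm_dim R d0 k j) mulfK.
move: (complex.Re _) (complex.Im _) => A B; move: hs hk hd.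
move: (nrm _ _ _ _) (Num.sqrt _) (k`!%:R : R) (dim_harm _ _ _) => x b z y hs hk hd.
by field; rewrite hd hs hk.
Qed.

(** The pairing is proportional to 2(1+r') <x,x> - <1,1>, and <1,1> = (d+1) <x,x> by [nrm_x1],
    whence 2(1+r') = d+1. *)
Lemma HG_orthogonal_order (r' : R) : - (1 / 2) < r' -> HG_orthogonal d r' -> r' = r.
Proof.
move=> hr /(_ 0%N 0%N 0%N 2%N) H; have {H} := H (fun e : (0, 0)%N = (0, 2)%N => ltac:(discriminate e)).
have h1 (x : R) : (1 : {poly R}).[x] = 1 by rewrite -polyC1 hornerC.

have hgb00 (p : R * R) : hgb d 0 0 0 0 p = 1.
  by rewrite /hgb /tens !derivn0 geg0 (h1 p.1) mul1r; exact: h1.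
set c : R := herm_scale R 0; have c0 : c != 0 by rewrite gt_eqF// herm_scale_gt0.
have rn : 1 + 2 * r' != 0 by rewrite gt_eqF//; lra.
pose q : {poly R} := (2 * (1 + r')) *: 'X^2 - 1.
have L1 := L2_basis R d0 0 0 0 0 0; have Lq := @L2_tens R d d0 0 q 1; have LX := @L2_tens R d d0 0 'X^2 1.
have mq : measurable_fun (strip R : set T2) (fun p => c ^+ 2 / (1 + 2 * r') * tens q 1 p * jweight d 0 p.1).
  apply: measurable_funM; last exact: (measurable_comp_fst (measurable_jweight _ _)).
  by apply: measurable_funM => //; exact: measurable_tens.
have -> : \int[dxdnu R]_(p in strip R) (HG r' 0 0 p * HG r' 0 2 p * jweight d 0 p.1) =
    c ^+ 2 / (1 + 2 * r') * dot 0 (hgb d 0 0 0 0) (tens q 1).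
  rewrite -(ipZr mS (mr 0) (@r0 0) _ Lq L1).
  transitivity (\int[dxdnu R]_(p in strip R) (c ^+ 2 / (1 + 2 * r') * tens q 1 p * jweight d 0 p.1)).
    apply: eq_Rintegral => p _; rewrite /HG !hermiteE gegenbauer_std0 gegenbauer_std2// -/c.
    rewrite /tens /q hornerD hornerN hornerZ hornerXn !h1; field; exact: rn.
  rewrite (Rintegral_dxdnu mq); apply: eq_Rintegral => p _.
  by rewrite hgb00 /rho; ring.
have -> : dot 0 (hgb d 0 0 0 0) (tens q 1) = 2 * (1 + r') * nrm R d 0 1 - nrm R d 0 0.
  transitivity (dot 0 (hgb d 0 0 0 0) (fun p => 2 * (1 + r') * tens 'X^2 1 p - hgb d 0 0 0 0 p)).
    apply: eq_ip => // p _; rewrite hgb00 /tens /q hornerD hornerN hornerZ hornerXn !h1; ring.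
  rewrite (ipBr mS (mr 0) (@r0 0) (L2wZ mS (mr 0) (@r0 0) _ LX) L1 L1) (ipZr mS (mr 0) (@r0 0) _ LX L1).
  congr (_ * _ - _); apply: eq_Rintegral => p _.
  rewrite hgb00 /hgb /tens !derivn0 geg1 hornerXn hornerX !h1; ring.
move/eqP; rewrite mulf_eq0 mulf_eq0 expf_eq0/= (negbTE c0) invr_eq0 (negbTE rn)/=.
rewrite -(nrm_x1 R d0 0) -mulrBl mulf_eq0 (gt_eqF (nrm_gt0 R d0 0 1)) orbF => /eqP e.
by lra.
Qed.

(** [weight] with a real exponent; the factor j^(d-1) is left out, being accounted for by the
    dimension. *)
Definition wreal (eta : R) (i : nat * nat) : R := index_pow i.1 eta * index_pow i.2 (2 * eta).

Lemma maxn1_gt0 j : 0 < (maxn j 1)%:R :> R. Proof. by rewrite ltr0n leq_max orbT. Qed.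

Lemma wreal_gt0 eta i : 0 < wreal eta i.
Proof. by rewrite mulr_gt0// powR_gt0// maxn1_gt0. Qed.

Lemma wreal_nat n i : wreal n%:R i = weight R n i.
Proof. by rewrite /wreal /index_pow /weight -natrM !powR_mulrn// ltW// maxn1_gt0. Qed.

Lemma dim_harm_maxn : exists2 C : R, 0 < C & forall j,
  (maxn j 1)%:R ^+ (d - 1) <= C * dim_harm R d j /\ dim_harm R d j <= C * (maxn j 1)%:R ^+ (d - 1).
Proof.
have [C C0 hC] := dim_harm_bounds R d0; exists (Num.max C 1); first by rewrite lt_max C0.
have Cle : C <= Num.max C 1 by rewrite le_max lexx.
move=> [|j]; first by rewrite dim_harm0 expr1n !mulr1 le_max lexx orbT.
have [h1 h2] := hC j.+1 isT; have -> : maxn j.+1 1 = j.+1 by apply/maxn_idPl.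
split; [apply: (le_trans h1)|apply: (le_trans h2)]; rewrite ler_wpM2r//.
by rewrite ltW// dim_harm_gt0.
Qed.

Lemma HG_term : exists c1 c2 : R, [/\ 0 < c1, 0 < c2 & forall f eta k j,
  L2r 0 (fun p => complex.Re (f p)) -> L2r 0 (fun p => complex.Im (f p)) ->
  c1 * (wreal eta (k, j) * energy d f (k, j)) <=
  sqabs (HG_coef d r f k j) * index_pow k eta * index_pow j (d%:R - 1 + 2 * eta) <=
  c2 * (wreal eta (k, j) * energy d f (k, j))].
Proof.
have [C C0 hC] := dim_harm_maxn; set c : R := nrm R d 0 0 / Num.sqrt (2 * pi).
have c0 : 0 < c by rewrite divr_gt0 ?(nrm00_gt0 R d0)// sqrt2pi_gt0.
exists (c / C), (c * C); split; [exact: divr_gt0|exact: mulr_gt0|move=> f eta k j L1 L2].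
rewrite sqabs_HG_coef// -/c.
have D0 := dim_harm_gt0 R j d0; have [b1 b2] := hC j.
have M0 := maxn1_gt0 j.
have -> : index_pow j (d%:R - 1 + 2 * eta) = (maxn j 1)%:R ^+ (d - 1) * index_pow j (2 * eta) :> R.
  rewrite /index_pow powRD; last by rewrite (gt_eqF M0) implybT.
  by rewrite -powR_mulrn ?(ltW M0)// natrB.
have X0 : 0 <= wreal eta (k, j) * energy d f (k, j).
  by rewrite mulr_ge0 ?(energy_ge0 d0)// ltW// wreal_gt0.
rewrite (_ : _ * _ * _ * _ = (c / dim_harm R d j * (maxn j 1)%:R ^+ (d - 1)) * (wreal eta (k, j) * energy d f (k, j))); last first.
  by rewrite /wreal/=; ring.
apply/andP; split; apply: ler_wpM2r => //.
  rewrite ler_pdivrMr// (_ : _ * C = c * (C * (maxn j 1)%:R ^+ (d - 1)) / dim_harm R d j); last by ring.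
  by rewrite ler_pdivlMr// ler_wpM2l ?(ltW c0).
have h := ler_wpM2l (ltW c0) b1; rewrite mulrA in h.
by rewrite [leLHS]mulrAC ler_pdivrMr.
Qed.

Definition energy_sum (eta : R) (f : R * R -> R[i]) : \bar R :=
  (\sum_(0 <= k <oo) \sum_(0 <= j <oo) (wreal eta (k, j) * energy d f (k, j))%:E)%E.

Lemma HG_sum_energy : exists c1 c2 : R, [/\ 0 < c1, 0 < c2 & forall f eta,
  L2r 0 (fun p => complex.Re (f p)) -> L2r 0 (fun p => complex.Im (f p)) ->
  (c1%:E * energy_sum eta f <= HG_sum d eta (HG_coef d r f) <= c2%:E * energy_sum eta f)%E].
Proof.
have [c1 [c2 [c10 c20 H]]] := HG_term; exists c1, c2; split; [exact: c10|exact: c20|move=> f eta L1 L2].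
have X0 k j : 0 <= wreal eta (k, j) * energy d f (k, j).
  by rewrite mulr_ge0 ?(energy_ge0 d0)// ltW// wreal_gt0.
have Z (c : R) : 0 < c -> (c%:E * energy_sum eta f = \sum_(0 <= k <oo) \sum_(0 <= j <oo) (c * (wreal eta (k, j) * energy d f (k, j)))%:E)%E.
  move=> c0; rewrite /energy_sum -nneseriesZl; last first.
    by move=> k _; apply: nneseries_ge0 => j _ _; rewrite lee_fin.
  apply: eq_eseriesr => k _; rewrite -nneseriesZl; last by move=> j _; rewrite lee_fin.
  by apply: eq_eseriesr => j _; rewrite EFinM.
rewrite !Z//; apply/andP; split; apply: lee_nneseries => [k _ _|k _].
- by apply: nneseries_ge0 => j _ _; rewrite lee_fin mulr_ge0// ltW.
- apply: lee_nneseries => [j _ _|j _]; first by rewrite lee_fin mulr_ge0// ltW.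
  by rewrite lee_fin; have /andP[] := H f eta k j L1 L2.
- apply: nneseries_ge0 => j _ _; rewrite lee_fin; have /andP[h _] := H f eta k j L1 L2.
  by apply: le_trans h; rewrite mulr_ge0// ltW.
apply: lee_nneseries => [j _ _|j _]; rewrite lee_fin; have /andP[h h'] := H f eta k j L1 L2 => //.
by apply: le_trans h; rewrite mulr_ge0// ltW.
Qed.

End hermite_gegenbauer.

(** * Interpolation *)

Section power_integral.
Variables (R : realType).
Local Notation leb := (@lebesgue_measure R).

Lemma integral_powR (s x y : R) : s != 0 -> 0 < x -> x < y ->
  (\int[leb]_(z in `[x, y]) (z `^ (s - 1))%:E = ((y `^ s - x `^ s) / s)%:E)%E.
Proof.
move=> s0 x0 xy.
have dF (z : R) : 0 < z -> is_derive z (1 : R) (fun z => s^-1 * z `^ s) (z `^ (s - 1)).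
  move=> z0; have := is_derive_scale s^-1 (is_derive1_powR s z0).
  by rewrite mulKf.
have pos (z : R) : z \in `[x, y] -> 0 < z.
  by rewrite in_itv/= => /andP[h _]; exact: lt_le_trans h.
rewrite (@continuous_FTC2 R (fun z => z `^ (s - 1)) (fun z => s^-1 * z `^ s) x y) //.
- by rewrite -EFinB; congr EFin; rewrite -mulrBr mulrC.
- apply: continuous_in_subspaceT => z /set_mem /= /pos z0.
  exact: is_derive_continuous (is_derive1_powR (s - 1) z0).
- have cc (z : R) : 0 < z -> {for z, continuous (fun z => s^-1 * z `^ s)}.
    by move=> z0; exact: is_derive_continuous (dF z z0).
  split.
  + move=> z zi; have z0 : 0 < z by apply: pos; apply: subset_itv_oo_cc zi.
    by have := dF z z0; case.
  + by apply: cvg_at_right_filter; exact: cc.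
  + by apply: cvg_at_left_filter; apply: cc; exact: lt_trans xy.
move=> z zi; have z0 : 0 < z by apply: pos; apply: subset_itv_oo_cc zi.
by rewrite derive1E; have := dF z z0; case.
Qed.

Lemma integral_exhaust (g : R -> \bar R) (B : \bar R) : measurable_fun setT g -> (forall z, (0 <= g z)%E) ->
  (forall n : nat, (\int[leb]_(z in `[(n.+2%:R^-1)%R, (n.+2%:R)%R]) g z <= B)%E) ->
  (\int[leb]_(z in `]0%R, +oo[) g z <= B)%E.
Proof.
move=> mg g0 HB; pose F n : set R := `[n.+2%:R^-1, n.+2%:R]%classic.
have UF : (`]0, +oo[%classic : set R) = \bigcup_n F n.
  apply/seteqP; split => [z|z [n _]]; rewrite /F /= !in_itv/= ?andbT; last first.
    by move=> /andP[h _]; apply: lt_le_trans h; rewrite invr_gt0.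
  move=> z0; set n := Num.truncn (Num.max z z^-1); exists n => //=.
  have h : Num.max z z^-1 < n.+2%:R by apply: lt_trans (truncnS_gt _) _; rewrite ltr_nat.
  move: h; rewrite gt_max => /andP[h1 h2]; rewrite in_itv/= (ltW h1) andbT.
  by rewrite -[leRHS]invrK lef_pV2 ?posrE ?invr_gt0// ltW.
rewrite UF.
have ndF : {homo F : n m / (n <= m)%N >-> (n <= m)%O}.
  move=> n m nm; apply/subsetPset => z; rewrite /F/= !in_itv/= => /andP[h1 h2].
  apply/andP; split; last by apply: (le_trans h2); rewrite ler_nat !ltnS.
  by apply: le_trans h1; rewrite lef_pV2 ?posrE// ler_nat !ltnS.
have cv : (\int[leb]_(z in F i) g z)%E @[i --> \oo] --> (\int[leb]_(z in \bigcup_i F i) g z)%E.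
  apply: ge0_nondecreasing_set_cvg_integral => //.
  - by move=> k; exact: measurable_itv.
  - by move=> k; exact: measurable_funTS.
rewrite -(cvg_lim _ cv)//; apply: lime_le; first by apply/cvg_ex; eexists; exact: cv.
by apply: nearW => n; exact: HB.
Qed.

(** The contribution of one mode to the interpolation integrand, per unit of weighted energy: the
    kernel z^(-2 theta - 1) times the size min(1, z^2 L) of the squared K-functional. *)
Definition kweight (theta z L : R) : R := z `^ (- (2 * theta) - 1) * Num.min 1 (z ^+ 2 * L).

Lemma kweight_ge0 theta z L : 0 <= L -> 0 <= kweight theta z L.
Proof. by move=> L0; rewrite mulr_ge0 ?powR_ge0// le_min ler01 mulr_ge0 ?sqr_ge0. Qed.

Lemma measurable_kweight theta L : measurable_fun setT (fun z => kweight theta z L).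
Proof.
apply: measurable_funM; first exact: measurable_powR.
apply: measurable_minr => //; apply: measurable_funM => //; exact: measurable_funX.
Qed.

(** The break is at a = L^(-1/2), where z^2 L = 1. Below it the integrand is L z^(1 - 2 theta),
    above it z^(-2 theta - 1); 0 < theta < 1 makes them integrable at 0 and at infinity, and each
    gives a multiple of L^theta. *)
Lemma integral_kweight_le theta L : 0 < theta < 1 -> 1 <= L ->
  (\int[leb]_(z in `]0%R, +oo[) (kweight theta z L)%:E <=
   (((2 - 2 * theta)^-1 + (2 * theta)^-1) * L `^ theta)%:E)%E.
Proof.
move=> /andP[t0 t1] L1; have L0 : 0 < L by lra.
apply: integral_exhaust => [|z|n].
- by apply/measurable_EFinP; exact: measurable_kweight.
- by rewrite lee_fin kweight_ge0// ltW.
set a := L `^ (- (1 / 2)); have a0 : 0 < a by rewrite powR_gt0.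
have a2 : a ^+ 2 * L = 1.
  rewrite -powR_mulrn ?(ltW a0)// /a -powRrM (_ : - (1 / 2) * 2%:R = - 1); last by field.
  by rewrite powR_inv1 ?(ltW L0)// mulVf// gt_eqF.
have a1 : a <= 1 by rewrite -(powRr0 L) ler_powR//; lra.
have aT : a `^ (- (2 * theta)) = L `^ theta.
  by rewrite /a -powRrM; congr (_ `^ _); field.
(* As a <= 1, this endpoint is below a and at most 1/(n+2), so the two intervals of the split cover
   the exhausting one. *)
set x := a / n.+2%:R; have n2 : 1 < n.+2%:R :> R by rewrite ltr1n.
have x0 : 0 < x by rewrite divr_gt0.
have xa : x < a by rewrite ltr_pdivrMr// ltr_pMr.
have ay : a < n.+2%:R by exact: le_lt_trans n2.
have xn : x <= n.+2%:R^-1 by rewrite /x ler_piMl// invr_ge0.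
apply: (@le_trans _ _ (\int[leb]_(z in `[x, a] `|` `]a, n.+2%:R]) (kweight theta z L)%:E)%E).
  apply: subset_integral_nomeas => [z|z _]; last by rewrite lee_fin kweight_ge0// ltW.
  rewrite /= !in_itv/= => /andP[h1 h2]; have [za|az] := leP z a; [left|right].
    by rewrite (le_trans xn h1).
  by rewrite h2.
rewrite ge0_integral_setU//; last 3 first.
- by apply/measurable_EFinP; apply: measurable_funTS; exact: measurable_kweight.
- by move=> z _; rewrite lee_fin kweight_ge0// ltW.
- apply/disj_setPS => z [] /=; rewrite !in_itv/= => /andP[_ h1] /andP[h2 _].
  by move: (le_lt_trans h1 h2); rewrite ltxx.
rewrite mulrDl EFinD; apply: leeD.
  apply: (@le_trans _ _ (\int[leb]_(z in `[x, a]) (L%:E * (z `^ ((2 - 2 * theta) - 1))%:E))%E).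
    apply: le_integral_nomeas => z /=; rewrite in_itv/= => /andP[h1 _].
      by rewrite lee_fin kweight_ge0// ltW.
    have z0 : 0 < z by exact: lt_le_trans h1.
    rewrite -EFinM lee_fin /kweight; apply: (@le_trans _ _ (z `^ (- (2 * theta) - 1) * (z ^+ 2 * L))).
      by rewrite ler_wpM2l ?powR_ge0// ge_min lexx orbT.
    rewrite -powR_mulrn ?(ltW z0)// mulrA -powRD ?(gt_eqF z0) ?implybT// mulrC.
    rewrite le_eqVlt; apply/orP; left; apply/eqP; congr (_ * _ `^ _); lra.
  rewrite ge0_integralZl//; last 3 first.
  - by apply/measurable_EFinP; apply: measurable_funTS; exact: measurable_powR.
  - by move=> z _; rewrite lee_fin powR_ge0.
  - by rewrite lee_fin ltW.
  rewrite integral_powR//; last by rewrite gt_eqF//; lra.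
  rewrite -EFinM lee_fin mulrA mulrC ler_wpM2l ?invr_ge0//; first by lra.
  apply: (@le_trans _ _ (L * a `^ (2 - 2 * theta))); first by rewrite ler_wpM2l ?(ltW L0)// gerBl powR_ge0.
  rewrite powRD ?(gt_eqF a0) ?implybT// aT powR_mulrn ?(ltW a0)// mulrA [L * _]mulrC a2 mul1r lexx//.
apply: (@le_trans _ _ (\int[leb]_(z in `[a, n.+2%:R]) (z `^ (- (2 * theta) - 1))%:E)%E).
  apply: (@le_trans _ _ (\int[leb]_(z in `]a, n.+2%:R]) (z `^ (- (2 * theta) - 1))%:E)%E).
    apply: le_integral_nomeas => z _; first by rewrite lee_fin kweight_ge0// ltW.
    by rewrite lee_fin /kweight ler_piMr ?powR_ge0// ge_min lexx.
  apply: subset_integral_nomeas => [z|z _]; last by rewrite lee_fin powR_ge0.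
  by rewrite /= !in_itv/= => /andP[/ltW -> ->].
rewrite integral_powR//; last by rewrite oppr_eq0 gt_eqF//; lra.
rewrite lee_fin aT invrN mulrN -mulNr opprB mulrC ler_wpM2l ?invr_ge0//; first by lra.
by rewrite gerBl powR_ge0.
Qed.

(** Restriction to [a, 2a] is enough: the minimum is 1 there, the kernel is at least its value at
    2a, and the length is a. *)
Lemma integral_kweight_ge theta L : 0 < theta -> 1 <= L ->
  ((2 `^ (- (2 * theta) - 1) * L `^ theta)%:E <=
   \int[leb]_(z in `]0%R, +oo[) (kweight theta z L)%:E)%E.
Proof.
move=> t0 L1; have L0 : 0 < L by lra.
set a := L `^ (- (1 / 2)); have a0 : 0 < a by rewrite powR_gt0.
have a2 : a ^+ 2 * L = 1.
  rewrite -powR_mulrn ?(ltW a0)// /a -powRrM (_ : - (1 / 2) * 2%:R = - 1); last by field.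
  by rewrite powR_inv1 ?(ltW L0)// mulVf// gt_eqF.
have aT : a `^ (- (2 * theta)) = L `^ theta.
  by rewrite /a -powRrM; congr (_ `^ _); field.
set c : R := (2 * a) `^ (- (2 * theta) - 1).
apply: (@le_trans _ _ (\int[leb]_(z in `[a, (2 * a)%R]) (cst c%:E) z)%E).
  have lm : (leb [set` `[a, (2 * a)%R]] = a%:E)%E.
    rewrite lebesgue_measure_itv/= lte_fin ifT; last by lra.
    by rewrite -EFinB; congr EFin; lra.
  rewrite integral_cst; last exact: measurable_itv.
  rewrite [X in (_ <= _ * X)%E](_ : _ = a%:E)//= -EFinM lee_fin.
  rewrite /c powRM ?(ltW a0)// -aT -mulrA -[X in _ * (_ * X)](powRr1 (ltW a0)) -powRD ?(gt_eqF a0) ?implybT//.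
  by rewrite subrK.
apply: (@le_trans _ _ (\int[leb]_(z in `[a, (2 * a)%R]) (kweight theta z L)%:E)%E).
  apply: le_integral_nomeas => z /=; rewrite in_itv/= => /andP[h1 h2]; first by rewrite lee_fin powR_ge0.
  have z0 : 0 < z by exact: lt_le_trans h1.
  rewrite lee_fin /kweight (_ : Num.min _ _ = 1) ?mulr1; last first.
    apply/min_idPl; rewrite -a2 ler_wpM2r ?(ltW L0)// ler_sqr ?nnegrE//; exact: ltW.
  have neg : - (2 * theta) - 1 = - (2 * theta + 1) by lra.
  rewrite /c neg !powRN lef_pV2 ?posrE ?powR_gt0//; last by lra.
  by apply: ge0_ler_powR; rewrite ?nnegrE//; lra.
apply: subset_integral_nomeas => [z|z _]; last by rewrite lee_fin kweight_ge0// ltW.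
by rewrite /= !in_itv/= => /andP[h1 _]; rewrite andbT; exact: lt_le_trans h1.
Qed.

End power_integral.

(** * Two-sided bounds of the K-functional *)

Section interpolation.
Variables (R : realType) (d : nat).
Hypothesis d0 : (0 < d)%N.
Local Notation T2 := (measurableTypeR R * measurableTypeR R)%type.
Local Notation L2r m := (L2w (leb2 R) (strip R : set T2) (rho d m)).
Local Notation dot m := (ip (leb2 R) (strip R : set T2) (rho d m)).
Local Notation leb := (@lebesgue_measure R).
Implicit Types f v w : R * R -> R[i].

Let mS := @measurable_strip R.
Let mr m := @measurable_rho R d m (strip R).
Let r0 m := @rho_ge0 R d m.

Let wE_ge0 eta f i : 0 <= wreal eta i * energy d f i.
Proof. by rewrite mulr_ge0 ?(energy_ge0 d0)// ltW// wreal_gt0. Qed.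

Lemma energy_sum_ge0 eta f : (0 <= energy_sum d eta f)%E.
Proof. by apply: nneseries_ge0 => k _ _; apply: nneseries_ge0 => j _ _; rewrite lee_fin. Qed.

Lemma energy_sum_bound eta f (s : seq (nat * nat)) : uniq s -> (energy_sum d eta f < +oo)%E ->
  \sum_(i <- s) wreal eta i * energy d f i <= fine (energy_sum d eta f).
Proof.
move=> us fin; rewrite -lee_fin fineK; last by rewrite ge0_fin_numE ?energy_sum_ge0.
exact: (sum_le_series (wE_ge0 eta f) us).
Qed.

Lemma energy_sum_le_Wn n : exists2 C : R, 0 < C & forall f, (Wn_norm2 d n f < +oo)%E ->
  (energy_sum d n%:R f <= C%:E * Wn_norm2 d n f)%E.
Proof.
have [C C0 hC] := weight_bessel R d0 n; exists C => // f fin.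
apply: (series_le (wE_ge0 n%:R f)) => N; apply: le_trans (hC f _ fin (uniq_square N)).
by rewrite lee_fin; apply: ler_sum => i _; rewrite wreal_nat.
Qed.

Lemma Wn_le_energy_sum n : exists2 C : R, 0 < C & forall f, expands d f ->
  (energy_sum d n%:R f < +oo)%E -> Wn d n f /\ (Wn_norm2 d n f <= C%:E * energy_sum d n%:R f)%E.
Proof.
have [C C0 hC] := series_norm R d0 n; exists C => // f ef fin.
have HB N : \sum_(i <- square N) weight R n i * energy d f i <= fine (energy_sum d n%:R f).
  apply: le_trans (energy_sum_bound (uniq_square N) fin).
  by apply: ler_sum => i _; rewrite wreal_nat.
split; first exact: (Wn_expands d0 ef HB).
apply: le_trans (hC f _ ef HB) _.
by rewrite EFinM fineK// ge0_fin_numE ?energy_sum_ge0.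
Qed.

(** The ratio of the weights of order n+1 and n, that is A = k j^2 with index 0 read as 1. *)
Definition Lam (i : nat * nat) : R := (maxn i.1 1)%:R * (maxn i.2 1)%:R ^+ 2.

Lemma Lam_ge1 i : 1 <= Lam i.
Proof. by rewrite mulr_ege1// ?exprn_ege1// ler1n leq_maxr. Qed.

Lemma weightS n i : weight R n.+1 i = weight R n i * Lam i.
Proof. by rewrite /weight /Lam mulnS exprD exprSr; ring. Qed.

Lemma wreal_Lam n theta i : wreal (n%:R + theta) i = weight R n i * Lam i `^ theta.
Proof.
have k0 := maxn1_gt0 R i.1; have j0 := maxn1_gt0 R i.2.
rewrite -wreal_nat /wreal /index_pow /Lam powRM ?exprn_ge0 ?ltW// -powR_mulrn ?(ltW j0)// -powRrM mulrDr.
by rewrite !powRD ?(gt_eqF k0) ?(gt_eqF j0) ?implybT//; ring.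
Qed.

Lemma energy_split f v w i : (forall p, strip R p -> f p = v p + w p) ->
  L2r 0 (fun p => complex.Re (v p)) -> L2r 0 (fun p => complex.Im (v p)) ->
  L2r 0 (fun p => complex.Re (w p)) -> L2r 0 (fun p => complex.Im (w p)) ->
  energy d f i <= 2 * (energy d v i + energy d w i).
Proof.
move=> fvw v1 v2 w1 w2; have Lb := L2_basis R d0 0 0 0 i.1 i.2.
have E1 : dot 0 (fun p => complex.Re (f p)) (hgb d 0 0 i.1 i.2) =
    dot 0 (fun p => complex.Re (v p)) (hgb d 0 0 i.1 i.2) + dot 0 (fun p => complex.Re (w p)) (hgb d 0 0 i.1 i.2).
  rewrite -(ipDl mS (mr 0) (@r0 0) v1 w1 Lb); apply: eq_ip => // p Sp.
  by rewrite fvw//; case: (v p) (w p) => [? ?] [? ?].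
have E2 : dot 0 (fun p => complex.Im (f p)) (hgb d 0 0 i.1 i.2) =
    dot 0 (fun p => complex.Im (v p)) (hgb d 0 0 i.1 i.2) + dot 0 (fun p => complex.Im (w p)) (hgb d 0 0 i.1 i.2).
  rewrite -(ipDl mS (mr 0) (@r0 0) v2 w2 Lb); apply: eq_ip => // p Sp.
  by rewrite fvw//; case: (v p) (w p) => [? ?] [? ?].
rewrite /energy E1 E2 -mulrDl mulrA ler_wpM2r ?invr_ge0 ?(ltW (nrm_gt0 R d0 _ _))//.
move: (ip _ _ _ _ _) (ip _ _ _ _ _) (ip _ _ _ _ _) (ip _ _ _ _ _) => a b c e.
have := sqr_ge0 (a - b); have := sqr_ge0 (c - e); nra.
Qed.

Definition kterm n z f i : R := weight R n i * Num.min 1 (z ^+ 2 * Lam i) * energy d f i.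

Lemma min_ge0 (z : R) i : 0 <= Num.min 1 (z ^+ 2 * Lam i).
Proof. by rewrite le_min ler01 mulr_ge0 ?sqr_ge0// (le_trans ler01 (Lam_ge1 i)). Qed.

Lemma kterm_ge0 n z f i : 0 <= kterm n z f i.
Proof.
apply: mulr_ge0 (energy_ge0 d0 f i).
by apply: mulr_ge0; [exact: ltW (weight_gt0 R n i)|exact: min_ge0].
Qed.

(** M <= 1 is spent on the rough part e and M <= z^2 L on the smooth part g. *)
Lemma interp_term_le (W M e g L z2 : R) : 0 <= W -> 0 <= e -> 0 <= g -> M <= 1 -> M <= z2 * L ->
  W * M * (2 * (e + g)) <= 2 * (W * e + z2 * (W * L * g)).
Proof.
move=> W0 e0 g0 M1 ML.
rewrite -subr_ge0 (_ : _ - _ = 2 * (W * ((1 - M) * e + (z2 * L - M) * g))); last by ring.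
by rewrite mulr_ge0// mulr_ge0// addr_ge0// mulr_ge0// subr_ge0.
Qed.

(** For each admissible splitting f = v + w the energies of f are bounded by those of v and w, and
    these by the norms of W^n and W^(n+1) through Bessel's inequality; if there is no splitting, the
    infimum is infinite. *)
Lemma Kfun_lower n : exists2 C : R, 0 < C & forall f z (s : seq (nat * nat)), 0 < z -> uniq s ->
  ((C * \sum_(i <- s) kterm n z f i)%:E <= Kfun d n z f ^+ 2)%E.
Proof.
have [C1 C10 h1] := weight_bessel R d0 n; have [C2 C20 h2] := weight_bessel R d0 n.+1.
set C := Num.max C1 C2; have C0 : 0 < C by rewrite lt_max C10.
have C1C : C1 <= C by rewrite le_max lexx. have C2C : C2 <= C by rewrite le_max lexx orbT.
exists (2 * C)^-1; first by rewrite invr_gt0 mulr_gt0.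
move=> f z s z0 us; set S := \sum_(i <- s) _.
have S0 : 0 <= S by apply: sumr_ge0 => i _; exact: kterm_ge0.
set x := Num.sqrt ((2 * C)^-1 * S).
have x0 : 0 <= x by exact: sqrtr_ge0.
have xK : (x%:E <= Kfun d n z f)%E.
  apply/ereal_infP => _ [v [w [[fv _] [fw _] fvw ->]]].
  have [v1 v2] := Wn_L2 fv; have [w1 w2] := Wn_L2 fw.
  have hv := h1 v s fv us; have hw := h2 w s fw us.
  have nv := Wn_norm2_ge0 d n v; have nw := Wn_norm2_ge0 d n.+1 w.
  have Ev : Wn_norm2 d n v = (fine (Wn_norm2 d n v))%:E by rewrite fineK// ge0_fin_numE.
  have Ew : Wn_norm2 d n.+1 w = (fine (Wn_norm2 d n.+1 w))%:E by rewrite fineK// ge0_fin_numE.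
  set a := fine (Wn_norm2 d n v); set b := fine (Wn_norm2 d n.+1 w).
  have a0 : 0 <= a by rewrite fine_ge0. have b0 : 0 <= b by rewrite fine_ge0.
  have ha : \sum_(i <- s) weight R n i * energy d v i <= C * a.
    apply: (@le_trans _ _ (C1 * a)); last by rewrite ler_wpM2r.
    by rewrite -lee_fin EFinM fineK// ge0_fin_numE.
  have hb : \sum_(i <- s) weight R n.+1 i * energy d w i <= C * b.
    apply: (@le_trans _ _ (C2 * b)); last by rewrite ler_wpM2r.
    by rewrite -lee_fin EFinM fineK// ge0_fin_numE.
  have hS : S <= 2 * C * (a + z ^+ 2 * b).
    apply: (@le_trans _ _ (2 * (\sum_(i <- s) weight R n i * energy d v i +
        z ^+ 2 * \sum_(i <- s) weight R n.+1 i * energy d w i))); last first.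
      rewrite -mulrA ler_wpM2l// mulrDr mulrCA lerD// ler_wpM2l ?sqr_ge0//.
    rewrite [X in _ + X]mulr_sumr -big_split/= mulr_sumr; apply: ler_sum => i _.
    have hs := energy_split i fvw v1 v2 w1 w2.
    have W0 := ltW (weight_gt0 R n i); have e1 := energy_ge0 d0 v i; have e2 := energy_ge0 d0 w i.
    have m0 := min_ge0 z i.
    have m1 : Num.min 1 (z ^+ 2 * Lam i) <= 1 by rewrite ge_min lexx.
    have m2 : Num.min 1 (z ^+ 2 * Lam i) <= z ^+ 2 * Lam i by rewrite ge_min lexx orbT.
    rewrite /kterm weightS; apply: (@le_trans _ _ (weight R n i * Num.min 1 (z ^+ 2 * Lam i) * (2 * (energy d v i + energy d w i)))).
      by rewrite ler_wpM2l// mulr_ge0.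
    exact: interp_term_le.
  rewrite Ev Ew -/a -/b [sqrte _]/= [sqrte _]/= -EFinM -EFinD lee_fin.
  have y0 : 0 <= Num.sqrt a + z * Num.sqrt b by rewrite addr_ge0 ?mulr_ge0 ?sqrtr_ge0// ltW.
  rewrite -(ger0_norm y0) -sqrtr_sqr ler_wsqrtr// ler_pdivrMl ?mulr_gt0//.
  apply: (le_trans hS); rewrite ler_wpM2l ?mulr_ge0 ?(ltW C0)//.
  (* The K-functional adds norms while the bound adds their squares; the difference is a nonnegative
     cross term. *)
  rewrite sqrrD sqr_sqrtr// exprMn sqr_sqrtr// -addrA lerD2l lerDr.
  by rewrite pmulrn_lge0// mulr_ge0 ?sqrtr_ge0// mulr_ge0 ?sqrtr_ge0// ltW.
apply: (@le_trans _ _ (x%:E ^+ 2)%E).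
  by rewrite -EFin_expe lee_fin sqr_sqrtr// mulr_ge0// invr_ge0 mulr_ge0// ltW.
by rewrite !expeS !expe0 !mule1; apply: lee_pmul; rewrite ?lee_fin.
Qed.

Lemma Kfun_ge0 n z f : 0 < z -> (0 <= Kfun d n z f)%E.
Proof.
move=> z0; apply/ereal_infP => _ [v [w [_ _ _ ->]]].
by rewrite adde_ge0 ?sqrte_ge0// mule_ge0 ?sqrte_ge0// lee_fin ltW.
Qed.

Lemma Kfun_upper n : exists2 C : R, 0 < C & forall f z, 0 < z -> expands d f ->
  (energy_sum d n%:R f < +oo)%E ->
  (Kfun d n z f ^+ 2 <= C%:E * \sum_(0 <= k <oo) \sum_(0 <= j <oo) (kterm n z f (k, j))%:E)%E.
Proof.
have [C1 C10 h1] := series_norm R d0 n; have [C2 C20 h2] := series_norm R d0 n.+1.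
exists ((Num.sqrt C1 + Num.sqrt C2) ^+ 2); first by rewrite exprn_gt0// addr_gt0 ?sqrtr_gt0.
move=> f z z0 ef fin; set S := (\sum_(0 <= k <oo) _)%E.
have S0 : (0 <= S)%E by apply: nneseries_ge0 => k _ _; apply: nneseries_ge0 => j _ _; rewrite lee_fin kterm_ge0.
have Sfin : (S < +oo)%E.
  apply: le_lt_trans fin; apply: lee_nneseries => [k _ _|k _].
    by apply: nneseries_ge0 => j _ _; rewrite lee_fin kterm_ge0.
  apply: lee_nneseries => [j _ _|j _]; rewrite lee_fin ?kterm_ge0// wreal_nat /kterm.
  rewrite ler_wpM2r ?(energy_ge0 d0)// ler_piMr ?ge_min ?lexx//; exact: ltW (weight_gt0 _ _ _).
have SE : S = (fine S)%:E by rewrite fineK// ge0_fin_numE.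
set B := fine S; have B0 : 0 <= B by exact: fine_ge0.
have SB (s : seq (nat * nat)) : uniq s -> \sum_(i <- s) kterm n z f i <= B.
  move=> us; rewrite -lee_fin /B -SE; exact: (sum_le_series (kterm_ge0 n z f) us).
(* Modes with z^2 Lam < 1 have Lam < z^-2 < N, and Lam is at least either index, so all of them lie
   in [square N] and [F] contains exactly these modes. *)
set N := (Num.truncn (z ^- 2)).+1.
have hN : z ^- 2 < N%:R by exact: truncnS_gt.
have z2 : 0 < z ^+ 2 by rewrite exprn_gt0.
set F := [seq i <- square N | z ^+ 2 * Lam i < 1].
have uF : uniq F by exact/filter_uniq/uniq_square.
have inF i : (i \in F) = (z ^+ 2 * Lam i < 1).
  rewrite mem_filter; case: ltP => //= h; rewrite mem_square.
  have LN : Lam i < N%:R by apply: lt_trans hN; rewrite -[ltRHS]mulr1 -ltr_pdivrMl ?invr_gt0// invrK.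
  have k1 : 1 <= (maxn i.1 1)%:R :> R by rewrite ler1n leq_maxr.
  have j1 : 1 <= (maxn i.2 1)%:R :> R by rewrite ler1n leq_maxr.
  have k2 : i.1%:R <= (maxn i.1 1)%:R :> R by rewrite ler_nat leq_maxl.
  have j2 : i.2%:R <= (maxn i.2 1)%:R :> R by rewrite ler_nat leq_maxl.
  rewrite -!(ltr_nat R); apply/andP; split; apply: le_lt_trans LN; rewrite /Lam.
    by apply: (le_trans k2); rewrite ler_peMr// ?exprn_ege1//; lra.
  by apply: (le_trans j2); rewrite -[leLHS]mul1r; apply: ler_pM => //; rewrite expr2 ler_peMr//; lra.
have [ew En] := expands_part d0 f uF; have [ev Em] := expands_rem d0 ef uF.
have Bv M : \sum_(i <- square M) weight R n i * energy d (fun p => f p - part d f F p) i <= B.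
  apply: le_trans (SB _ (uniq_square M)); apply: ler_sum => i _; rewrite Em inF /kterm.
  have [h|] /= := boolP (_ < _); first by rewrite mul0r mulr0; exact: (kterm_ge0 n z f i).
  rewrite -leNgt => h.
  by rewrite mul1r ler_wpM2r ?(energy_ge0 d0)// (min_idPl h) mulr1.
(* On the retained modes the minimum is z^2 Lam, so the weight of order n+1 gives z^-2 times
   [kterm]; the factor z in front of the second norm undoes this. *)
have Bw M : \sum_(i <- square M) weight R n.+1 i * energy d (part d f F) i <= z ^- 2 * B.
  apply: (@le_trans _ _ (z ^- 2 * \sum_(i <- square M) kterm n z f i)); last first.
    by rewrite ler_wpM2l ?invr_ge0 ?(ltW z2)// SB ?uniq_square.
  rewrite mulr_sumr; apply: ler_sum => i _; rewrite En inF /kterm weightS.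
  have k0 := kterm_ge0 n z f i; rewrite /kterm in k0.
  have [h|_] /= := boolP (_ < _); last by rewrite mul0r mulr0; apply: mulr_ge0 => //; rewrite invr_ge0 ltW.
  rewrite (min_idPr (ltW h)) mul1r le_eqVlt; apply/orP; left; apply/eqP; field.
  by rewrite gt_eqF.
have nv := h1 _ _ ev Bv; have nw := h2 _ _ ew Bw.
have Wv : Wn d n (fun p => f p - part d f F p) by exact: (Wn_expands d0 ev Bv).
have Ww : Wn d n.+1 (part d f F) by exact: (Wn_part d0).
have K1 : (Kfun d n z f <= ((Num.sqrt C1 + Num.sqrt C2) * Num.sqrt B)%:E)%E.
  apply: (@le_trans _ _ (sqrte (Wn_norm2 d n (fun p => f p - part d f F p)%R) + z%:E * sqrte (Wn_norm2 d n.+1 (part d f F)))%E).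
    apply: ereal_inf_lbound; exists (fun p => f p - part d f F p), (part d f F); split=> //.
    by move=> p _; rewrite subrK.
  have CB1 : (0 <= (C1 * B)%:E)%E by rewrite lee_fin mulr_ge0// ltW.
  have CB2 : (0 <= (C2 * (z ^- 2 * B))%:E)%E.
    by rewrite lee_fin mulr_ge0 ?(ltW C20)// mulr_ge0// invr_ge0 ltW.
  rewrite mulrDl EFinD; apply: leeD.
    apply: (@le_trans _ _ (sqrte (C1 * B)%:E)); first by rewrite (lee_sqrt _ CB1).
    by rewrite /= lee_fin sqrtrM// ltW.
  apply: (@le_trans _ _ (z%:E * sqrte (C2 * (z ^- 2 * B))%:E)%E).
    by rewrite lee_wpmul2l ?lee_fin ?(ltW z0)// (lee_sqrt _ CB2).
  rewrite /= -EFinM lee_fin sqrtrM ?(ltW C20)// sqrtrM ?invr_ge0 ?(ltW z2)// sqrtrV ?(ltW z2)// sqrtr_sqr gtr0_norm//.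
  by rewrite le_eqVlt; apply/orP; left; apply/eqP; field; rewrite gt_eqF.
rewrite SE -/B -EFinM -[in leRHS](sqr_sqrtr B0) -exprMn EFin_expe.
by rewrite !expeS !expe0 !mule1; apply: lee_pmul => //; exact: Kfun_ge0.
Qed.

End interpolation.

(** * Equivalence of the norms for real smoothness *)

Section norm_equivalence.
Variables (R : realType) (d : nat).
Hypothesis d0 : (0 < d)%N.
Local Notation leb := (@lebesgue_measure R).
Implicit Types f : R * R -> R[i].

Let kernelE (theta z : R) : 0 < z -> z `^ (- 2 * theta) / z = z `^ (- (2 * theta) - 1).
Proof.
move=> z0; rewrite mulNr powRB ?(gt_eqF z0) ?implybT// powRr1 //; exact: ltW.
Qed.

Let posP (z : R) : `]0, +oo[%classic z -> 0 < z.
Proof. by rewrite /= in_itv/= andbT. Qed.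

Let fin_scale (c : R) (y : \bar R) : 0 < c -> (y < +oo)%E -> (c%:E * y < +oo)%E.
Proof. by move=> c0 yf; rewrite lte_mul_pinfty// lee_fin ltW. Qed.

Lemma kterm_kweight n theta z f i :
  z `^ (- (2 * theta) - 1) * kterm d n z f i = weight R n i * energy d f i * kweight theta z (Lam R i).
Proof. by rewrite /kterm /kweight; ring. Qed.

Lemma interp_lower n theta : 0 < theta < 1 -> exists2 C : R, 0 < C & forall f,
  (energy_sum d (n%:R + theta) f <= C%:E * interp_norm2 d n theta f)%E.
Proof.
move=> /andP[t0 t1]; have [C C0 hC] := Kfun_lower R d0 n.
set c : R := 2 `^ (- (2 * theta) - 1); have c0 : 0 < c by rewrite powR_gt0.
exists (C * c)^-1; first by rewrite invr_gt0 mulr_gt0.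
move=> f; apply: (@series_le R (fun i => wreal (n%:R + theta) i * energy d f i)) => [i|N].
  by rewrite mulr_ge0 ?(energy_ge0 d0)// ltW// wreal_gt0.
have WE i : 0 <= weight R n i * energy d f i by rewrite mulr_ge0 ?(energy_ge0 d0)// ltW// weight_gt0.
have L0 i : 0 <= Lam R i by exact: le_trans ler01 (Lam_ge1 R i).
rewrite (_ : (\sum_(i <- _) _)%:E = ((C * c)^-1)%:E * (C * c * \sum_(i <- square N) wreal (n%:R + theta) i * energy d f i)%:E)%E; last first.
  by rewrite -EFinM mulrA mulVf ?mul1r// gt_eqF// mulr_gt0.
apply: lee_wpmul2l; first by rewrite lee_fin invr_ge0 ltW// mulr_gt0.
apply: (@le_trans _ _ (\sum_(i <- square N) ((C * (weight R n i * energy d f i))%:E *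
    \int[leb]_(z in `]0%R, +oo[) (kweight theta z (Lam R i))%:E))%E).
  rewrite mulr_sumr -sumEFin; apply: lee_sum => i _.
  rewrite wreal_Lam (_ : _ * _ = C * (weight R n i * energy d f i) * (c * Lam R i `^ theta)); last by ring.
  rewrite EFinM; apply: lee_wpmul2l; first by rewrite lee_fin mulr_ge0// ltW.
  exact: integral_kweight_ge (Lam_ge1 R i).
have mk i : measurable_fun (`]0, +oo[%classic : set (measurableTypeR R)) (fun z => (kweight theta z (Lam R i))%:E).
  by apply/measurable_EFinP; apply: measurable_funTS; exact: measurable_kweight.
have CW i : 0 <= C * (weight R n i * energy d f i) by rewrite mulr_ge0// ltW.
rewrite (eq_bigr (fun i => \int[leb]_(z in `]0%R, +oo[) ((C * (weight R n i * energy d f i))%:E * (kweight theta z (Lam R i))%:E)))%E; last first.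
  move=> i _; have k0 z : `]0, +oo[%classic z -> (0 <= (kweight theta z (Lam R i))%:E)%E.
    by move=> _; rewrite lee_fin kweight_ge0.
  have cw : (0 <= (C * (weight R n i * energy d f i))%:E)%E by rewrite lee_fin.
  by rewrite ge0_integralZl//; exact: mk.
rewrite -ge0_integral_sum//; last 2 first.
- by move=> i; exact: measurable_funeM.
- by move=> i z _; rewrite mule_ge0// lee_fin// kweight_ge0.
apply: le_integral_nomeas => z zp.
  by apply: sume_ge0 => i _; rewrite mule_ge0// lee_fin// kweight_ge0.
have z0 := posP zp; rewrite kernelE//.
apply: (@le_trans _ _ ((z `^ (- (2 * theta) - 1))%:E * (C * \sum_(i <- square N) kterm d n z f i)%:E)%E).
  rewrite -EFinM mulrCA mulr_sumr mulr_sumr -sumEFin; apply: lee_sum => i _.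
  by rewrite -EFinM kterm_kweight lee_fin [leRHS]mulrA.
by apply: lee_wpmul2l; [rewrite lee_fin powR_ge0|exact: hC (uniq_square N)].
Qed.

(** Finiteness at the integral order n makes the splitting of [Kfun_upper] admissible in W^n; the
    double series of bounds is then integrated term by term. *)
Lemma interp_upper n theta : 0 < theta < 1 -> exists2 C : R, 0 < C & forall f, expands d f ->
  (energy_sum d n%:R f < +oo)%E ->
  (interp_norm2 d n theta f <= C%:E * energy_sum d (n%:R + theta) f)%E.
Proof.
move=> t01; have /andP[t0 t1] := t01; have [C C0 hC] := Kfun_upper R d0 n.
set c : R := (2 - 2 * theta)^-1 + (2 * theta)^-1.
have c0 : 0 < c by rewrite addr_gt0// invr_gt0; lra.
exists (C * c); first by rewrite mulr_gt0.
move=> f ef fin.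
have WE i : 0 <= weight R n i * energy d f i by rewrite mulr_ge0 ?(energy_ge0 d0)// ltW// weight_gt0.
have L0 i : 0 <= Lam R i by exact: le_trans ler01 (Lam_ge1 R i).
pose G k j (z : measurableTypeR R) : \bar R := (C * (weight R n (k, j) * energy d f (k, j)) * kweight theta z (Lam R (k, j)))%:E.
have G0 k j z : (0 <= G k j z)%E by rewrite lee_fin mulr_ge0 ?kweight_ge0// mulr_ge0// ltW.
have mG k j : measurable_fun (`]0, +oo[%classic : set (measurableTypeR R)) (G k j).
  apply/measurable_EFinP; apply: measurable_funM => //.
  by apply: measurable_funTS; exact: measurable_kweight.
apply: (@le_trans _ _ (\int[leb]_(z in `]0%R, +oo[) \sum_(0 <= k <oo) \sum_(0 <= j <oo) G k j z)%E).
  apply: le_integral_nomeas => z zp; have z0 := posP zp.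
    by rewrite mule_ge0 ?lee_fin ?divr_ge0 ?powR_ge0 ?(ltW z0)// !expeS expe0 mule1 mule_ge0 ?(Kfun_ge0 _ _ _ z0).
  rewrite kernelE//; set x := z `^ _; have x0 : 0 <= x by exact: powR_ge0.
  apply: (@le_trans _ _ (x%:E * (C%:E * \sum_(0 <= k <oo) \sum_(0 <= j <oo) (kterm d n z f (k, j))%:E))%E).
    by apply: lee_wpmul2l; [rewrite lee_fin|exact: hC].
  rewrite muleA -EFinM -nneseriesZl; last first.
    by move=> k _; apply: nneseries_ge0 => j _ _; rewrite lee_fin (kterm_ge0 d0).
  rewrite le_eqVlt; apply/orP; left; apply/eqP; apply: eq_eseriesr => k _.
  rewrite -nneseriesZl; last by move=> j _; rewrite lee_fin (kterm_ge0 d0).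
  apply: eq_eseriesr => j _; rewrite -EFinM /G; congr EFin.
  by rewrite mulrAC kterm_kweight; ring.
rewrite integral_nneseries//; last 2 first.
- by move=> k; apply: ge0_emeasurable_sum => // j z _ _; exact: G0.
- by move=> k z _; apply: nneseries_ge0 => j _ _; exact: G0.
rewrite /energy_sum -nneseriesZl; last first.
  by move=> k _; apply: nneseries_ge0 => j _ _; rewrite lee_fin mulr_ge0 ?(energy_ge0 d0)// ltW// wreal_gt0.
apply: lee_nneseries => [k _ _|k _]; first by apply: integral_ge0 => z _; apply: nneseries_ge0 => j _ _; exact: G0.
rewrite integral_nneseries// -nneseriesZl; last first.
  by move=> j _; rewrite lee_fin mulr_ge0 ?(energy_ge0 d0)// ltW// wreal_gt0.
apply: lee_nneseries => [j _ _|j _]; first by apply: integral_ge0 => z _; exact: G0.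
apply: (@le_trans _ _ (\int[leb]_(z in `]0%R, +oo[) ((C * (weight R n (k, j) * energy d f (k, j)))%:E * (kweight theta z (Lam R (k, j)))%:E))%E).
  by apply: le_integral_nomeas => z _; [exact: G0|rewrite /G EFinM].
have CW : 0 <= C * (weight R n (k, j) * energy d f (k, j)) by rewrite mulr_ge0// ltW.
rewrite ge0_integralZl//; last 2 first.
- by apply/measurable_EFinP; apply: measurable_funTS; exact: measurable_kweight.
- by move=> z _; rewrite lee_fin kweight_ge0.
apply: (@le_trans _ _ ((C * (weight R n (k, j) * energy d f (k, j)))%:E * (c * Lam R (k, j) `^ theta)%:E)%E).
  by apply: lee_wpmul2l; [rewrite lee_fin|exact: integral_kweight_le t01 (Lam_ge1 R (k, j))].
rewrite wreal_Lam -!EFinM lee_fin le_eqVlt; apply/orP; left; apply/eqP; ring.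
Qed.

Lemma energy_sum_mono (s t : R) f : s <= t -> (energy_sum d s f <= energy_sum d t f)%E.
Proof.
move=> st; have W u i : 0 <= wreal u i * energy d f i by rewrite mulr_ge0 ?(energy_ge0 d0)// ltW// wreal_gt0.
apply: lee_nneseries => [k _ _|k _]; first by apply: nneseries_ge0 => j _ _; rewrite lee_fin W.
apply: lee_nneseries => [j _ _|j _]; first by rewrite lee_fin W.
rewrite lee_fin ler_wpM2r ?(energy_ge0 d0)// /wreal /index_pow.
have m1 i : 1 <= (maxn i 1)%:R :> R by rewrite ler1n leq_maxr.
by apply: ler_pM; rewrite ?powR_ge0// ler_powR//=; lra.
Qed.

Lemma norm_equiv (eta : R) : 0 <= eta -> exists C1 C2 : R, [/\ 0 < C1, 0 < C2 & forall f, expands d f ->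
  (Wspace d eta f -> (energy_sum d eta f <= C1%:E * W_norm2 d eta f)%E) /\
  ((energy_sum d eta f < +oo)%E ->
     Wspace d eta f /\ (W_norm2 d eta f <= C2%:E * energy_sum d eta f)%E)].
Proof.
move=> e0; have /andP[ne en] := truncn_itv e0; set n := Num.truncn eta in ne en *.
have [e|en'] := eqVneq eta n%:R.
  have [C1 C10 h1] := energy_sum_le_Wn R d0 n; have [C2 C20 h2] := Wn_le_energy_sum R d0 n.
  exists C1, C2; split=> [||f ef]; [exact: C10|exact: C20|].
  have WE g : W_norm2 d eta g = Wn_norm2 d n g by rewrite /W_norm2 -/n e eqxx.
  rewrite /Wspace -/n !WE; split=> [[[fin _] _]|fin]; first by rewrite e; exact: h1.
  rewrite e in fin *; have [w1 w2] := h2 f ef fin.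
  by split=> //; split=> //; case: w1.
have t01 : 0 < eta - n%:R < 1.
  by rewrite subr_gt0 lt_def en' ne/= ltrBlDl natr1.
have [C1 C10 h1] := interp_lower n t01; have [C2 C20 h2] := interp_upper n t01.
have [C3 C30 h3] := Wn_le_energy_sum R d0 n.
have eE : n%:R + (eta - n%:R) = eta by rewrite addrC subrK.
rewrite eE in h1; rewrite eE in h2.
exists C1, C2; split=> [||f ef]; [exact: C10|exact: C20|].
have WE g : W_norm2 d eta g = interp_norm2 d n (eta - n%:R) g by rewrite /W_norm2 -/n (negbTE en').
rewrite /Wspace -/n !WE; split=> [_|fin]; first exact: h1.
(* Finiteness at the order eta passes down to n, because all index powers have base at least 1. *)
have finn : (energy_sum d n%:R f < +oo)%E by apply: le_lt_trans fin; exact: energy_sum_mono.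
have up := h2 f ef finn; have [w1 _] := h3 f ef finn.
split=> //; split=> //; apply: le_lt_trans up _.
exact: fin_scale C20 fin.
Qed.

Lemma HG_norm_equiv (eta : R) : 0 <= eta -> exists c1 c2 : R, [/\ 0 < c1, 0 < c2 & forall f,
  (Wn_norm2 d 0 f < +oo)%E -> expands d f ->
  let S := HG_sum d eta (HG_coef d ((d%:R - 1) / 2) f) in
  (Wspace d eta f <-> (S < +oo)%E) /\
  (Wspace d eta f -> (c1%:E * S <= W_norm2 d eta f)%E /\ (W_norm2 d eta f <= c2%:E * S)%E)].
Proof.
move=> e0; have [C1 [C2 [C10 C20 H]]] := norm_equiv e0.
have [b1 [b2 [b10 b20 B]]] := HG_sum_energy R d0.
exists (b2 * C1)^-1, (C2 / b1); split.
- by rewrite invr_gt0 mulr_gt0.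
- exact: divr_gt0.
move=> f f0 ef S; have [L1 L2] := Wn_L2 f0; have [h1 h2] := H f ef.
have /andP[B1 B2] := B f eta L1 L2; rewrite -/S in B1 B2.
have E0 := energy_sum_ge0 d0 eta f.
have B1' : (energy_sum d eta f <= (b1^-1)%:E * S)%E by rewrite lee_pdivlMl.
have imp : Wspace d eta f -> (energy_sum d eta f < +oo)%E.
  move=> W; apply: le_lt_trans (h1 W) _; case: W => _ Wf.
  have W0 : (0 <= W_norm2 d eta f)%E.
    rewrite /W_norm2; case: ifP => _; first exact: Wn_norm2_ge0.
    apply: integral_ge0 => z /posP z0.
    by rewrite mule_ge0 ?lee_fin ?divr_ge0 ?powR_ge0 ?(ltW z0)// !expeS expe0 mule1 mule_ge0 ?(Kfun_ge0 _ _ _ z0).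
  exact: fin_scale C10 Wf.
have S0 : (0 <= S)%E by apply: le_trans B1; rewrite mule_ge0// lee_fin ltW.
split; first split=> [W|Sf].
- by apply: le_lt_trans B2 _; exact: fin_scale b20 (imp W).
- by apply: (h2 _).1; apply: le_lt_trans B1' _; apply: fin_scale Sf; rewrite invr_gt0.
move=> W; split.
  rewrite lee_pdivrMl ?mulr_gt0//; apply: (le_trans B2); rewrite EFinM -muleA.
  by apply: lee_wpmul2l; [rewrite lee_fin ltW|exact: h1].
apply: le_trans (h2 (imp W)).2 _; rewrite EFinM -muleA.
by apply: lee_wpmul2l; [rewrite lee_fin ltW|exact: B1'].
Qed.

End norm_equivalence.

(** * The spatio-temporal power spectrum *)

Section power_spectrum.
Variables (R : realType) (d : nat).
Hypothesis d0 : (0 < d)%N.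
Local Notation T2 := (measurableTypeR R * measurableTypeR R)%type.
Local Notation r := ((d%:R - 1) / 2 : R).

Lemma sqabsM (z : R[i]) (x : R) : sqabs (z * x%:C) = sqabs z * x ^+ 2.
Proof. by case: z => a b; rewrite /sqabs /=; ring. Qed.

Lemma tail_series_le (f g : nat -> \bar R) m : (forall i, (0 <= f i)%E) -> (forall i, (0 <= g i)%E) ->
  (forall i, (m <= i)%N -> (f i <= g i)%E) ->
  (\sum_(m <= i <oo) f i <= \sum_(0 <= i <oo) g i)%E.
Proof.
move=> f0 g0 fg; apply: nneseries_le => // N.
apply: (@le_trans _ _ (\sum_(0 <= i < N) g i)%E); last by apply: nneseries_lim_ge.
rewrite (big_nat_widenl m 0 N)// big_mkcond; apply: lee_sum => i _.
by case: ifP => // /andP[_ mi]; exact: fg.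
Qed.

(** Coefficients dim alpha carry the energy c dim |alpha|^2, and j^(d-1) <= C dim, so the sum is
    bounded by the weighted energy of order n. [F] and [m] are abstract because the l^2 condition
    and the rephrased sum write the terms differently and start at 1 and at n. *)
Lemma power_spectrum_fin n m (psi : R * R -> R[i]) (alpha : nat -> nat -> R[i]) (F : nat -> nat -> R) :
  (0 < m)%N -> Wn d n psi ->
  HG_expansion d r (fun k j => (dim_harm R d j)%:C * alpha k j) psi ->
  (forall k j, 0 <= F k j) ->
  (forall k j, (m <= k)%N -> (m <= j)%N -> F k j = sqabs (alpha k j) * k%:R ^+ n * j%:R ^+ (d - 1 + 2 * n)) ->
  (\sum_(m <= k <oo) \sum_(m <= j <oo) (F k j)%:E < +oo)%E.
Proof.
move=> m0 [fin _] ex F0 FE; have [L1 L2] := Wn_L2 fin.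
have [ef En] := expands_of_HG d0 L1 L2 ex.
have [C C0 hC] := dim_harm_maxn R d0; have [C1 C10 h1] := energy_sum_le_Wn R d0 n.
set c : R := nrm R d 0 0 / Num.sqrt (2 * pi) in En.
have c0 : 0 < c by rewrite divr_gt0 ?(nrm00_gt0 R d0)// sqrt2pi_gt0.
have X0 k j : 0 <= wreal n%:R (k, j) * energy d psi (k, j).
  by rewrite mulr_ge0 ?(energy_ge0 d0)// ltW// wreal_gt0.
apply: (@le_lt_trans _ _ ((C / c)%:E * energy_sum d n%:R psi)%E); last first.
  rewrite lte_mul_pinfty ?lee_fin ?(ltW (divr_gt0 C0 c0))//.
  apply: le_lt_trans (h1 _ fin) _; rewrite lte_mul_pinfty ?lee_fin ?(ltW C10)//.
rewrite /energy_sum -nneseriesZl; last by move=> k _; apply: nneseries_ge0 => j _ _; rewrite lee_fin.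
have Z0 : (0 <= (C / c)%:E)%E by rewrite lee_fin ltW// divr_gt0.
apply: tail_series_le => [k|k|k mk].
- by apply: nneseries_ge0 => j _ _; rewrite lee_fin.
- by rewrite mule_ge0//; apply: nneseries_ge0 => j _ _; rewrite lee_fin.
rewrite -nneseriesZl; last by move=> j _; rewrite lee_fin.
apply: tail_series_le => [j|j|j mj].
- by rewrite lee_fin.
- by rewrite mule_ge0// lee_fin.
rewrite -EFinM lee_fin FE// wreal_nat /weight/= En.
have -> : maxn k 1 = k by apply/maxn_idPl; exact: leq_trans mk.
have Ej : maxn j 1 = j by apply/maxn_idPl; exact: leq_trans mj.
have [b _] := hC j; rewrite Ej in b *; have D0 := dim_harm_gt0 R j d0.
rewrite mulrC [(dim_harm R d j)%:C * _]mulrC sqabsM exprD.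
rewrite (_ : C / c * _ = C * dim_harm R d j * (j%:R ^+ (2 * n) * (sqabs (alpha k j) * k%:R ^+ n))); last first.
  by field; rewrite !gt_eqF.
rewrite -[leLHS]mulrA; apply: ler_wpM2r => //.
by rewrite mulr_ge0 ?exprn_ge0// mulr_ge0 ?exprn_ge0// addr_ge0 ?sqr_ge0.
Qed.

(** The norm of W^n contains the seminorm of order (n,n). The exponent (d-2)/4 + n/2 is half of d/2
    - 1 + n, so squaring the weighted derivative restores the weight of that seminorm. *)
Lemma wderiv2_fin n (psi : R * R -> R[i]) : Wn d n psi ->
  [/\ wderivable2 n n psi, (wint d n (wderiv2 n n psi) < +oo)%E &
   in_L2 (fun p => wderiv2 n n psi p * ((1 - p.1 ^+ 2) `^ ((d%:R - 2) / 4 + n%:R / 2))%:C)].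
Proof.
move=> [fin _]; have fnn := le_lt_trans (wseminorm2_le d psi (leqnn n) (leqnn n)) fin.
have [hw [m1 _] [m2 _] e] := wseminorm2_fin fnn.
have W : (wint d n (wderiv2 n n psi) < +oo)%E by rewrite -e.
split=> //; set g := wderiv2 n n psi; set s : R := (d%:R - 2) / 4 + n%:R / 2.
have ms : measurable_fun (strip R : set T2) (fun p : T2 => (1 - p.1 ^+ 2) `^ s).
  apply: (@measurable_comp_fst R (fun x => (1 - x ^+ 2) `^ s)).
  by apply: (measurableT_comp (measurable_powR _)); apply: measurable_funB => //; exact: measurable_funX.
have reM (z : R[i]) (x : R) : complex.Re (z * x%:C) = complex.Re z * x by case: z => [? ?] /=; ring.
have imM (z : R[i]) (x : R) : complex.Im (z * x%:C) = complex.Im z * x by case: z => [? ?] /=; ring.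
split.
- by under eq_fun do rewrite reM; exact: measurable_funM.
- by under eq_fun do rewrite imM; exact: measurable_funM.
apply: le_lt_trans W; apply: le_integral_nomeas => p Sp.
  by rewrite lee_fin addr_ge0 ?sqr_ge0.
rewrite lee_fin sqabsM /jweight; have /andP[h _] := strip_x Sp.
rewrite -powR_mulrn ?powR_ge0// -powRrM (_ : s * 2%:R = d%:R / 2 - 1 + n%:R)//.
by rewrite /s; field.
Qed.

End power_spectrum.

Theorem theorem4p1 (R : realType) (d : nat) (hd : (0 < d)%N) :
  (forall (r : R) (eta : R),
     - (1 / 2) < r -> HG_orthogonal d r -> 0 <= eta ->
     (forall f : R * R -> R[i],
        Wspace d 0 f ->
        HG_expansion d r
          (fun k j => HG_coef d r f k j / (HG_norm2 d r k j)%:C) f ->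
        (Wspace d eta f <-> (HG_sum d eta (HG_coef d r f) < +oo)%E)) /\
     (exists c1 c2 : R, [/\ 0 < c1, 0 < c2 &
        forall f : R * R -> R[i],
          Wspace d 0 f ->
          HG_expansion d r
            (fun k j => HG_coef d r f k j / (HG_norm2 d r k j)%:C) f ->
          Wspace d eta f ->
          (c1%:E * HG_sum d eta (HG_coef d r f) <= W_norm2 d eta f)%E /\
          (W_norm2 d eta f <= c2%:E * HG_sum d eta (HG_coef d r f))%E])) /\
  (forall (n : nat) (psi : R * R -> R[i]) (alpha : nat -> nat -> R[i]),
     (0 < n)%N -> Wn d n psi ->
     HG_expansion d ((d%:R - 1) / 2)
       (fun k j => (dim_harm R d j)%:C * alpha k j) psi ->
     (in_l2 (fun k j => alpha k j
          * (k%:R `^ (n%:R / 2) * j%:R `^ ((d%:R - 1) / 2 + n%:R))%:C)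
      <->
      wderivable2 n n psi /\
      in_L2 (fun p => wderiv2 n n psi p
          * ((1 - p.1 ^+ 2) `^ ((d%:R - 2) / 4 + n%:R / 2))%:C)) /\
     ((\sum_(n <= k <oo) \sum_(n <= j <oo)
         (sqabs (alpha k j) * k%:R ^+ n * j%:R ^+ (d - 1 + 2 * n))%:E < +oo)%E
      <->
      wderivable2 n n psi /\
      (\int[dxdnu R]_(p in strip R)
         (sqabs (wderiv2 n n psi p)
          * (1 - p.1 ^+ 2) `^ (d%:R / 2 - 1 + n%:R))%:E < +oo)%E)).
Proof.
split=> [r eta hr orth eta0|n psi alpha n0 W ex].
  have e := HG_orthogonal_order hd hr orth; rewrite {r}e in hr orth *.
  have [c1 [c2 [c10 c20 H]]] := HG_norm_equiv hd eta0.
  have fin (f : R * R -> R[i]) : Wspace d 0 f -> (Wn_norm2 d 0 f < +oo)%E.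
    by case=> -[h _] _; move: h; rewrite truncn0.
  have ex (f : R * R -> R[i]) : Wspace d 0 f -> HG_expansion d ((d%:R - 1) / 2)
      (fun k j => HG_coef d ((d%:R - 1) / 2) f k j / (HG_norm2 d ((d%:R - 1) / 2) k j)%:C) f ->
      expands d f.
    by move=> W h; have [L1 L2] := Wn_L2 (fin _ W); have [] := expands_of_HG hd L1 L2 h.
  split=> [f W0 h|]; first by have [] := H f (fin _ W0) (ex _ W0 h).
  exists c1, c2; split=> [||f W0 h W]; [exact: c10|exact: c20|].
  by have [_] := H f (fin _ W0) (ex _ W0 h); apply.
have [hw Wf L] := wderiv2_fin W.
split; split=> // _.
  apply: (power_spectrum_fin hd (ltn0Sn 0) W ex) => [k j|k j k1 j1]; first by rewrite addr_ge0 ?sqr_ge0.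
  (* The l^2 weights are square roots of k^n and j^(d-1+2n); real and natural powers agree on the
     positive indices. *)
  rewrite sqabsM -mulrA; congr (_ * _); rewrite exprMn.
  have k0 : 0 < k%:R :> R by rewrite ltr0n. have j0 : 0 < j%:R :> R by rewrite ltr0n.
  rewrite -!powR_mulrn ?powR_ge0 ?ler0n// -!powRrM; congr (_ `^ _ * _ `^ _); first by field.
  by rewrite natrD natrM natrB//; field.
apply: (power_spectrum_fin hd n0 W ex) => // k j.
by rewrite !mulr_ge0 ?exprn_ge0// addr_ge0 ?sqr_ge0.
Qed.
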